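(* Let $\mathcal{C}$ be the typical cell of the Voronoi tessellation of the Ginibre process and $\mathcal{C}_p$ the typical cell of the Voronoi tessellation of the stationary Poisson process in $\mathbb{C}$ with the same intensity $1/\pi$ (see context). Let $k$ be a positive integer. (a) When $r\to0$, $$EV^k(\mathcal{C}\cap B(r))=EV^k(\mathcal{C}_p\cap B(r))\,(1+r^2W_k+o(r^2)),\qquad W_k=\frac{1}{\pi^{k+1}}\int_{B(1)^k}V(z)\,dz .$$ (b) For every $R>0$, $$EV^k(\mathcal{C}\setminus B(R))\le EV^k(\mathcal{C}_p\setminus B(R))\cdot e^{(3/2)-J(R)},\qquad J(R)=\frac{1}{2\pi^2}\int_{B(R)^2}e^{-|z_1-z_2|^2}\,dz_1\,dz_2 .$$ Hence, there exists a positive constant $c$ such that, for every $R>0$, $$EV^k(\mathcal{C}\setminus B(R))\le EV^k(\mathcal{C}_p\setminus B(R))\cdot e^{(3/2)-cR^2}.$$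
   Context: $B(z,r)\subset\mathbb{C}$ is the disc centered at $z$ with radius $r$, and $B(r)=B(0,r)$. $dz$ is Lebesgue measure on $\mathbb{C}=\mathbb{R}^2$, and $dz=dz_1\cdots dz_k$ on $\mathbb{C}^k$. For a Borel set $A\subset\mathbb{C}$, $V^k(A)=\left[\int_A dz\right]^k$ is the $k$-th power of its area. For $z=(z_1,\dots,z_k)\in\mathbb{C}^k$, $V(z)$ denotes the area of $D(z)=\bigcup_{i=1}^k B(z_i,|z_i|)$. A point process $\psi\subset\mathbb{C}$ is determinantal with kernel $K$ if for every $k\ge 1$ and every Borel $B\subset\mathbb{C}^k$ the expected number of ordered $k$-tuples of distinct points of $\psi$ lying in $B$ equals $\int_B\det(K(z_i,z_j))_{1\le i,j\le k}\,dz_1\cdots dz_k$. The Ginibre process $\phi$ is the determinantal process with kernel $K(z_1,z_2)=\frac1\pi e^{z_1\overline{z_2}}e^{-\frac12(|z_1|^2+|z_2|^2)}$, and $\phi_0=(\phi\mid0\in\phi)\setminus\{0\}$ is the determinantal process with kernel $K_0(z_1,z_2)=\frac1\pi(e^{z_1\overline{z_2}}-1)e^{-\frac12(|z_1|^2+|z_2|^2)}$. The typical cell of the Ginibre–Voronoi tessellation is (in law) $\mathcal{C}=\{z\in\mathbb{C}:\forall u\in\phi_0,\ |z|\le|z-u|\}$. The typical cell of the Poisson–Voronoi tessellation is (in law) $\mathcal{C}_p=\{z\in\mathbb{C}:\forall u\in\Pi,\ |z|\le|z-u|\}$, where $\Pi$ is the Poisson process on $\mathbb{C}$ with intensity measure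 $\frac1\pi dz$. *)

(* Defs.v *)
(* The plane is [C = R * R], with the product (Borel)
   sigma-algebra and the product Lebesgue measure; [toC] is the identification
   with the field [R[i]].  The library norm of [R * R] is the sup norm, so the
   modulus is [cabs] throughout. *)
From HB Require Import structures.
From mathcomp Require Import all_boot all_order all_algebra.
From mathcomp Require Import complex.
From mathcomp Require Import all_classical all_reals all_analysis.
From mathcomp Require Import measurable_realfun.

Set Implicit Arguments.
Unset Strict Implicit.
Unset Printing Implicit Defensive.

Import Order.TTheory GRing.Theory Num.Theory.
Import numFieldNormedType.Exports.

Local Open Scope classical_set_scope.
Local Open Scope ring_scope.

Notation plane R := (measurableTypeR R * measurableTypeR R)%type.

(* Canonical inference for [m1 \x m2] only finds the (sub)probability instances
   of sigma-finiteness. *)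
Lemma product_sigma_finite d1 d2 (T1 : measurableType d1)
    (T2 : measurableType d2) (R : realType)
    (m1 : {sigma_finite_measure set T1 -> \bar R})
    (m2 : {sigma_finite_measure set T2 -> \bar R}) :
  sigma_finite setT (m1 \x m2)%E.
Proof.
have /sigma_finiteP[F [TF ndF Foo]] := sigma_finiteT m1.
have /sigma_finiteP[G [TG ndG Goo]] := sigma_finiteT m2.
exists (fun n => F n `*` G n).
  rewrite -setXTT TF TG predeqE => -[x y]; split.
    move=> [/= [n _ Fnx] [k _ Gky]]; exists (maxn n k) => //; split.
    - by move: x Fnx; exact/subsetPset/ndF/leq_maxl.
    - by move: y Gky; exact/subsetPset/ndG/leq_maxr.
  by move=> [n _ []/= ? ?]; split; exists n.
move=> k; have [? ?] := Foo k; have [? ?] := Goo k.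
split; first exact: measurableX.
by rewrite product_measure1E// lte_mul_pinfty// ge0_fin_numE.
Qed.

Section Plane.
Context {R : realType}.

Definition toC (z : plane R) : R[i] := Complex z.1 z.2.

Definition cabs (z : plane R) : R := ComplexField.Normc.normc (toC z).

Definition cexp (w : R[i]) : R[i] :=
  (expR (complex.Re w))%:C%C * Complex (cos (complex.Im w)) (sin (complex.Im w)).

Definition disc (z : plane R) (r : R) : set (plane R) :=
  [set w | cabs (w - z) < r].

Definition lebC : set (plane R) -> \bar R :=
  (@lebesgue_measure R \x @lebesgue_measure R)%E.

HB.instance Definition _ := Measure.on lebC.

HB.instance Definition _ := Measure_isSigmaFinite.Build _ _ _ lebC
  (product_sigma_finite (@lebesgue_measure R) (@lebesgue_measure R)).

End Plane.
Arguments disc {R} z%_ring_scope r%_ring_scope _.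

Section PowerMeasure.
Context d (T : measurableType d) (R : realType).
Variable mu : {sigma_finite_measure set T -> \bar R}.

Definition tcons n (p : T * n.-tuple T) : n.+1.-tuple T :=
  [tuple of p.1 :: p.2].

Lemma measurable_tcons n : measurable_fun setT (@tcons n).
Proof. exact: (measurable_cons measurable_fst measurable_snd). Qed.

Section push.
Variables (n : nat) (nu : {sigma_finite_measure set (n.-tuple T) -> \bar R}).

Definition pm_step : set (n.+1.-tuple T) -> \bar R :=
  pushforward (mu \x nu)%E (@tcons n).

Let pm_step0 : pm_step set0 = 0%E.
Proof. by rewrite /pm_step /pushforward preimage_set0 measure0. Qed.

Let pm_step_ge0 A : (0 <= pm_step A)%E.
Proof. by rewrite /pm_step /pushforward measure_ge0. Qed.

Let pm_step_sigma_additive : semi_sigma_additive pm_step.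
Proof.
move=> F mF tF mUF; rewrite /pm_step /pushforward preimage_bigcup.
have mt := @measurable_tcons n.
apply: measure_semi_sigma_additive.
- by move=> k; rewrite -[X in measurable X]setTI; exact: mt.
- apply/trivIsetP => /= i j _ _ ij; rewrite -preimage_setI.
  by move/trivIsetP : tF => /(_ _ _ _ _ ij) ->//; rewrite preimage_set0.
- by rewrite -preimage_bigcup -[X in measurable X]setTI; exact: mt.
Qed.

HB.instance Definition _ := isMeasure.Build _ _ _ pm_step
  pm_step0 pm_step_ge0 pm_step_sigma_additive.

Let tuncons (t : n.+1.-tuple T) : T * n.-tuple T :=
  (thead t, [tuple of behead t]).

Let pm_step_sigma_finite : sigma_finite setT pm_step.
Proof.
have [F UF mF] := product_sigma_finite mu nu.
have tunconsK : cancel (@tcons n) tuncons.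
  by move=> [x t]; congr pair; apply/val_inj.
have mtun : measurable_fun setT tuncons.
  apply: measurable_fun_pair; first exact: measurable_tnth.
  exact: measurable_behead.
exists (fun k => tuncons @^-1` F k).
  by rewrite -preimage_bigcup -UF preimage_setT.
move=> k; have [mFk Fk] := mF k; split.
  by rewrite -[X in measurable X]setTI; exact: mtun.
rewrite /pm_step /pushforward (_ : _ @^-1` _ = F k)//.
by apply/seteqP; split=> p /=; rewrite tunconsK.
Qed.

HB.instance Definition _ := Measure_isSigmaFinite.Build _ _ _ pm_step
  pm_step_sigma_finite.

End push.

(* The [n]-fold product measure, on tuples: the image of [mu \x mu^(n-1)]
   under [tcons]. *)
Fixpoint power_measure n : {sigma_finite_measure set (n.-tuple T) -> \bar R} :=
  match n with
  | 0%N => \d_([tuple] : 0.-tuple T)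
  | m.+1 => pm_step (power_measure m)
  end.

End PowerMeasure.

Section PointProcess.
Context {R : realType} {d : measure_display} {Omega : measurableType d}.
Variable P : probability Omega R.
Implicit Types psi : Omega -> set (plane R).

Definition num_points psi (A : set (plane R)) (w : Omega) : \bar R :=
  counting (psi w `&` A).

Definition point_process psi : Prop :=
  (forall w r, finite_set (psi w `&` disc 0 r)) /\
  (forall A, measurable A -> measurable_fun setT (num_points psi A)).

(* The correlation determinant is real for Hermitian [K]. *)
Definition determinantal (K : plane R -> plane R -> R[i]) psi : Prop :=
  point_process psi /\
  forall (k : nat) (B : set (k.-tuple (plane R))), (0 < k)%N -> measurable B ->
    (\int[P]_w counting [set t : k.-tuple (plane R) |
         [/\ uniq t, forall i, psi w (tnth t i) & B t]]
     = \int[power_measure lebC k]_(t in B)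
         (complex.Re (\det (\matrix_(i < k, j < k)
            K (tnth t i) (tnth t j))))%:E)%E.

Definition poisson_process (nu : set (plane R) -> \bar R) psi : Prop :=
  [/\ point_process psi,
    forall A, measurable A -> (nu A < +oo)%E ->
      forall n : nat, P [set w | num_points psi A w = n%:R%:E] =
        (fine (nu A) ^+ n / n`!%:R * expR (- fine (nu A)))%:E
  & forall n (A : 'I_n -> set (plane R)) (S : 'I_n -> set (\bar R)),
      (forall i, measurable (A i)) -> trivIset setT A ->
      (forall i, measurable (S i)) ->
      P [set w | forall i, S i (num_points psi (A i) w)] =
      (\prod_(i < n) P [set w | S i (num_points psi (A i) w)])%E].

(* [E V^k(X)] for a random Borel set [X]; it may be infinite. *)
Definition mean_area_pow (k : nat) (X : Omega -> set (plane R)) : \bar R :=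
  (\int[P]_w (lebC (X w) ^+ k))%E.

End PointProcess.

Section Ginibre.
Context {R : realType}.
Implicit Types z : plane R.

(* Kernel of the Ginibre process conditioned to contain 0, with 0 removed. *)
Definition ginibre_palm_kernel z1 z2 : R[i] :=
  (pi^-1)%:C%C * (cexp (toC z1 * (toC z2)^*%C) - 1)
  * (expR (- 2^-1 * (cabs z1 ^+ 2 + cabs z2 ^+ 2)))%:C%C.

Definition voronoi_cell0 (psi : set (plane R)) : set (plane R) :=
  [set z | forall u, psi u -> cabs z <= cabs (z - u)].

(* [V(z)], the area of the union of the discs [B(z_i, |z_i|)]. *)
Definition flower_area k (t : k.-tuple (plane R)) : \bar R :=
  lebC (\bigcup_(i in [set: 'I_k]) disc (tnth t i) (cabs (tnth t i))).

Definition disc_pow k (r : R) : set (k.-tuple (plane R)) :=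
  [set t | forall i, disc 0 r (tnth t i)].

(* The integral is finite, so [fine] loses nothing. *)
Definition W_coeff (k : nat) : R :=
  pi ^- k.+1 *
  fine (\int[power_measure lebC k]_(t in @disc_pow k 1) flower_area t)%E.

Definition J_coeff (r : R) : R :=
  (2 * pi ^+ 2)^-1 *
  \int[(lebC \x lebC)%E]_(z in disc 0 r `*` disc 0 r)
     expR (- cabs (z.1 - z.2) ^+ 2).

End Ginibre.

(* Main.v *)
(* Fubini gives [E V^k(C `&` A)] as the integral over [A^k] of the probability
   that the flower of [z] contains no point of the process; this probability is
   [exp(-V(z)/pi)] for the Poisson process.

   For the Ginibre process, let [D] be the flower and truncate the exponential
   series in [K_0]: the kernel becomes of finite rank, and diagonalising its
   restriction to [D] turns the [n]-th correlation integral over [D] into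
   [n! e_n(l_1, ..., l_N)] with [0 <= l_i <= 1]. Since
   [\prod (1 - l_i) <= exp(- \sum l_i - \sum l_i^2 / 2)], the Bonferroni
   inequalities and a passage to the limit give
     [P(phi_0 `&` D = set0) <= exp(- I_1 - (I_1^2 - I_2) / 2)]
   for the correlation integrals [I_1], [I_2] over [D]. Here
   [I_1 = V/pi - pi^-1 \int_D e^(-|z|^2) >= V/pi - 1], and
   [I_1^2 - I_2 = \int_(D^2) |K_0|^2 >= 2 J(r) - 1] as soon as [D] contains a
   disc of radius [r], by Bessel's inequality; this is (b). It implies the
   quadratic bound because [J(r)] grows like [r^2], while for small [r] the
   factor [e^(-I_1) <= e * e^(-V/pi)] suffices.

   For (a) the first moment [1 - I_1 <= P(phi_0 `&` D = set0) <= 1] is enough: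
   the Palm intensity vanishes to second order at 0, so for [z] in [B(r)^k] the
   Ginibre void probability is [1 - O(r^4)], the Poisson one is
   [1 - V(z)/pi + O(r^4)], and the mean of [V] over [B(r)^k] scales like
   [r^2]. *)
Require Import Defs.
From HB Require Import structures.
From mathcomp Require Import all_boot all_order all_algebra all_fingroup.
From mathcomp Require Import complex spectral finmap.
From mathcomp Require sesquilinear.
From mathcomp Require Import ring lra.
From mathcomp Require Import all_classical all_reals all_analysis.
From mathcomp Require Import measurable_realfun.

Set Implicit Arguments.
Unset Strict Implicit.
Unset Printing Implicit Defensive.

Import Order.TTheory GRing.Theory Num.Theory.
Import numFieldNormedType.Exports.

Local Open Scope classical_set_scope.
Local Open Scope ring_scope.

(** * Elementary symmetric sums and the Bonferroni inequalities *)

(** The upper bound on a void probability mentions only I_1 and I_2, never the eigenvalues, and this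
    is what lets it survive the passage to the limit. As the rank grows the eigenvalues change and
    no limit of them is taken, whereas each correlation integral over a bounded D converges, because
    the truncated kernels converge uniformly there. The order 2m of the alternating sum is fixed
    during this limit; only afterwards does m grow, killing the remainder I_1^(2m+1) / (2m+1)!. The
    eigenvalues are those of a Gram matrix, so the spectral theorem is used for Hermitian matrices
    only. The constant 3/2 has the following origin. Let a be the mass of pi^-1 e^(-|z|^2) in D, so
    that 0 <= a <= 1. Then I_1 = V/pi - a. Expanding |K_0|^2 gives the Gaussian of z - w, which
    produces 2J, a cross term which Bessel's inequality bounds by a, and a^2. The total loss in the
    exponent is 2a - a^2/2, largest at a = 1. *)

Section ElementarySymmetric.
Variable R : realType.
Implicit Types (s : seq R) (x : R).

Definition elsym s : {poly R} := \prod_(x <- s) (1 + x *: 'X).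

Lemma elsym_cons0 x s : (elsym (x :: s))`_0 = (elsym s)`_0.
Proof.
by rewrite /elsym big_cons mulrDl mul1r coefD -scalerAl coefZ coefXM mulr0 addr0.
Qed.

Lemma elsym_consS x s n :
  (elsym (x :: s))`_n.+1 = (elsym s)`_n.+1 + x * (elsym s)`_n.
Proof. by rewrite /elsym big_cons mulrDl mul1r coefD -scalerAl coefZ coefXM. Qed.

Lemma elsym_coef0 s : (elsym s)`_0 = 1.
Proof.
elim: s => [|y s ih]; last by rewrite elsym_cons0.
by rewrite /elsym big_nil coef1.
Qed.

(** Induction on the list. Adjoining [x] turns the signed error of order m+1 into the old one of
    order m+1 plus [x] times the old one of order m, so nonnegativity at all orders propagates
    together. *)
Lemma elsym_bonferroni s m : (forall x, x \in s -> 0 <= x <= 1) ->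
  0 <= (-1) ^+ m * (\sum_(n < m.+1) (-1) ^+ n * (elsym s)`_n - \prod_(x <- s) (1 - x)).
Proof.
have prod01 t : (forall x, x \in t -> 0 <= x <= 1) ->
    0 <= \prod_(x <- t) (1 - x) <= 1.
  elim: t => [_|y t ih h]; first by rewrite big_nil ler01 lexx.
  have /andP[y0 y1] := h y (mem_head _ _).
  have /andP[p0 p1] := ih (fun x (xt : x \in t) => h x (@mem_behead _ (y :: t) x xt)).
  by rewrite big_cons mulr_ge0 ?subr_ge0//= mulr_ile1// ?subr_ge0// gerBl.
elim: s m => [|x s ih] m h.
  rewrite big_nil big_ord_recl/= {1}/elsym big_nil coef1/= mul1r big1 ?addr0 ?subrr ?mulr0//.
  by move=> i _; rewrite /elsym big_nil coef1/= mulr0.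
have /andP[x0 x1] := h x (mem_head _ _).
have hs y : y \in s -> 0 <= y <= 1 by move=> ys; apply: h; rewrite in_cons ys orbT.
case: m => [|m].
  rewrite big_ord_recl big_ord0 addr0 !expr0 !mul1r elsym_cons0.
  by rewrite elsym_coef0 subr_ge0; have /andP[] := prod01 _ h.
have := ih m.+1 hs; have := ih m hs.
rewrite [in X in _ -> _ -> X]big_ord_recl elsym_cons0.
rewrite [X in _ -> _ -> is_true (0 <= _ * (_ + X - _))](eq_bigr (fun i : 'I_m.+1 =>
  (-1) ^+ i.+1 * (elsym s)`_i.+1 + - x * ((-1) ^+ i * (elsym s)`_i))); last first.
  by move=> i _; rewrite lift0 elsym_consS exprS; ring.
rewrite big_split/= addrA.
rewrite (_ : (-1) ^+ 0 * (elsym s)`_0 + _ =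
  \sum_(n < m.+2) (-1) ^+ n * (elsym s)`_n); last by rewrite [RHS]big_ord_recl.
rewrite -mulr_sumr.
move: (\sum_(n < m.+1) _) (\sum_(n < m.+2) _) => a b.
rewrite big_cons; move: (\prod_(_ <- s) _) => p h1 h2.
have -> : (-1) ^+ m.+1 * (b + - x * a - (1 - x) * p) =
    (-1) ^+ m.+1 * (b - p) + x * ((-1) ^+ m * (a - p)) by rewrite exprS; ring.
by rewrite addr_ge0// mulr_ge0.
Qed.

End ElementarySymmetric.

Section InjectiveSums.
Variables (R : realType) (I : finType).
Implicit Types (l : I -> R).

(** The shape in which integrated determinants appear: a sum over distinct indices, equal to n!
    times the elementary symmetric sum by [inj_sumE]. *)
Definition inj_sum l n : R :=
  \sum_(a : {ffun 'I_n -> I} | injectiveb a) \prod_i l (a i).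

Lemma inj_sum_le_exp l n : (forall i, 0 <= l i) -> inj_sum l n <= (\sum_i l i) ^+ n.
Proof.
move=> l0; rewrite -[in X in _ <= X](card_ord n) -prodr_const.
rewrite (bigA_distr_bigA (fun=> l)) /= /inj_sum big_mkcond/=.
by apply: ler_sum => a _; case: ifP => // _; exact: prodr_ge0.
Qed.

(** Group the injections by their image: each set of n indices is the image of exactly n! of them,
    all with the same product. *)
Lemma inj_sumE l n : inj_sum l n = n`!%:R * (elsym [seq l i | i <- enum I])`_n.
Proof.
have -> : (elsym [seq l i | i <- enum I])`_n = \sum_(S : {set I} | #|S| == n) \prod_(i in S) l i.
  rewrite /elsym big_map big_enum/=.
  have -> : \prod_(i : I) (1 + l i *: 'X) = \sum_(S : {set I}) (\prod_(i in S) l i) *: 'X^#|S| :> {poly R}.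
    under eq_bigr do rewrite addrC.
    rewrite bigA_distr.
    apply: eq_bigr => S _; rewrite -big_mkcond/=.
    by rewrite scaler_prod prodr_const.
  rewrite coef_sum [RHS]big_mkcond/=; apply: eq_bigr => S _.
  by rewrite coefZ coefXn eq_sym; case: eqP; rewrite (mulr1, mulr0).
rewrite /inj_sum (partition_big (fun a : {ffun 'I_n -> I} => (a @: [set: 'I_n])%SET)
  (fun S => #|S| == n))/=; last first.
  by move=> a /injectiveP inja; rewrite card_imset// cardsT card_ord.
rewrite mulr_sumr; apply: eq_bigr => S /eqP Sn.
rewrite (eq_bigr (fun=> \prod_(i in S) l i)); last first.
  move=> a /andP[/injectiveP inja /eqP <-].
  by rewrite big_imset/=; [apply: eq_bigl => i; rewrite inE|move=> ? ? _ _; exact: inja].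
rewrite sumr_const mulr_natl; congr (_ *+ _).
have -> : n`! = #|[set a : {ffun 'I_n -> I} in ffun_on (mem S) | injectiveb a]%SET|.
  by rewrite card_inj_ffuns_on card_ord Sn ffactnn.
apply: eq_card => a; rewrite !inE unfold_in /= andbC.
apply: andb_id2r => /injectiveP inja.
apply/eqP/forallP => [<- i|aS]; first exact: imset_f.
apply/eqP; rewrite eqEcard card_imset// cardsT card_ord Sn leqnn andbT.
by apply/fintype.subsetP => _ /imsetP[i _ ->]; exact: aS.
Qed.

End InjectiveSums.

Section RealInequalities.
Variable R : realType.

(** The function (1 - t) e^(t + t^2/2) equals 1 at 0 and has derivative - t^2 e^(t + t^2/2). The
    quadratic gain, beyond the usual 1 - x <= e^(-x), is the source of the J term. *)
Lemma onem_le_expR (x : R) : 0 <= x <= 1 -> 1 - x <= expR (- x - x ^+ 2 / 2).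
Proof.
move=> /andP[x0 x1].
pose f (t : R) := (1 - t) * expR (t + t ^+ 2 / 2).
have fE (t : R) : is_derive t 1 f (- (t ^+ 2) * expR (t + t ^+ 2 / 2)).
  apply: is_derive_eq; rewrite /GRing.scale/=.
  by field.
have df (t : R) : derivable f t 1 by case: (fE t).
have : f x <= f 0.
  have : {in `]0, x[, forall t, f^`()%classic t <= 0}.
    move=> t _; rewrite derive1E (@derive_val _ _ _ _ _ _ _ (fE t)).
    by rewrite mulNr oppr_le0 mulr_ge0 ?sqr_ge0 ?expR_ge0.
  move=> h; apply: (ler0_derive1_le_cc (a := 0) (b := x)) => //;
    rewrite ?in_itv/= ?lexx ?x0//.
  by apply: derivable_within_continuous => t _.
rewrite /f expr0n/= mul0r addr0 expR0 subr0 mulr1 => h.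
by rewrite -opprD expRN -[leRHS]mul1r ler_pdivlMr ?expR_gt0.
Qed.

Lemma prod_onem_le_expR (I : Type) (s : seq I) (l : I -> R) :
  (forall i, 0 <= l i <= 1) ->
  \prod_(i <- s) (1 - l i) <=
  expR (- (\sum_(i <- s) l i) - (\sum_(i <- s) l i ^+ 2) / 2).
Proof.
move=> l01; elim: s => [|i s ih].
  by rewrite !big_nil oppr0 mul0r subrr expR0.
rewrite !big_cons; have /andP[l0 l1] := l01 i.
rewrite (_ : _ - _ = (- l i - l i ^+ 2 / 2) +
   (- (\sum_(j <- s) l j) - (\sum_(j <- s) l j ^+ 2) / 2)); last by field.
rewrite expRD ler_pM ?subr_ge0//.
- by apply: prodr_ge0 => j _; rewrite subr_ge0; case/andP: (l01 j).
- exact: onem_le_expR.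
Qed.

Lemma elsym_coef1 (s : seq R) : (elsym s)`_1 = \sum_(x <- s) x.
Proof.
elim: s => [|y s ih]; first by rewrite /elsym !big_nil coef1.
by rewrite elsym_consS ih elsym_coef0 mulr1 big_cons addrC.
Qed.

Lemma elsym_coef2 (s : seq R) :
  2 * (elsym s)`_2 = (\sum_(x <- s) x) ^+ 2 - \sum_(x <- s) x ^+ 2.
Proof.
elim: s => [|y s ih]; first by rewrite /elsym !big_nil coef1 expr0n/=; ring.
by rewrite elsym_consS elsym_coef1 !big_cons mulrDr ih; ring.
Qed.

Lemma inj_sum1 (I : finType) (l : I -> R) : inj_sum l 1 = \sum_i l i.
Proof. by rewrite inj_sumE (_ : 1`! = 1%N)// mul1r elsym_coef1 big_map big_enum. Qed.

Lemma inj_sum2 (I : finType) (l : I -> R) :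
  inj_sum l 2 = (\sum_i l i) ^+ 2 - \sum_i l i ^+ 2.
Proof. by rewrite inj_sumE (_ : 2`! = 2%N)// elsym_coef2 !big_map. Qed.

(** An even truncation will bound the void probability from above, so it must itself be bounded
    above. The truncation of odd order 2m+1 lies below the product of the 1 - l_i; its last term is
    negative, is moved to the right, and is at most (sum of the l_i)^(2m+1) / (2m+1)!. *)
Lemma sum_inj_sum_le (I : finType) (l : I -> R) m : (forall i, 0 <= l i <= 1) ->
  \sum_(n < (m.*2).+1) (-1) ^+ n / n`!%:R * inj_sum l n <=
  expR (- inj_sum l 1 - (inj_sum l 1 ^+ 2 - inj_sum l 2) / 2)
  + inj_sum l 1 ^+ (m.*2).+1 / (m.*2).+1`!%:R.
Proof.
move=> l01; have l0 i : 0 <= l i by case/andP: (l01 i).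
have -> : inj_sum l 1 ^+ 2 - inj_sum l 2 = \sum_i l i ^+ 2.
  by rewrite inj_sum1 inj_sum2; ring.
have factn0 n : n`!%:R != 0 :> R by rewrite pnatr_eq0 -lt0n fact_gt0.
pose s := [seq l i | i <- enum I].
have := @elsym_bonferroni R s (m.*2).+1.
have h x : x \in s -> 0 <= x <= 1 by case/mapP => i _ ->.
move=> /(_ h); rewrite big_ord_recr/=.
have -> : (-1) ^+ (m.*2).+1 = -1 :> R by rewrite exprS -muln2 exprM sqrr_sign mulr1.
rewrite !mulN1r oppr_ge0 subr_le0 lerBlDr => le1.
rewrite (eq_bigr (fun n : 'I_(m.*2).+1 => (-1) ^+ n * (elsym s)`_n)); last first.
  by move=> n _; rewrite inj_sumE mulrA divfK.
apply: (le_trans le1); apply: lerD.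
  by rewrite inj_sum1 big_map big_enum; exact: prod_onem_le_expR.
by rewrite ler_pdivlMr ?ltr0n ?fact_gt0// mulrC -inj_sumE inj_sum1 inj_sum_le_exp.
Qed.

End RealInequalities.

(** * Complex integrals on power measures *)

Section ProductIntegral.
Context d1 d2 (T1 : measurableType d1) (T2 : measurableType d2) (R : realType).
Variable mu : {sigma_finite_measure set T1 -> \bar R}.
Variable nu : {sigma_finite_measure set T2 -> \bar R}.

Lemma measurable_fun_prod_mul (f : T1 -> R) (g : T2 -> R) :
  measurable_fun setT f -> measurable_fun setT g ->
  measurable_fun setT (fun p : T1 * T2 => f p.1 * g p.2).
Proof.
by move=> mf mg; apply: measurable_funM;
  [exact: (measurableT_comp mf)|exact: (measurableT_comp mg)].
Qed.

Lemma integrable_prod_mul (f : T1 -> R) (g : T2 -> R) :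
  mu.-integrable setT (EFin \o f) -> nu.-integrable setT (EFin \o g) ->
  (mu \x nu)%E.-integrable setT (EFin \o (fun p => f p.1 * g p.2)).
Proof.
move=> /integrableP[mf fi] /integrableP[mg gi].
have mf' : measurable_fun setT f by exact/measurable_EFinP.
have mg' : measurable_fun setT g by exact/measurable_EFinP.
apply/integrable12ltyP.
  by apply/measurable_EFinP; exact: measurable_fun_prod_mul.
under eq_integral => x _.
  under eq_integral => y _ do rewrite /= normrM EFinM.
  rewrite ge0_integralZl//; last first.
    by apply/measurable_EFinP; exact: measurableT_comp.
  over.
rewrite ge0_integralZr//; last 2 first.
- by apply/measurable_EFinP; exact: measurableT_comp.
- exact: integral_ge0.
by rewrite lte_mul_pinfty// ?integral_ge0// ge0_fin_numE ?integral_ge0.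
Qed.

Lemma Rintegral_prod_mul (f : T1 -> R) (g : T2 -> R) :
  mu.-integrable setT (EFin \o f) -> nu.-integrable setT (EFin \o g) ->
  \int[(mu \x nu)%E]_p (f p.1 * g p.2) = \int[mu]_x f x * \int[nu]_y g y.
Proof.
move=> fi gi; rewrite [LHS]/Rintegral.
rewrite -(integral12_prod_meas1 (integrable_prod_mul fi gi)).
transitivity (\int[mu]_x ((\int[nu]_y g y) * f x)); last first.
  by rewrite RintegralZl// mulrC.
congr fine; apply: eq_integral => x _; rewrite /fubini_F/=.
transitivity (\int[nu]_y ((f x)%:E * (g y)%:E))%E; first exact: eq_integral.
by rewrite integralZl// mulrC EFinM fineK// integrable_fin_num.
Qed.

End ProductIntegral.

Lemma integrable_scale d (T : measurableType d) (R : realType)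
    (mu : {measure set T -> \bar R}) (a : R) (f : T -> R) :
  mu.-integrable setT (EFin \o f) ->
  mu.-integrable setT (EFin \o (fun x => a * f x)).
Proof. by move=> fi; apply: eq_integrable (integrableZl measurableT a fi). Qed.

Section ComplexIntegral.
Context d (T : measurableType d) (R : realType).
Variable mu : {measure set T -> \bar R}.
Implicit Types f g : T -> R[i].

Definition cintegrable f :=
  mu.-integrable setT (EFin \o (fun x => complex.Re (f x))) /\
  mu.-integrable setT (EFin \o (fun x => complex.Im (f x))).

Definition cint f : R[i] :=
  Complex (\int[mu]_x complex.Re (f x)) (\int[mu]_x complex.Im (f x)).

Lemma cintegrable0 : cintegrable (fun=> 0).
Proof. by split; exact: integrable0. Qed.

Lemma cint0 : cint (fun=> 0) = 0.
Proof. by rewrite /cint/= /Rintegral integral0. Qed.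

Lemma cintegrableD f g : cintegrable f -> cintegrable g ->
  cintegrable (fun x => f x + g x).
Proof.
move=> [f1 f2] [g1 g2]; split.
- by apply: eq_integrable (integrableD measurableT f1 g1) => // x _ /=; rewrite raddfD.
- by apply: eq_integrable (integrableD measurableT f2 g2) => // x _ /=; rewrite raddfD.
Qed.

Lemma cintD f g : cintegrable f -> cintegrable g ->
  cint (fun x => f x + g x) = cint f + cint g.
Proof.
move=> [f1 f2] [g1 g2]; apply/eqP; rewrite eq_complex/= -!RintegralD//.
by apply/andP; split; apply/eqP/eq_Rintegral => x _; rewrite raddfD.
Qed.

Lemma Re_mul (z w : R[i]) : complex.Re (z * w) =
  complex.Re z * complex.Re w - complex.Im z * complex.Im w.
Proof. by case: z w => [a b] [c e]. Qed.

Lemma Im_mul (z w : R[i]) : complex.Im (z * w) =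
  complex.Re z * complex.Im w + complex.Im z * complex.Re w.
Proof. by case: z w => [a b] [c e]. Qed.

Lemma cintegrableZ (c : R[i]) f : cintegrable f -> cintegrable (fun x => c * f x).
Proof.
move=> [f1 f2]; split.
- apply: eq_integrable (integrableB measurableT (integrableZl measurableT (complex.Re c) f1)
    (integrableZl measurableT (complex.Im c) f2)) => // x _ /=.
  by rewrite Re_mul.
- apply: eq_integrable (integrableD measurableT (integrableZl measurableT (complex.Re c) f2)
    (integrableZl measurableT (complex.Im c) f1)) => // x _ /=.
  by rewrite Im_mul.
Qed.

Lemma cintZ (c : R[i]) f : cintegrable f ->
  cint (fun x => c * f x) = c * cint f.
Proof.
move=> [f1 f2]; apply/eqP; rewrite eq_complex Re_mul Im_mul/= -!RintegralZl//.
rewrite -RintegralB//; [|exact: integrable_scale..].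
rewrite -RintegralD//; [|exact: integrable_scale..].
by apply/andP; split; apply/eqP/eq_Rintegral => x _; rewrite ?Re_mul ?Im_mul.
Qed.

Lemma cintegrable_sum (I : Type) (s : seq I) (h : I -> T -> R[i]) :
  (forall i, cintegrable (h i)) -> cintegrable (fun x => \sum_(i <- s) h i x).
Proof.
move=> hi; elim: s => [|i s ih].
  by under eq_fun do rewrite big_nil; exact: cintegrable0.
by under eq_fun do rewrite big_cons; exact: cintegrableD.
Qed.

Lemma cint_sum (I : Type) (s : seq I) (h : I -> T -> R[i]) :
  (forall i, cintegrable (h i)) ->
  cint (fun x => \sum_(i <- s) h i x) = \sum_(i <- s) cint (h i).
Proof.
move=> hi; elim: s => [|i s ih].
  by under eq_fun do rewrite big_nil; rewrite big_nil cint0.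
under eq_fun do rewrite big_cons; rewrite big_cons -ih cintD//.
exact: cintegrable_sum.
Qed.

Lemma cintegrable_conj f : cintegrable f -> cintegrable (fun x => conjc (f x)).
Proof.
move=> [f1 f2]; split.
  by apply: eq_integrable f1 => // x _ /=; case: (f x).
by apply: eq_integrable (integrableN f2) => // x _ /=; case: (f x).
Qed.

Lemma cint_conj f : cintegrable f -> cint (fun x => conjc (f x)) = conjc (cint f).
Proof.
move=> [f1 f2]; apply/eqP; rewrite eq_complex/=; apply/andP; split; apply/eqP.
  by apply: eq_Rintegral => x _; case: (f x).
rewrite -mulN1r -RintegralZl//; apply: eq_Rintegral => x _.
by rewrite mulN1r; case: (f x).
Qed.

End ComplexIntegral.

Section ComplexProduct.
Context d1 d2 (T1 : measurableType d1) (T2 : measurableType d2) (R : realType).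
Variable mu : {sigma_finite_measure set T1 -> \bar R}.
Variable nu : {sigma_finite_measure set T2 -> \bar R}.

Lemma cintegrable_prod (f : T1 -> R[i]) (g : T2 -> R[i]) :
  cintegrable mu f -> cintegrable nu g ->
  cintegrable (mu \x nu)%E (fun p => f p.1 * g p.2).
Proof.
move=> [f1 f2] [g1 g2]; split.
- apply: eq_integrable (integrableB measurableT (integrable_prod_mul f1 g1)
    (integrable_prod_mul f2 g2)) => // x _ /=.
  by rewrite Re_mul.
- apply: eq_integrable (integrableD measurableT (integrable_prod_mul f1 g2)
    (integrable_prod_mul f2 g1)) => // x _ /=.
  by rewrite Im_mul.
Qed.

Lemma cint_prod (f : T1 -> R[i]) (g : T2 -> R[i]) :
  cintegrable mu f -> cintegrable nu g ->
  cint (mu \x nu)%E (fun p => f p.1 * g p.2) = cint mu f * cint nu g.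
Proof.
move=> [f1 f2] [g1 g2].
apply/eqP; rewrite eq_complex Re_mul Im_mul/= -!Rintegral_prod_mul//.
rewrite -RintegralB//;
  [|exact: (integrable_prod_mul f1 g1)|exact: (integrable_prod_mul f2 g2)].
rewrite -RintegralD//;
  [|exact: (integrable_prod_mul f1 g2)|exact: (integrable_prod_mul f2 g1)].
by apply/andP; split; apply/eqP/eq_Rintegral => x _; rewrite ?Re_mul ?Im_mul.
Qed.

End ComplexProduct.

Section PowerMeasureIntegral.
Context d (T : measurableType d) (R : realType).
Variable mu : {sigma_finite_measure set T -> \bar R}.

Lemma ge0_integral_power_measureS n (f : n.+1.-tuple T -> \bar R) :
  measurable_fun setT f -> (forall t, 0 <= f t)%E ->
  (\int[power_measure mu n.+1]_t f t =
   \int[(mu \x power_measure mu n)%E]_p f (tcons p))%E.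
Proof.
move=> mf f0.
by rewrite /= /pm_step ge0_integral_pushforward//; exact: measurable_tcons.
Qed.

Lemma integrable_power_measureS n (f : n.+1.-tuple T -> \bar R) :
  measurable_fun setT f ->
  (power_measure mu n.+1).-integrable setT f <->
  (mu \x power_measure mu n)%E.-integrable setT (fun p => f (tcons p)).
Proof.
move=> mf; split => /integrableP[_ fi]; apply/integrableP; split => //.
- exact: (measurableT_comp mf (@measurable_tcons _ _ _)).
- by move: fi; rewrite ge0_integral_power_measureS//; exact: measurableT_comp.
- by rewrite ge0_integral_power_measureS//; exact: measurableT_comp.
Qed.

Lemma Rintegral_power_measureS n (f : n.+1.-tuple T -> R) :
  (power_measure mu n.+1).-integrable setT (EFin \o f) ->
  \int[power_measure mu n.+1]_t f t =
  \int[(mu \x power_measure mu n)%E]_p f (tcons p).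
Proof.
move=> fi; rewrite /Rintegral; congr fine => /=; rewrite /pm_step.
have mf := (integrableP _ _ _ fi).1.
rewrite (integral_pushforward (@measurable_tcons _ _ n))//.
exact: ((integrable_power_measureS mf).1 fi).
Qed.

Lemma integral_power_measure0 (f : 0.-tuple T -> \bar R) :
  measurable_fun setT f ->
  (\int[power_measure mu 0]_t f t = f [tuple])%E.
Proof. by move=> mf; rewrite /= integral_dirac// diracT mul1e. Qed.

Lemma cintegrable_power_measureS n (f : n.+1.-tuple T -> R[i]) :
  measurable_fun setT (fun t => complex.Re (f t)) ->
  measurable_fun setT (fun t => complex.Im (f t)) ->
  cintegrable (mu \x power_measure mu n)%E (fun p => f (tcons p)) ->
  cintegrable (power_measure mu n.+1) f.
Proof.
by move=> mr mi [f1 f2]; split; apply: (integrable_power_measureS _).2 => //;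
  exact/measurable_EFinP.
Qed.

Lemma cint_power_measureS n (f : n.+1.-tuple T -> R[i]) :
  cintegrable (power_measure mu n.+1) f ->
  cint (power_measure mu n.+1) f =
  cint (mu \x power_measure mu n)%E (fun p => f (tcons p)).
Proof. by move=> [f1 f2]; rewrite /cint !Rintegral_power_measureS. Qed.

Lemma measurable_Re_mul d' (T' : measurableType d') (f g : T' -> R[i]) :
  measurable_fun setT (fun t => complex.Re (f t)) ->
  measurable_fun setT (fun t => complex.Im (f t)) ->
  measurable_fun setT (fun t => complex.Re (g t)) ->
  measurable_fun setT (fun t => complex.Im (g t)) ->
  measurable_fun setT (fun t => complex.Re (f t * g t)) /\
  measurable_fun setT (fun t => complex.Im (f t * g t)).
Proof.
move=> f1 f2 g1 g2; split.
- under eq_fun do rewrite Re_mul.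
  by apply: measurable_funB; exact: measurable_funM.
- under eq_fun do rewrite Im_mul.
  by apply: measurable_funD; exact: measurable_funM.
Qed.

Lemma measurable_power_prod n (h : 'I_n -> T -> R[i]) :
  (forall i, cintegrable mu (h i)) ->
  measurable_fun setT (fun t : n.-tuple T => complex.Re (\prod_i h i (tnth t i))) /\
  measurable_fun setT (fun t : n.-tuple T => complex.Im (\prod_i h i (tnth t i))).
Proof.
move=> hi.
have mh i : measurable_fun setT (fun t : n.-tuple T => complex.Re (h i (tnth t i))) /\
    measurable_fun setT (fun t : n.-tuple T => complex.Im (h i (tnth t i))).
  have [/measurable_int/measurable_EFinP h1 /measurable_int/measurable_EFinP h2] := hi i.
  by split; [apply: (measurableT_comp h1)|apply: (measurableT_comp h2)];
    exact: measurable_tnth.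
elim: (index_enum _) => [|i s [ih1 ih2]].
  by split; under eq_fun do rewrite big_nil; exact: measurable_cst.
split; under eq_fun do rewrite big_cons; have [? ?] := mh i.
- by apply: (measurable_Re_mul _ _ ih1 ih2).1.
- by apply: (measurable_Re_mul _ _ ih1 ih2).2.
Qed.

(** Fubini on tuples, peeling off the head. Expanded determinants are sums of such products, one
    factor for each point. *)
Lemma cint_power_prod n (h : 'I_n -> T -> R[i]) :
  (forall i, cintegrable mu (h i)) ->
  cintegrable (power_measure mu n) (fun t => \prod_i h i (tnth t i)) /\
  cint (power_measure mu n) (fun t => \prod_i h i (tnth t i)) =
  \prod_i cint mu (h i).
Proof.
elim: n h => [|n ih] h hi.
  under eq_fun do rewrite big_ord0; rewrite big_ord0; split.
    by split; apply/integrableP; split;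
      rewrite ?integral_power_measure0//= ?ltry//; exact: measurable_cst.
  by rewrite /cint /Rintegral !integral_power_measure0.
have [m1 m2] := measurable_power_prod hi.
have [ih1 ih2] := ih (fun i => h (lift ord0 i)) (fun i => hi _).
have pE : (fun p : T * n.-tuple T => \prod_i h i (tnth (tcons p) i)) =
    (fun p => h ord0 p.1 * \prod_i h (lift ord0 i) (tnth p.2 i)).
  apply/funext => p; rewrite big_ord_recl tnth0; congr (_ * _).
  by apply: eq_bigr => i _; rewrite tnthS.
have ci : cintegrable (power_measure mu n.+1) (fun t => \prod_i h i (tnth t i)).
  by apply: cintegrable_power_measureS => //; rewrite pE; exact: (cintegrable_prod (hi ord0) ih1).
split => //; rewrite cint_power_measureS// pE (cint_prod (hi ord0) ih1) ih2.
by rewrite [RHS]big_ord_recl.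
Qed.

End PowerMeasureIntegral.

Section SquareIntegrable.
Context d (T : measurableType d) (R : realType).
Variable mu : {measure set T -> \bar R}.
Implicit Types f g h : T -> R[i].

(** The squared modulus, kept polynomial in the two parts so that no square root enters
    measurability or integrability arguments. *)
Definition csq (z : R[i]) : R := complex.Re z ^+ 2 + complex.Im z ^+ 2.

Lemma csq_ge0 z : 0 <= csq z.
Proof. by rewrite addr_ge0// sqr_ge0. Qed.

Lemma csqE z : (csq z)%:C%C = z * conjc z.
Proof.
case: z => a b; apply/eqP; rewrite eq_complex /csq/=.
by apply/andP; split; apply/eqP; ring.
Qed.

Lemma csqM z w : csq (z * w) = csq z * csq w.
Proof. by case: z w => [a b] [c e]; rewrite /csq/=; ring. Qed.

Lemma csqD_le z w : csq (z + w) <= 2 * (csq z + csq w).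
Proof.
case: z w => [a b] [c e]; rewrite /csq/= -subr_ge0.
rewrite (_ : _ - _ = (a - c) ^+ 2 + (b - e) ^+ 2); last by ring.
by rewrite addr_ge0 ?sqr_ge0.
Qed.

Record square_integrable f : Prop := SquareIntegrable {
  sqint_Re : measurable_fun setT (fun x => complex.Re (f x)) ;
  sqint_Im : measurable_fun setT (fun x => complex.Im (f x)) ;
  sqint_csq : mu.-integrable setT (EFin \o (fun x => csq (f x))) }.

Lemma measurable_csq f : measurable_fun setT (fun x => complex.Re (f x)) ->
  measurable_fun setT (fun x => complex.Im (f x)) ->
  measurable_fun setT (fun x => csq (f x)).
Proof.
by move=> mr mi; apply: measurable_funD; exact: measurable_funX.
Qed.

Lemma integrable_le (u v : T -> R) : measurable_fun setT u ->
  mu.-integrable setT (EFin \o v) -> (forall x, `|u x| <= v x) ->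
  mu.-integrable setT (EFin \o u).
Proof.
move=> mu_ vi uv; apply: le_integrable vi => //; first exact/measurable_EFinP.
by move=> x _; rewrite /= lee_fin (le_trans (uv x))// ler_norm.
Qed.

Lemma square_integrable0 : square_integrable (fun=> 0).
Proof.
split; [exact: measurable_cst..|].
rewrite (_ : _ \o _ = cst 0%E); first exact: integrable0.
by apply/funext => x /=; rewrite /csq/= expr0n/= addr0.
Qed.

Lemma square_integrableD f g : square_integrable f -> square_integrable g ->
  square_integrable (fun x => f x + g x).
Proof.
move=> [f1 f2 f3] [g1 g2 g3].
have m1 : measurable_fun setT (fun x => complex.Re (f x + g x)).
  by under eq_fun do rewrite raddfD; exact: measurable_funD.
have m2 : measurable_fun setT (fun x => complex.Im (f x + g x)).
  by under eq_fun do rewrite raddfD; exact: measurable_funD.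
split => //; apply: (@integrable_le _ (fun x => 2 * (csq (f x) + csq (g x)))).
- exact: measurable_csq.
- apply: integrable_scale.
  by apply: eq_integrable (integrableD measurableT f3 g3).
- by move=> x; rewrite ger0_norm ?csq_ge0// csqD_le.
Qed.

Lemma square_integrableZ c f : square_integrable f ->
  square_integrable (fun x => c * f x).
Proof.
move=> [f1 f2 f3].
have [m1 m2] := measurable_Re_mul (measurable_cst (complex.Re c))
  (measurable_cst (complex.Im c)) f1 f2.
split => //; under eq_fun do rewrite csqM.
exact: integrable_scale.
Qed.

Lemma square_integrable_sum (I : Type) (s : seq I) (h : I -> T -> R[i]) :
  (forall i, square_integrable (h i)) ->
  square_integrable (fun x => \sum_(i <- s) h i x).
Proof.
move=> hi; elim: s => [|i s ih].
  by under eq_fun do rewrite big_nil; exact: square_integrable0.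
by under eq_fun do rewrite big_cons; exact: square_integrableD.
Qed.

Lemma square_integrable_restrict (D : set T) f : measurable D ->
  square_integrable f -> square_integrable (fun x => (\1_D x)%:C%C * f x).
Proof.
move=> mD [f1 f2 f3].
have mI : measurable_fun setT (\1_D : T -> R) by [].
have [m1 m2] := @measurable_Re_mul _ _ _ (fun x => (\1_D x)%:C%C) f
  mI (measurable_cst (0 : R)) f1 f2.
split => //; apply: (integrable_le _ f3); first exact: measurable_csq.
move=> x; rewrite csqM ger0_norm ?mulr_ge0 ?csq_ge0// ler_piMl ?csq_ge0//.
by rewrite /csq/= indicE; case: (_ \in _); rewrite ?expr1n ?expr0n/= ?addr0 ?ler01.
Qed.

Lemma cintegrable_mul_conj f g : square_integrable f -> square_integrable g ->
  cintegrable mu (fun x => f x * conjc (g x)).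
Proof.
move=> [f1 f2 f3] [g1 g2 g3].
have g2' : measurable_fun setT (fun x => complex.Im (conjc (g x))).
  rewrite (_ : (fun x => _) = (fun x => - complex.Im (g x))).
    exact: measurableT_comp.
  by apply/funext => x; case: (g x).
have g1' : measurable_fun setT (fun x => complex.Re (conjc (g x))).
  rewrite (_ : (fun x => _) = (fun x => complex.Re (g x)))//.
  by apply/funext => x; case: (g x).
have [m1 m2] := measurable_Re_mul f1 f2 g1' g2'.
have fgi := integrableD measurableT f3 g3.
split; apply: (@integrable_le _ (fun x => csq (f x) + csq (g x))) => // x.
- rewrite ler_norml; case: (f x) (g x) => [a b] [c e]; rewrite /csq/=.
  have := sqr_ge0 (a + c); have := sqr_ge0 (a - c).
  have := sqr_ge0 (b + e); have := sqr_ge0 (b - e).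
  have := sqr_ge0 a; have := sqr_ge0 b; have := sqr_ge0 c; have := sqr_ge0 e.
  by rewrite !expr2 => *; apply/andP; split; lra.
- rewrite ler_norml; case: (f x) (g x) => [a b] [c e]; rewrite /csq/=.
  have := sqr_ge0 (a + e); have := sqr_ge0 (a - e).
  have := sqr_ge0 (b + c); have := sqr_ge0 (b - c).
  have := sqr_ge0 a; have := sqr_ge0 b; have := sqr_ge0 c; have := sqr_ge0 e.
  by rewrite !expr2 => *; apply/andP; split; lra.
Qed.

(** The Hermitian product of L^2, linear in the first argument. *)
Definition cip f g : R[i] := cint mu (fun x => f x * conjc (g x)).

Lemma cip_conj f g : square_integrable f -> square_integrable g ->
  conjc (cip f g) = cip g f.
Proof.
move=> fi gi; rewrite /cip -cint_conj; last exact: cintegrable_mul_conj.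
by congr cint; apply/funext => x; rewrite rmorphM/= conjcK mulrC.
Qed.

Lemma cip_suml (I : Type) (s : seq I) (c : I -> R[i]) (h : I -> T -> R[i]) g :
  (forall i, square_integrable (h i)) -> square_integrable g ->
  cip (fun x => \sum_(i <- s) c i * h i x) g = \sum_(i <- s) c i * cip (h i) g.
Proof.
move=> hi gi; rewrite /cip.
under eq_fun do rewrite mulr_suml.
rewrite cint_sum => [|i]; last first.
  under eq_fun do rewrite -mulrA.
  by apply: cintegrableZ; exact: cintegrable_mul_conj.
apply: eq_bigr => i _; under eq_fun do rewrite -mulrA.
by rewrite cintZ//; exact: cintegrable_mul_conj.
Qed.

Lemma cip_sumr (I : Type) (s : seq I) (c : I -> R[i]) (h : I -> T -> R[i]) g :
  (forall i, square_integrable (h i)) -> square_integrable g ->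
  cip g (fun x => \sum_(i <- s) c i * h i x) =
  \sum_(i <- s) conjc (c i) * cip g (h i).
Proof.
move=> hi gi; rewrite -cip_conj//; last first.
  by apply: square_integrable_sum => i; exact: square_integrableZ.
rewrite cip_suml// rmorph_sum/=; apply: eq_bigr => i _.
by rewrite rmorphM; congr (_ * _); exact: cip_conj.
Qed.

Lemma cip_self f : cip f f = (\int[mu]_x csq (f x))%:C%C.
Proof.
rewrite /cip; under eq_fun do rewrite -csqE.
by rewrite /cint/= [X in Complex _ X]/Rintegral integral0.
Qed.

End SquareIntegrable.

(** * Determinants of finite-rank kernels *)

Section FiniteRank.
Import sesquilinear.
Local Open Scope sesquilinear_scope.
Context d (T : measurableType d) (R : realType).
Variable mu : {sigma_finite_measure set T -> \bar R}.

Definition ker_mx (K : T -> T -> R[i]) n (t : n.-tuple T) : 'M[R[i]]_n :=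
  \matrix_(i, j) K (tnth t i) (tnth t j).

Definition finite_rank (I : finType) (g : I -> T -> R[i]) z w : R[i] :=
  \sum_a g a z * conjc (g a w).

(** A repeated index produces two equal rows; without repetition the matrix is diagonal. *)
Lemma det_orthogonal (I : finType) n (l : I -> R[i]) (a : {ffun 'I_n -> I}) :
  \det (\matrix_(i, j) (l (a i) *+ (a i == a j))) =
  if injectiveb a then \prod_i l (a i) else 0.
Proof.
case: ifPn => [/injectiveP inja|/injectivePn[i [j ij aij]]].
  rewrite (_ : (\matrix_(i, j) _) = diag_mx (\row_i l (a i))).
    by rewrite det_diag; apply: eq_bigr => i _; rewrite mxE.
  apply/matrixP => i j; rewrite !mxE (inj_eq inja).
  by case: eqVneq => [->|]; rewrite ?mulr1n ?mulr0n.
by apply: (determinant_alternate ij) => k; rewrite !mxE aij.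
Qed.

(** In the Leibniz expansion, each product of sums over [I] is distributed over index functions [a].
    After Fubini every point contributes one Gram entry, so for fixed [a] the sum over permutations
    is again a determinant, the one of [det_orthogonal], and only injective [a] survive. *)
Lemma cint_det_finite_rank (I : finType) (g : I -> T -> R[i]) (l : I -> R) n :
  (forall a, square_integrable mu (g a)) ->
  (forall a b, cip mu (g a) (g b) = (l a)%:C%C *+ (a == b)) ->
  cintegrable (power_measure mu n) (fun t => \det (ker_mx (finite_rank g) t)) /\
  cint (power_measure mu n) (fun t => \det (ker_mx (finite_rank g) t)) =
  (inj_sum l n)%:C%C.
Proof.
move=> gi gE.
(* Factors are grouped by point: the conjugate factor evaluated at the point [i] comes from the row
   that [s] sends to [i], hence the inverse permutation. *)
pose F (s : 'S_n) (a : {ffun 'I_n -> I}) (t : n.-tuple T) : R[i] :=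
  \prod_i (g (a i) (tnth t i) * conjc (g (a ((s^-1)%g i)) (tnth t i))).
have detE : (fun t => \det (ker_mx (finite_rank g) t)) =
    (fun t => \sum_(p : 'S_n * {ffun 'I_n -> I}) (-1) ^+ p.1 * F p.1 p.2 t).
  apply/funext => t; rewrite -(pair_bigA _ (fun (s : 'S_n) (a : {ffun 'I_n -> I}) => (-1) ^+ s * F s a t))/=.
  apply: eq_bigr => s _; rewrite -mulr_sumr; congr (_ * _).
  under eq_bigr do rewrite mxE.
  rewrite bigA_distr_bigA/=; apply: eq_bigr => a _; rewrite /F.
  rewrite !big_split/=; congr (_ * _).
  rewrite [RHS](reindex_inj (@perm_inj _ s))/=.
  by apply: eq_bigr => i _; rewrite permK.
have Fi s a : cintegrable (power_measure mu n) (F s a) /\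
    cint (power_measure mu n) (F s a) =
    \prod_i ((l (a i))%:C%C *+ (a i == a ((s^-1)%g i))).
  have hi (i : 'I_n) : cintegrable mu
      (fun x => g (a i) x * conjc (g (a ((s^-1)%g i)) x)).
    exact: cintegrable_mul_conj.
  have [h1 h2] := cint_power_prod hi.
  by split => //; rewrite h2; apply: eq_bigr => i _; exact: gE.
rewrite detE; split.
  by apply: cintegrable_sum => -[s a]; apply: cintegrableZ; exact: (Fi s a).1.
rewrite cint_sum => [|[s a]]; last by apply: cintegrableZ; exact: (Fi s a).1.
rewrite (eq_bigr (fun p : 'S_n * {ffun 'I_n -> I} => (-1) ^+ p.1 *
    \prod_i ((l (p.2 i))%:C%C *+ (p.2 i == p.2 ((p.1^-1)%g i))))); last first.
  by move=> [s a] _; rewrite cintZ; [rewrite (Fi s a).2|exact: (Fi s a).1].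
rewrite -(pair_bigA _ (fun (s : 'S_n) (a : {ffun 'I_n -> I}) => (-1) ^+ s * \prod_i
  ((l (a i))%:C%C *+ (a i == a ((s^-1)%g i)))))/= exchange_big/=.
rewrite /inj_sum rmorph_sum/= [RHS]big_mkcond/=; apply: eq_bigr => a _.
rewrite rmorph_prod/= -(det_orthogonal (fun b => (l b)%:C%C)).
rewrite [RHS](reindex_inj invg_inj)/=; apply: eq_bigr => s _.
rewrite odd_permV; congr (_ * _).
by apply: eq_bigr => i _; rewrite mxE.
Qed.

(** This invariance leaves the freedom to replace the functions by combinations that diagonalise
    their Gram matrix. *)
Lemma finite_rank_unitary N (U : 'M[R[i]]_N) (h : 'I_N -> T -> R[i]) :
  (forall b c, \sum_a U a b * conjc (U a c) = (b == c)%:R) ->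
  finite_rank (fun a x => \sum_b U a b * h b x) = finite_rank h.
Proof.
move=> UE; apply/funext => z; apply/funext => w; rewrite /finite_rank.
transitivity (\sum_a \sum_b \sum_c
    (U a b * conjc (U a c)) * (h b z * conjc (h c w))).
  apply: eq_bigr => a _; rewrite rmorph_sum mulr_suml; apply: eq_bigr => b _.
  rewrite mulr_sumr; apply: eq_bigr => c _.
  by rewrite rmorphM/= mulrACA.
rewrite exchange_big/=; apply: eq_bigr => b _; rewrite exchange_big/=.
rewrite (bigD1 b)//= -mulr_suml UE eqxx mul1r big1 ?addr0// => c cb.
by rewrite -mulr_suml UE eq_sym (negPf cb) mul0r.
Qed.

(** Spectral theorem for the Gram matrix. Both unitarity relations are returned: orthonormal columns
    keep the kernel unchanged, orthonormal rows keep the combined functions normalised. *)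
Lemma gram_diagonal N (h : 'I_N -> T -> R[i]) :
  (forall a, square_integrable mu (h a)) ->
  exists (U : 'M[R[i]]_N) (l : 'I_N -> R),
    [/\ forall b c, \sum_a U a b * conjc (U a c) = (b == c)%:R,
        forall b c, \sum_a U b a * conjc (U c a) = (b == c)%:R &
        forall a b, cip mu (fun x => \sum_c U a c * h c x)
                           (fun x => \sum_c U b c * h c x) =
                    (l a)%:C%C *+ (a == b)].
Proof.
move=> hi; pose M : 'M[R[i]]_N := \matrix_(a, b) cip mu (h a) (h b).
have Mherm : M \is hermsymmx.
  apply/is_hermitianmxP; rewrite expr0 scale1r; apply/matrixP => a b.
  by rewrite !mxE/= -[LHS]cip_conj.
pose P := spectralmx M.
have PU : P \is unitarymx by exact: spectral_unitarymx.
have ME := orthomx_spectralP (hermitian_normalmx Mherm).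
have Dreal := hermitian_spectral_diag_real Mherm.
have PMP : P *m M *m P^t* = diag_mx (spectral_diag M).
  rewrite {1}ME -/P invmx_unitary// !mulmxA (unitarymxP PU) mul1mx.
  by rewrite -mulmxA (unitarymxP PU) mulmx1.
exists P, (fun a => complex.Re (spectral_diag M ord0 a)); split.
- move=> b c; have : P^t* *m P = 1%:M.
    by rewrite -invmx_unitary// mulVmx// unitarymx_unit.
  move=> /matrixP/(_ c b); rewrite !mxE eq_sym => <-.
  by apply: eq_bigr => a _; rewrite !mxE mulrC.
- move=> b c; have /matrixP/(_ b c) := unitarymxP PU.
  by rewrite !mxE => <-; apply: eq_bigr => a _; rewrite !mxE.
- move=> a b; rewrite RRe_real; last by have /mxOverP := Dreal; exact.
  have /matrixP/(_ a b) := PMP; rewrite [in X in _ = X -> _]mxE eq_sym => <-.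
  have Li c : square_integrable mu (fun x => \sum_c0 P c c0 * h c0 x).
    by apply: square_integrable_sum => ?; exact: square_integrableZ.
  rewrite cip_suml// -mulmxA mxE; apply: eq_bigr => c _; congr (_ * _).
  rewrite cip_sumr// mxE; apply: eq_bigr => c' _.
  by rewrite !mxE mulrC.
Qed.

(* The eigenvalues are at most 1 because the diagonalised functions are
   restrictions to [D] of unit vectors. *)
Lemma cint_det_restrict N (f : 'I_N -> T -> R[i]) (D : set T) :
  measurable D -> (forall a, square_integrable mu (f a)) ->
  (forall a b, cip mu (f a) (f b) = (a == b)%:R) ->
  exists l : 'I_N -> R, (forall a, 0 <= l a <= 1) /\ forall n,
    let K := finite_rank (fun a x => (\1_D x)%:C%C * f a x) in
    cintegrable (power_measure mu n) (fun t => \det (ker_mx K t)) /\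
    cint (power_measure mu n) (fun t => \det (ker_mx K t)) =
      (inj_sum l n)%:C%C.
Proof.
move=> mD fi fE; pose h a x := (\1_D x)%:C%C * f a x.
have hi a : square_integrable mu (h a) by exact: square_integrable_restrict.
have [U [l [U1 U2 Ul]]] := gram_diagonal hi.
have Fi a : square_integrable mu (fun x => \sum_c U a c * f c x).
  by apply: square_integrable_sum => ?; exact: square_integrableZ.
exists l; split=> [a|n]; last first.
  rewrite /= -/h -(finite_rank_unitary h U1); apply: cint_det_finite_rank => //.
  by move=> a; apply: square_integrable_sum => ?; exact: square_integrableZ.
have la : l a = \int[mu]_x csq (\sum_c U a c * h c x).
  by have := Ul a a; rewrite eqxx cip_self => /complexI.
rewrite la; apply/andP; split.
  by apply: Rintegral_ge0 => x _; exact: csq_ge0.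
have F1 : \int[mu]_x csq (\sum_c U a c * f c x) = 1.
  apply: complexI; rewrite -cip_self cip_suml//.
  transitivity ((a == a)%:R : R[i]); last by rewrite eqxx.
  rewrite -U2; apply: eq_bigr => c _; congr (_ * _).
  rewrite cip_sumr// (bigD1 c)//= fE eqxx mulr1 big1 ?addr0// => b bc.
  by rewrite fE eq_sym (negPf bc) mulr0.
rewrite -F1; apply: le_Rintegral => //.
- by apply: sqint_csq; apply: square_integrable_sum => ?; exact: square_integrableZ.
- exact: sqint_csq.
- move=> x _; have -> : \sum_c U a c * h c x = (\1_D x)%:C%C * \sum_c U a c * f c x.
    by rewrite mulr_sumr; apply: eq_bigr => c _; rewrite mulrCA.
  rewrite csqM ler_piMl ?csq_ge0//.
  by rewrite /csq/= indicE; case: (_ \in _); rewrite ?expr1n ?expr0n/= ?addr0 ?ler01.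
Qed.

Lemma cipD f1 f2 g : square_integrable mu f1 -> square_integrable mu f2 ->
  square_integrable mu g ->
  cip mu (fun x => f1 x + f2 x) g = cip mu f1 g + cip mu f2 g.
Proof.
move=> f1i f2i gi; rewrite /cip -cintD; [|exact: cintegrable_mul_conj..].
by congr cint; apply/funext => x; rewrite mulrDl.
Qed.

(** Here [- w] is the projection of [u] on the span of the family, and the squared norm of the
    residual [u + w] is the difference of the two sides. *)
Lemma bessel N (f : 'I_N -> T -> R[i]) (u : T -> R[i]) :
  (forall a, square_integrable mu (f a)) -> square_integrable mu u ->
  (forall a b, cip mu (f a) (f b) = (a == b)%:R) ->
  \sum_a csq (cip mu u (f a)) <= \int[mu]_x csq (u x).
Proof.
move=> fi ui fE; pose w x := \sum_a (- cip mu u (f a)) * f a x.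
pose s : R := \sum_a csq (cip mu u (f a)).
have wi : square_integrable mu w.
  by apply: square_integrable_sum => a; exact: square_integrableZ.
have sE : s%:C%C = \sum_a cip mu u (f a) * conjc (cip mu u (f a)).
  by rewrite /s rmorph_sum/=; apply: eq_bigr => a _; rewrite csqE.
have uw : cip mu u w = - s%:C%C.
  rewrite sE cip_sumr// -sumrN; apply: eq_bigr => a _.
  by rewrite rmorphN/= mulNr mulrC.
have wu : cip mu w u = - s%:C%C.
  by rewrite -cip_conj// uw; apply/eqP; rewrite eq_complex/= !oppr0 !eqxx.
have ww : cip mu w w = s%:C%C.
  rewrite cip_suml// sE; apply: eq_bigr => a _.
  rewrite cip_sumr// (eq_bigr (fun b => - conjc (cip mu u (f b)) * (a == b)%:R));
    last by move=> b _; rewrite rmorphN fE.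
  rewrite (bigD1 a)//= eqxx mulr1 big1 ?addr0 ?mulrNN// => b ba.
  by rewrite eq_sym (negPf ba) mulr0.
have vi : square_integrable mu (fun x => u x + w x) by exact: square_integrableD.
have : (\int[mu]_x csq (u x + w x))%:C%C = (\int[mu]_x csq (u x) - s)%:C%C.
  rewrite -cip_self cipD// -(cip_conj vi ui) -(cip_conj vi wi) !cipD//.
  rewrite uw wu ww cip_self; apply/eqP; rewrite eq_complex/=.
  by apply/andP; split; apply/eqP; ring.
move=> /complexI vE; rewrite -subr_ge0 -/s -vE.
by apply: Rintegral_ge0 => x _; exact: csq_ge0.
Qed.

End FiniteRank.

(** * Perturbation of determinants and the limit of growing rank *)

Local Notation normc := ComplexField.Normc.normc.

Section Perturbation.
Variable R : realType.
Implicit Types z w : R[i].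

Lemma normc_ge0 z : 0 <= normc z.
Proof. by case: z => a b; exact: sqrtr_ge0. Qed.

Lemma normr_Re_le z : `|complex.Re z| <= normc z.
Proof.
by case: z => a b; rewrite /= -sqrtr_sqr ler_wsqrtr// lerDl sqr_ge0.
Qed.

Lemma normr_Im_le z : `|complex.Im z| <= normc z.
Proof.
by case: z => a b; rewrite /= -sqrtr_sqr ler_wsqrtr// lerDr sqr_ge0.
Qed.

Lemma normc_real (x : R) : normc x%:C%C = `|x|.
Proof. by rewrite /= expr0n/= addr0 sqrtr_sqr. Qed.

Lemma normc_sum (I : Type) (s : seq I) (F : I -> R[i]) :
  normc (\sum_(i <- s) F i) <= \sum_(i <- s) normc (F i).
Proof.
elim: s => [|i s ih]; first by rewrite !big_nil ComplexField.Normc.normc0.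
by rewrite !big_cons (le_trans (le_normcD _ _))// lerD2l.
Qed.

Lemma normc_prod (I : Type) (s : seq I) (F : I -> R[i]) :
  normc (\prod_(i <- s) F i) = \prod_(i <- s) normc (F i).
Proof.
elim: s => [|i s ih]; first by rewrite !big_nil ComplexField.Normc.normc1.
by rewrite !big_cons ComplexField.Normc.normcM ih.
Qed.

Lemma normc_signM n z : normc ((-1) ^+ n * z) = normc z.
Proof.
by rewrite -signr_odd; case: odd; rewrite ?expr0 ?expr1 ?mul1r// mulN1r normcN.
Qed.

(** Telescoping, one factor changed at a time. The telescoping has only size - 1 unchanged factors;
    [1 <= C] rounds the exponent up to the size. *)
Lemma normc_prodB_le (I : Type) (s : seq I) (F G : I -> R[i]) (C e : R) :
  1 <= C -> (forall i, normc (F i) <= C) -> (forall i, normc (G i) <= C) ->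
  (forall i, normc (F i - G i) <= e) ->
  normc (\prod_(i <- s) F i - \prod_(i <- s) G i) <= (size s)%:R * C ^+ size s * e.
Proof.
move=> C1 FC GC FGe; have C0 : 0 <= C by exact: le_trans C1.
elim: s => [|i s ih].
  by rewrite !big_nil subrr ComplexField.Normc.normc0 !mul0r.
rewrite !big_cons.
have e0 : 0 <= e := le_trans (normc_ge0 _) (FGe i).
have -> : F i * \prod_(j <- s) F j - G i * \prod_(j <- s) G j =
    (F i - G i) * \prod_(j <- s) F j + G i * (\prod_(j <- s) F j - \prod_(j <- s) G j).
  by ring.
apply: le_trans (le_normcD _ _) _; rewrite !ComplexField.Normc.normcM.
apply: (@le_trans _ _ (e * C ^+ size s + C * ((size s)%:R * C ^+ size s * e))).
  apply: lerD; apply: ler_pM; rewrite ?normc_ge0//.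
  rewrite normc_prod; elim: {ih} s => [|j s ih]; first by rewrite big_nil.
  by rewrite big_cons exprS ler_pM ?normc_ge0// prodr_ge0// => ? _; exact: normc_ge0.
rewrite /= -natr1 exprS mulrDl mul1r mulrDl addrC.
apply: lerD; first by rewrite le_eqVlt; apply/orP; left; apply/eqP; ring.
by rewrite mulrC ler_wpM2r// ler_peMl// exprn_ge0.
Qed.

(** The crude Leibniz bound suffices: n and [C] stay fixed while [e] tends to 0. *)
Lemma normc_detB_le n (A B : 'M[R[i]]_n) (C e : R) : 1 <= C ->
  (forall i j, normc (A i j) <= C) -> (forall i j, normc (B i j) <= C) ->
  (forall i j, normc (A i j - B i j) <= e) ->
  normc (\det A - \det B) <= n`!%:R * (n%:R * C ^+ n * e).
Proof.
move=> C1 AC BC ABe; rewrite /determinant -sumrB.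
apply: le_trans (normc_sum _ _) _.
apply: (@le_trans _ _ (\sum_(s : 'S_n) n%:R * C ^+ n * e)); last first.
  by rewrite sumr_const card_Sn -[leLHS]mulr_natl.
apply: ler_sum => s _; rewrite -mulrBr normc_signM.
have := @normc_prodB_le _ (index_enum 'I_n) (fun i => A i (s i)) (fun i => B i (s i))
  C e C1 (fun i => AC _ _) (fun i => BC _ _) (fun i => ABe _ _).
by rewrite -sum1_size sum_nat_const card_ord muln1.
Qed.

Lemma normc_det_le n (A : 'M[R[i]]_n) (C : R) :
  (forall i j, normc (A i j) <= C) -> normc (\det A) <= n`!%:R * C ^+ n.
Proof.
move=> AC; apply: le_trans (normc_sum _ _) _.
apply: (@le_trans _ _ (\sum_(s : 'S_n) C ^+ n)); last first.
  by rewrite sumr_const card_Sn -[leLHS]mulr_natl.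
apply: ler_sum => s _; rewrite normc_signM normc_prod.
rewrite -[in leRHS](card_ord n) -prodr_const.
by apply: ler_prod => i _; rewrite normc_ge0 AC.
Qed.

End Perturbation.

Section Limit.
Context d (T : measurableType d) (R : realType).
Variable mu : {sigma_finite_measure set T -> \bar R}.
Variable D : set T.
Hypothesis mD : measurable D.
Hypothesis finD : (mu D < +oo)%E.

Definition tuple_pow n (A : set T) : set (n.-tuple T) :=
  [set t | forall i, A (tnth t i)].

Lemma indic_tuple_pow n (A : set T) (t : n.-tuple T) :
  \1_(tuple_pow A) t = \prod_i \1_A (tnth t i) :> R.
Proof.
rewrite indicE; have [At|] := pselect (tuple_pow A t).
  by rewrite mem_set// big1// => i _; rewrite indicE mem_set.
move=> nAt; rewrite memNset//; move/existsNP : nAt => [i nAi].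
by rewrite (bigD1 i)//= indicE memNset// mul0r.
Qed.

(** Cutting the kernel off outside D x D lets every integral over D^n be taken over the whole space
    of tuples, and keeps the determinant structure. *)
Definition restrict_ker (K : T -> T -> R[i]) z w : R[i] :=
  (\1_D z)%:C%C * (\1_D w)%:C%C * K z w.

Lemma det_restrict_ker (K : T -> T -> R[i]) n (t : n.-tuple T) :
  \det (ker_mx (restrict_ker K) t) =
  (\1_(tuple_pow D) t)%:C%C * \det (ker_mx K t).
Proof.
rewrite indicE; have [Dt|] := pselect (tuple_pow D t).
  rewrite mem_set// mul1r; congr (\det _); apply/matrixP => i j.
  by rewrite !mxE /restrict_ker !indicE !mem_set// !mul1r.
move=> nDt; rewrite memNset// mul0r; move/existsNP : nDt => [i nDi].
rewrite /determinant big1// => s _; rewrite (bigD1 i)//= mxE /restrict_ker.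
by rewrite indicE memNset// !mul0r mulr0.
Qed.

Lemma restrict_finite_rank (I : finType) (g : I -> T -> R[i]) :
  finite_rank (fun a x => (\1_D x)%:C%C * g a x) = restrict_ker (finite_rank g).
Proof.
apply/funext => z; apply/funext => w; rewrite /restrict_ker mulr_sumr.
apply: eq_bigr => a _; rewrite [conjc _](_ : _ = (\1_D w)%:C%C * conjc (g a w)).
  by rewrite mulrACA.
by rewrite rmorphM; congr (_ * _); exact: conjc_real.
Qed.

Lemma integrable_indic_lty : mu.-integrable setT (EFin \o (\1_D : T -> R)).
Proof.
apply/integrableP; split; first exact/measurable_EFinP.
rewrite (eq_integral (fun x => (\1_D x)%:E)); last first.
  by move=> x _; rewrite /= ger0_norm.
by rewrite integral_indic// setIT.
Qed.

Lemma indic_tuple_pow_integral n :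
  (power_measure mu n).-integrable setT
    (EFin \o (\1_(tuple_pow D) : n.-tuple T -> R)) /\
  \int[power_measure mu n]_t (\1_(tuple_pow D) t) = fine (mu D) ^+ n.
Proof.
have hi (i : 'I_n) : cintegrable mu (fun x => (\1_D x)%:C%C).
  by split; [exact: integrable_indic_lty|exact: integrable0].
have pE : (fun t : n.-tuple T => \prod_(i < n) (\1_D (tnth t i))%:C%C) =
    (fun t : n.-tuple T => (\1_(tuple_pow D) t)%:C%C) :> (_ -> R[i]).
  by apply/funext => t; rewrite indic_tuple_pow rmorph_prod.
have [] := cint_power_prod hi; rewrite pE => -[h _] /(congr1 (@complex.Re _))/= hE.
split => //; rewrite [LHS]hE.
have -> : cint mu (fun x => (\1_D x)%:C%C) = (fine (mu D))%:C%C.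
  rewrite /cint/= /Rintegral integral0; congr Complex.
  by rewrite integral_indic// setIT.
by rewrite -rmorph_prod/= prodr_const card_ord.
Qed.

Lemma integrable_det_restrict (K : T -> T -> R[i]) n (C : R) :
  measurable_fun setT (fun t : n.-tuple T =>
    complex.Re (\det (ker_mx (restrict_ker K) t))) ->
  (forall z w, D z -> D w -> normc (K z w) <= C) ->
  (power_measure mu n).-integrable setT (EFin \o (fun t : n.-tuple T =>
    complex.Re (\det (ker_mx (restrict_ker K) t)))).
Proof.
move=> mK KC; have [indi _] := indic_tuple_pow_integral n.
apply: (@integrable_le _ _ _ _ _
  (fun t => n`!%:R * C ^+ n * \1_(tuple_pow D) t)) => //.
  exact: integrable_scale.
move=> t; rewrite det_restrict_ker.
apply: le_trans (normr_Re_le _) _; rewrite ComplexField.Normc.normcM normc_real.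
rewrite indicE; have [Dt|nDt] := pselect (tuple_pow D t).
  rewrite mem_set// normr1 mul1r mulr1; apply: normc_det_le => i j.
  by rewrite mxE KC.
by rewrite memNset// normr0 mul0r mulr0.
Qed.

(** For a determinantal process with kernel [K] this is the n-th factorial moment of the number of
    points in D. *)
Definition correlation_integral (K : T -> T -> R[i]) n : R :=
  \int[power_measure mu n]_t complex.Re (\det (ker_mx (restrict_ker K) t)).

Lemma correlation_integralB_le (K L : T -> T -> R[i]) n (C e : R) : 1 <= C ->
  measurable_fun setT (fun t : n.-tuple T =>
    complex.Re (\det (ker_mx (restrict_ker K) t))) ->
  measurable_fun setT (fun t : n.-tuple T =>
    complex.Re (\det (ker_mx (restrict_ker L) t))) ->
  (forall z w, D z -> D w -> normc (K z w) <= C) ->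
  (forall z w, D z -> D w -> normc (L z w) <= C) ->
  (forall z w, D z -> D w -> normc (K z w - L z w) <= e) ->
  `|correlation_integral K n - correlation_integral L n| <=
    n`!%:R * (n%:R * C ^+ n) * fine (mu D) ^+ n * e.
Proof.
move=> C1 mK mL KC LC KLe; have [indi indE] := indic_tuple_pow_integral n.
have Ki := integrable_det_restrict mK KC.
have Li := integrable_det_restrict mL LC.
rewrite /correlation_integral -RintegralB//.
apply: le_trans (le_normr_Rintegral _ _) _ => //.
  exact: (integrableB measurableT Ki Li).
rewrite mulrAC -indE -RintegralZl//; apply: le_Rintegral => //.
- by apply: integrable_norm; exact: (integrableB measurableT Ki Li).
- exact: integrable_scale.
move=> t _; rewrite -raddfB !det_restrict_ker -mulrBr.
apply: le_trans (normr_Re_le _) _; rewrite ComplexField.Normc.normcM normc_real.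
rewrite indicE; have [Dt|nDt] := pselect (tuple_pow D t); last first.
  by rewrite memNset// normr0 mul0r mulr0.
rewrite mem_set// normr1 mul1r mulr1 -mulrA.
by apply: normc_detB_le => // i j; rewrite !mxE; [exact: KC|exact: LC|exact: KLe].
Qed.

(** For each rank N this is [sum_inj_sum_le], with eigenvalues that depend on N. Both sides are
    continuous functions of finitely many correlation integrals, and these converge by
    [correlation_integralB_le]. *)
Lemma bonferroni_correlation_le (K : T -> T -> R[i]) (f : nat -> T -> R[i])
    (eps : nat -> R) (C : R) m (I := correlation_integral K) :
  1 <= C ->
  (forall a, square_integrable mu (f a)) ->
  (forall a b, cip mu (f a) (f b) = (a == b)%:R) ->
  (forall n, measurable_fun setT (fun t : n.-tuple T =>
    complex.Re (\det (ker_mx (restrict_ker K) t)))) ->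
  (forall z w, D z -> D w -> normc (K z w) <= C) ->
  (forall N z w, D z -> D w ->
    normc (finite_rank (fun a : 'I_N => f a) z w) <= C) ->
  (forall N z w, D z -> D w ->
    normc (finite_rank (fun a : 'I_N => f a) z w - K z w) <= eps N) ->
  eps N @[N --> \oo] --> 0 ->
  \sum_(n < (m.*2).+1) (-1) ^+ n / n`!%:R * I n <=
  expR (- I 1 - (I 1 ^+ 2 - I 2) / 2) + I 1 ^+ (m.*2).+1 / (m.*2).+1`!%:R.
Proof.
move=> C1 fi fE mK KC KNC Ke eps0.
pose KN N := finite_rank (fun a : 'I_N => f a).
pose J N := correlation_integral (KN N).
have JE N : exists l : 'I_N -> R, (forall a, 0 <= l a <= 1) /\
    forall n, measurable_fun setT (fun t : n.-tuple T =>
      complex.Re (\det (ker_mx (restrict_ker (KN N)) t))) /\ J N n = inj_sum l n.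
  have fE' (a b : 'I_N) : cip mu (f a) (f b) = (a == b)%:R by rewrite fE.
  have [l [l01 lE]] := @cint_det_restrict _ _ _ mu N (fun a => f a) D mD
    (fun a => fi a) fE'.
  exists l; split => // n; have := lE n; rewrite /= restrict_finite_rank.
  by move=> [[/measurable_int/measurable_EFinP h _] /(congr1 (@complex.Re _))].
have JI n : J N n @[N --> \oo] --> I n.
  apply/cvgrPdist_le => e e0.
  pose M := n`!%:R * (n%:R * C ^+ n) * fine (mu D) ^+ n.
  have M0 : 0 <= M.
    by rewrite !mulr_ge0// exprn_ge0// ?fine_ge0// (le_trans ler01).
  have : M * eps N @[N --> \oo] --> M * 0 by apply: cvgM => //; exact: cvg_cst.
  rewrite mulr0 => /cvgrPdist_le /(_ _ e0); apply: filterS => N.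
  rewrite sub0r normrN => h; rewrite distrC.
  apply: le_trans (le_trans (ler_norm _) h).
  apply: correlation_integralB_le => //.
  - by have [l [_ /(_ n)[]]] := JE N.
  - exact: KNC.
  - exact: Ke.
pose lhs N := \sum_(n < (m.*2).+1) (-1) ^+ n / n`!%:R * J N n.
pose rhs N := expR (- J N 1 - (J N 1 ^+ 2 - J N 2) / 2) +
  J N 1 ^+ (m.*2).+1 / (m.*2).+1`!%:R.
have lhs_cvg : lhs N @[N --> \oo] --> \sum_(n < (m.*2).+1) (-1) ^+ n / n`!%:R * I n.
  rewrite /lhs; elim: (m.*2).+1 => [|p ih].
    by under eq_fun do rewrite big_ord0; rewrite big_ord0; exact: cvg_cst.
  under eq_fun do rewrite big_ord_recr; rewrite big_ord_recr/=.
  by apply: cvgD => //; apply: cvgM; [exact: cvg_cst|exact: JI].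
have rhs_cvg : rhs N @[N --> \oo] --> expR (- I 1 - (I 1 ^+ 2 - I 2) / 2) +
    I 1 ^+ (m.*2).+1 / (m.*2).+1`!%:R.
  have JX p : J N 1 ^+ p @[N --> \oo] --> I 1 ^+ p.
    exact: (continuous_cvg _ (@exprn_continuous R p (I 1)) (JI 1%N)).
  apply: cvgD; last by apply: cvgM => //; exact: cvg_cst.
  apply: (@continuous_cvg _ _ _ _ _ _ expR); first exact: continuous_expR.
  apply: cvgB; first exact: cvgN.
  by apply: cvgM; [exact: cvgB|exact: cvg_cst].
apply: (ler_cvg_to lhs_cvg rhs_cvg); apply: nearW => N.
have [l [l01 /all_and2[_ lE]]] := JE N; rewrite /lhs /rhs !lE.
under eq_bigr do rewrite lE.
exact: sum_inj_sum_le.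
Qed.

End Limit.

(** * Planar Lebesgue measure *)

Section PlaneMeasure.
Variable R : realType.
Local Notation mu := (@lebesgue_measure R).
Implicit Types (z w : plane R) (r : R).

Definition affine_plane r z : plane R -> plane R :=
  fun w => (r * w.1 + z.1, r * w.2 + z.2).

Lemma measurable_affine r (x : R) :
  measurable_fun setT (fun y : measurableTypeR R => r * y + x : measurableTypeR R).
Proof. by apply: measurable_funD => //; exact: measurable_funM. Qed.

Lemma measurable_affine_plane r z : measurable_fun setT (affine_plane r z).
Proof.
apply: measurable_fun_pair.
- exact: (measurableT_comp (measurable_affine r z.1) measurable_fst).
- exact: (measurableT_comp (measurable_affine r z.2) measurable_snd).
Qed.

(** The rescaled image measure agrees with Lebesgue measure on half-open intervals, hence
    everywhere. The planar version argues in the same way with rectangles. *)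
Lemma lebesgue_measure_affine r (x : R) (A : set (measurableTypeR R)) :
  0 < r -> measurable A ->
  mu ((fun y => r * y + x) @^-1` A) = (r^-1%:E * mu A)%E.
Proof.
move=> r0 mA.
have mf := measurable_affine r x.
pose nu : {measure set (measurableTypeR R) -> \bar R} :=
  mscale (NngNum (ltW r0)) (pushforward mu (fun y : measurableTypeR R => r * y + x : measurableTypeR R)).
have nuE X : nu mf X = (r%:E * mu ((fun y : R => (r * y + x)%R) @^-1` X))%E by [].
have : mu A = nu mf A.
  apply: lebesgue_measure_unique => // X [[a b] _ <-]; rewrite nuE.
  rewrite (_ : _ @^-1` _ = `](a - x) / r, (b - x) / r]%classic).
    rewrite !lebesgue_measure_itv/= !lte_fin ltr_pM2r ?invr_gt0// ltrD2r.
    case: ifPn; last by rewrite mule0.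
    rewrite -!EFinB -EFinM => _; congr EFin; field.
    exact: lt0r_neq0.
  apply/seteqP; split => y /=; rewrite !in_itv/= ltr_pdivrMr// ler_pdivlMr//;
    by rewrite ltrBlDr lerBrDr mulrC.
rewrite nuE => ->; rewrite muleA -EFinM mulVf ?mul1e//.
exact: lt0r_neq0.
Qed.

Lemma lebC_affine r z (A : set (plane R)) : 0 < r -> measurable A ->
  lebC (affine_plane r z @^-1` A) = ((r ^- 2)%:E * lebC A)%E.
Proof.
move=> r0 mA; have mf := measurable_affine_plane r z.
have r20 : 0 <= r ^+ 2 by rewrite sqr_ge0.
pose nu : {measure set (plane R) -> \bar R} :=
  mscale (NngNum r20) (pushforward lebC (affine_plane r z)).
have nuE X : nu mf X = ((r ^+ 2)%:E * lebC (affine_plane r z @^-1` X))%E by [].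
have : lebC A = nu mf A.
  apply: product_measure_unique => // X Y mX mY.
  transitivity ((r ^+ 2)%:E * lebC (((fun y : R => (r * y + z.1)%R) @^-1` X) `*`
    ((fun y : R => (r * y + z.2)%R) @^-1` Y)))%E; first by rewrite nuE.
  have mp c (B : set (measurableTypeR R)) : measurable B ->
      measurable ((fun y : R => r * y + c) @^-1` B).
    by move=> mB; rewrite -[X in measurable X]setTI; exact: measurable_affine.
  rewrite /lebC product_measure1E; [|exact: mp..].
  rewrite [X in (_ * (X * _))%E](lebesgue_measure_affine z.1 r0 mX).
  rewrite [X in (_ * (_ * X))%E](lebesgue_measure_affine z.2 r0 mY).
  have rE (a b : \bar R) :
      ((r ^+ 2)%:E * ((r^-1%:E * a) * (r^-1%:E * b)) = a * b)%E.
    rewrite (muleACA (r^-1%:E)) (muleA (r ^+ 2)%:E) -!EFinM.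
    by rewrite (_ : r ^+ 2 * _ = 1) ?mul1e//; field; exact: lt0r_neq0.
  exact: rE.
rewrite nuE => ->; rewrite muleA -EFinM mulVf ?mul1e//.
by rewrite expf_neq0// lt0r_neq0.
Qed.

Lemma ge0_integral_affine r z (f : plane R -> \bar R) : 0 < r ->
  measurable_fun setT f -> (forall x, 0 <= f x)%E ->
  (\int[lebC]_x f (affine_plane r z x) = (r ^- 2)%:E * \int[lebC]_x f x)%E.
Proof.
move=> r0 mf f0; have ma := measurable_affine_plane r z.
have r20 : 0 <= r ^- 2 by rewrite invr_ge0 sqr_ge0.
transitivity (\int[pushforward lebC (affine_plane r z)]_x f x)%E.
  by rewrite ge0_integral_pushforward.
transitivity (\int[mscale (NngNum r20) lebC]_x f x)%E; last first.
  by rewrite ge0_integral_mscale.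
apply: eq_measure_integral => A mA _.
exact: lebC_affine.
Qed.

End PlaneMeasure.

Section Modulus.
Variable R : realType.
Implicit Types (z w : plane R) (r : R).

Lemma cabs_ge0 z : 0 <= cabs z.
Proof. exact: normc_ge0. Qed.

Lemma cabs_sqr z : cabs z ^+ 2 = z.1 ^+ 2 + z.2 ^+ 2.
Proof. by rewrite /cabs/= sqr_sqrtr// addr_ge0 ?sqr_ge0. Qed.

Lemma csq_toC z : csq (toC z) = cabs z ^+ 2.
Proof. by rewrite cabs_sqr. Qed.

Lemma toCD z w : toC (z + w) = toC z + toC w.
Proof. by []. Qed.

Lemma toCN z : toC (- z) = - toC z.
Proof. by []. Qed.

Lemma cabsN z : cabs (- z) = cabs z.
Proof. by rewrite /cabs toCN normcN. Qed.

Lemma cabs_subC z w : cabs (z - w) = cabs (w - z).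
Proof. by rewrite -cabsN opprB. Qed.

Lemma cabs_triangle z w : cabs (z + w) <= cabs z + cabs w.
Proof. by rewrite /cabs toCD le_normcD. Qed.

Lemma measurable_cabs : measurable_fun setT (@cabs R).
Proof.
have h : measurable_fun setT (fun z : plane R => z.1 ^+ 2 + z.2 ^+ 2).
  by apply: measurable_funD; apply: measurable_funX;
    [exact: measurable_fst|exact: measurable_snd].
exact: (measurableT_comp (continuous_measurable_fun (@sqrt_continuous R)) h).
Qed.

Lemma measurable_cabs_sub d (T : measurableType d) (f g : T -> plane R) :
  measurable_fun setT f -> measurable_fun setT g ->
  measurable_fun setT (fun t => cabs (f t - g t)).
Proof.
move=> mf mg; apply: (measurableT_comp measurable_cabs).
have mc1 (h : T -> plane R) : measurable_fun setT h ->
    measurable_fun setT (fun t => (h t).1) by exact: measurableT_comp.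
have mc2 (h : T -> plane R) : measurable_fun setT h ->
    measurable_fun setT (fun t => (h t).2) by exact: measurableT_comp.
apply: measurable_fun_pair; apply: measurable_funB.
- exact: mc1.
- exact: mc1.
- exact: mc2.
- exact: mc2.
Qed.

Lemma measurable_set_ltr d (T : measurableType d) (f g : T -> R) :
  measurable_fun setT f -> measurable_fun setT g ->
  measurable [set t | f t < g t].
Proof.
move=> mf mg; rewrite -[X in measurable X]setTI.
rewrite (_ : [set t | _] = (fun t => f t < g t) @^-1` [set true]).
  exact: measurable_fun_ltr.
by apply/seteqP; split => t.
Qed.

Lemma measurable_disc z r : measurable (disc z r).
Proof.
rewrite (_ : disc z r = (fun w => cabs (w - z)) @^-1` `]-oo, r[%classic).
  rewrite -[X in measurable X]setTI; apply: measurable_cabs_sub => //.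
by apply/seteqP; split => w /=; rewrite /disc in_itv.
Qed.

Lemma cabs_affine r z w : 0 <= r -> cabs (affine_plane r z w - z) = r * cabs w.
Proof.
move=> r0; apply/eqP; rewrite -(@eqrXn2 _ 2) ?cabs_ge0 ?mulr_ge0 ?cabs_ge0//.
by rewrite exprMn !cabs_sqr/= /affine_plane; apply/eqP => /=; ring.
Qed.

Lemma lebC_disc_scale r z : 0 < r ->
  lebC (disc z r) = ((r ^+ 2)%:E * lebC (disc 0 1 : set (plane R)))%E.
Proof.
move=> r0; have := @lebC_affine R r z _ r0 (measurable_disc z r).
rewrite (_ : affine_plane r z @^-1` _ = disc 0 1).
  move=> ->; rewrite muleA -EFinM mulfV ?mul1e//.
  by rewrite expf_neq0// lt0r_neq0.
apply/seteqP; split => w; rewrite /disc /= subr0 cabs_affine ?ltW//.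
  by rewrite gtr_pMr.
by rewrite gtr_pMr.
Qed.

End Modulus.

(** * Rotation invariance of planar Lebesgue measure *)

Section Rotation.
Variable R : realType.
Local Notation mu := (@lebesgue_measure R).
Implicit Types (z w : plane R) (r c s t : R).

Lemma lebC_ysection (A : set (plane R)) : measurable A ->
  lebC A = (\int[mu]_y mu (ysection A y))%E.
Proof.
move=> mA; apply: (@product_measure_unique _ _ _ _ _ mu mu
  (mu \x^ mu)%E _ _ mA) => B C mB mC.
exact: product_measure2E.
Qed.

(** A shear translates each line parallel to its axis, so it preserves area by translation
    invariance in dimension one. *)
Definition shear1 t z : plane R := (z.1 + t * z.2, z.2).
Definition shear2 t z : plane R := (z.1, z.2 + t * z.1).

Lemma measurable_shear1 t : measurable_fun setT (shear1 t).
Proof.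
apply: measurable_fun_pair; last exact: measurable_snd.
apply: measurable_funD; first exact: measurable_fst.
by apply: measurable_funM => //; exact: measurable_snd.
Qed.

Lemma measurable_shear2 t : measurable_fun setT (shear2 t).
Proof.
apply: measurable_fun_pair; first exact: measurable_fst.
apply: measurable_funD; first exact: measurable_snd.
by apply: measurable_funM => //; exact: measurable_fst.
Qed.

Lemma lebesgue_measure_translate (x : R) (A : set (measurableTypeR R)) :
  measurable A -> mu ((fun y => y + x) @^-1` A) = mu A.
Proof.
move=> mA; have := @lebesgue_measure_affine R 1 x A ltr01 mA.
rewrite invr1 mul1e => <-; congr (mu _).
by apply/seteqP; split => y /=; rewrite mul1r.
Qed.

Lemma lebC_shear1 t (A : set (plane R)) : measurable A ->
  lebC (shear1 t @^-1` A) = lebC A.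
Proof.
move=> mA; have mpA : measurable (shear1 t @^-1` A).
  by rewrite -[X in measurable X]setTI; exact: measurable_shear1.
rewrite !lebC_ysection//; apply: eq_integral => y _.
rewrite -[RHS](@lebesgue_measure_translate (t * y)); last exact: measurable_ysection.
by congr (mu _); apply/seteqP; split => x; rewrite /ysection/= !inE.
Qed.

Lemma lebC_shear2 t (A : set (plane R)) : measurable A ->
  lebC (shear2 t @^-1` A) = lebC A.
Proof.
move=> mA; have mpA : measurable (shear2 t @^-1` A).
  by rewrite -[X in measurable X]setTI; exact: measurable_shear2.
apply: eq_integral => x _ /=.
rewrite -[RHS](@lebesgue_measure_translate (t * x)); last exact: measurable_xsection.
by congr (mu _); apply/seteqP; split => y; rewrite /xsection/= !inE.
Qed.

Definition rotation c s z : plane R := (c * z.1 - s * z.2, s * z.1 + c * z.2).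

(** The classical factorisation of a rotation into three shears. The outer coefficient is minus the
    tangent of the half angle, which excludes the half turn. *)
Lemma rotation_shear c s z : c ^+ 2 + s ^+ 2 = 1 -> 1 + c != 0 ->
  rotation c s z =
  shear1 (- (s / (1 + c))) (shear2 s (shear1 (- (s / (1 + c))) z)).
Proof.
move=> cs c1; set t := - (s / (1 + c)).
have tc : t * (1 + c) = - s by rewrite /t mulNr divfK.
have ts : 1 + t * s = c.
  apply: (mulIf c1); rewrite mulrDl mul1r mulrAC tc.
  by rewrite -{1}cs; ring.
rewrite /rotation /shear1 /shear2/=; congr pair.
  transitivity (z.1 * (1 + t * s) + t * (1 + (1 + t * s)) * z.2); last by ring.
  by rewrite ts tc; ring.
transitivity (s * z.1 + (1 + t * s) * z.2); last by ring.
by rewrite ts.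
Qed.

Lemma lebC_rotation c s (A : set (plane R)) :
  c ^+ 2 + s ^+ 2 = 1 -> 1 + c != 0 -> measurable A ->
  lebC (rotation c s @^-1` A) = lebC A.
Proof.
move=> cs c1 mA; set t := - (s / (1 + c)).
have m1 B : measurable B -> measurable (shear1 t @^-1` B).
  by move=> mB; rewrite -[X in measurable X]setTI; exact: measurable_shear1.
have m2 B : measurable B -> measurable (shear2 s @^-1` B).
  by move=> mB; rewrite -[X in measurable X]setTI; exact: measurable_shear2.
transitivity (lebC (shear1 t @^-1` (shear2 s @^-1` (shear1 t @^-1` A)))).
  by congr (lebC _); apply/seteqP; split => z; rewrite /= rotation_shear.
rewrite (lebC_shear1 t (m2 _ (m1 _ mA))) (lebC_shear2 s (m1 _ mA)).
exact: lebC_shear1.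
Qed.

End Rotation.

(** * Gaussian moments in the plane, without polar coordinates *)

Section RadialIntegral.
Variable R : realType.
Local Notation mu := (@lebesgue_measure R).

(** Tonelli on the set |z| < s. For radial functions written as tails, this layer formula replaces
    polar coordinates. *)
Lemma integral_layer (g : R -> R) : (forall s, 0 <= s -> 0 <= g s) ->
  measurable_fun setT g ->
  (\int[lebC]_z \int[mu]_(s in `]cabs z, +oo[) (g s)%:E =
   \int[mu]_(s in `]0%R, +oo[) ((g s)%:E * lebC (disc 0 s)))%E.
Proof.
move=> g0 mg.
pose S : set (plane R * measurableTypeR R) := [set p | cabs p.1 < p.2].
have mS : measurable S.
  apply: measurable_set_ltr; last exact: measurable_snd.
  exact: (measurableT_comp (@measurable_cabs R) measurable_fst).
pose F (p : plane R * measurableTypeR R) : \bar R := (\1_S p * g p.2)%:E.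
have mF : measurable_fun setT F.
  apply/measurable_EFinP; apply: measurable_funM => //.
  exact: (measurableT_comp mg measurable_snd).
have F0 p : (0 <= F p)%E.
  rewrite /F lee_fin indicE; case: (boolP (p \in S)) => [|_]; last by rewrite mul0r.
  by rewrite inE /S/= mul1r => h; apply: g0; rewrite (le_trans (cabs_ge0 p.1))// ltW.
have := @fubini_tonelli _ _ _ _ _ (lebC : {sigma_finite_measure set (plane R) -> \bar R})
  (mu : {sigma_finite_measure set (measurableTypeR R) -> \bar R}) F mF F0.
have -> : (\int[lebC]_z \int[mu]_s F (z, s) =
    \int[lebC]_z \int[mu]_(s in `]cabs z, +oo[) (g s)%:E)%E.
  apply: eq_integral => z _; rewrite [RHS]integral_mkcond; apply: eq_integral => s _.
  have [zs|sz] := ltP (cabs z) s.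
    have zsS : S (z, s) by [].
    have zsI : `]cabs z, +oo[%classic s by rewrite /= in_itv/= zs.
    by rewrite patchE (mem_set zsI) /F indicE (mem_set zsS) mul1r.
  have zsS : ~ S (z, s) by apply/negP; rewrite -leNgt.
  have zsI : ~ `]cabs z, +oo[%classic s by rewrite /= in_itv/= ltNge sz.
  by rewrite patchE (memNset zsI) /F indicE (memNset zsS) mul0r.
move=> ->; rewrite [RHS]integral_mkcond; apply: eq_integral => s _.
have [s0|] := ltP 0 s.
  have sI : `]0, +oo[%classic s by rewrite /= in_itv/= s0.
  rewrite patchE (mem_set sI).
  transitivity (\int[lebC]_z ((g s)%:E * (\1_(disc 0 s) z)%:E))%E.
    apply: eq_integral => z _; rewrite /F -EFinM mulrC; congr (_ * _)%:E.
    rewrite !indicE; congr ((_ : bool)%:R).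
    by apply/idP/idP; rewrite !inE /S /disc/= subr0.
  rewrite ge0_integralZl//.
  - by rewrite integral_indic ?setIT//; exact: measurable_disc.
  - by apply/measurable_EFinP; apply: measurable_indic; exact: measurable_disc.
  - by rewrite lee_fin g0// ltW.
move=> s0; have sI : ~ `]0, +oo[%classic s by rewrite /= in_itv/= ltNge s0.
rewrite patchE (memNset sI).
rewrite integral0_eq// => z _; rewrite /F.
rewrite indicE memNset ?mul0r// /S/=; apply/negP; rewrite -leNgt.
by rewrite (le_trans s0)// cabs_ge0.
Qed.

(** The probability that a Poisson variable of mean s^2 is at most n. Its derivative telescopes to
    the single term [- gauss_tail_density n s]. *)
Definition gauss_tail n (s : R) : R :=
  \sum_(k < n.+1) s ^+ k.*2 / k`!%:R * expR (- s ^+ 2).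

Definition gauss_tail_density n (s : R) : R :=
  2 * s ^+ n.*2.+1 / n`!%:R * expR (- s ^+ 2).

Lemma is_derive_monomial_gauss m (c s : R) :
  is_derive s 1 (fun t : R => t ^+ m * c * expR (- t ^+ 2))
    ((m%:R * s ^+ m.-1 - 2 * s ^+ m.+1) * c * expR (- s ^+ 2)).
Proof.
have h1 : is_derive s 1 (fun t : R => t ^+ m) (m%:R * s ^+ m.-1).
  have := @is_deriveX _ _ (id : R -> R) m s 1 1 (is_derive_id _ _).
  by rewrite exprfctE /GRing.scale/= mulr1.
apply: is_derive_eq; rewrite /GRing.scale/= [s ^+ m.+1]exprS; ring.
Qed.

Lemma is_derive_gauss_tail n (s : R) :
  is_derive s 1 (gauss_tail n) (- gauss_tail_density n s).
Proof.
elim: n => [|n ih].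
  rewrite (_ : gauss_tail 0 = (fun s => expR (- s ^+ 2))); last first.
    by apply/funext => t; rewrite /gauss_tail big_ord1 expr0 fact0 divr1 mul1r.
  apply: is_derive_eq; rewrite /gauss_tail_density fact0 expr1 divr1.
  by rewrite /GRing.scale/=; ring.
pose h (t : R) := t ^+ n.+1.*2 / n.+1`!%:R * expR (- t ^+ 2).
rewrite (_ : gauss_tail n.+1 = gauss_tail n + h); last first.
  by apply/funext => t; rewrite /gauss_tail big_ord_recr/= !fctE.
have n0 : (n.+1)%:R != 0 :> R by rewrite pnatr_eq0.
have f0 : n`!%:R != 0 :> R by rewrite pnatr_eq0 -lt0n fact_gt0.
have hE : is_derive s 1 h
    (gauss_tail_density n s - gauss_tail_density n.+1 s).
  have := @is_derive_monomial_gauss n.+1.*2 (n.+1`!%:R)^-1 s.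
  rewrite (_ : (_ - _) * _ * _ = gauss_tail_density n s - gauss_tail_density n.+1 s)//.
  rewrite /gauss_tail_density doubleS/= factS -muln2 !natrM -!natr1 !exprS natrM.
  by field; rewrite f0/= natr1.
by apply: is_derive_eq; ring.
Qed.

Lemma expr_le_expR (x : R) n : 0 <= x -> x ^+ n <= n`!%:R * expR x.
Proof.
move=> x0; case: n => [|n]; first by rewrite expr0 fact0 mul1r -expR0 ler_expR.
rewrite mulrC -ler_pdivrMr ?ltr0n ?fact_gt0//.
by apply: le_trans (expR_ge1Dxn n x0); rewrite lerDr.
Qed.

(** Half of the Gaussian is spent on absorbing the monomial. *)
Lemma monomial_gauss_le k (s : R) :
  s ^+ k.*2 * expR (- s ^+ 2) <= k`!%:R * 2 ^+ k * expR (- (s ^+ 2 / 2)).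
Proof.
have h : (s ^+ 2 / 2) ^+ k <= k`!%:R * expR (s ^+ 2 / 2).
  by apply: expr_le_expR; rewrite mulr_ge0 ?sqr_ge0.
have -> : - (s ^+ 2) = - (s ^+ 2 / 2) + - (s ^+ 2 / 2) by field.
rewrite expRD mulrA ler_wpM2r ?expR_ge0// expRN ler_pdivrMr ?expR_gt0//.
rewrite mulrAC -ler_pdivrMr ?exprn_gt0//.
by rewrite -mul2n exprM -expr_div_n.
Qed.

Lemma gauss_tail_cvg n : gauss_tail n s @[s --> +oo%R] --> (0 : R).
Proof.
have hk k : (s ^+ k.*2 / k`!%:R * expR (- s ^+ 2) : R) @[s --> +oo%R] --> (0 : R).
  (* The remaining half Gaussian is traded for an exponential: (s - 1)^2 >= 0 gives - s^2/2 <= 1 -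
     s. *)
  have h0 : (2 ^+ k * expR 1 * expR (- s)) @[s --> +oo%R] --> (2 ^+ k * expR 1 * 0 : R).
    by apply: cvgM; [exact: cvg_cst|exact: cvgr_expR].
  rewrite mulr0 in h0; apply: (squeeze_cvgr _ (cvg_cst 0) h0).
  apply: nearW => s; apply/andP; split.
    by rewrite !mulr_ge0 ?expR_ge0// -muln2 mulnC exprM exprn_ge0 ?sqr_ge0.
  rewrite mulrAC ler_pdivrMr ?ltr0n ?fact_gt0//.
  apply: (le_trans (monomial_gauss_le _ _)).
  have -> : 2 ^+ k * expR 1 * expR (- s) * k`!%:R = k`!%:R * 2 ^+ k * expR (1 - s).
    by rewrite expRD; ring.
  rewrite ler_wpM2l ?mulr_ge0 ?exprn_ge0// ler_expR.
  by have := sqr_ge0 (s - 1); rewrite sqrrB; lra.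
rewrite /gauss_tail; elim: n.+1 => [|m ih].
  by under eq_fun do rewrite big_ord0; exact: cvg_cst.
under eq_fun do rewrite big_ord_recr/=.
have := cvgD ih (hk m); rewrite addr0; exact.
Qed.

Lemma continuous_gauss_tail n : continuous (gauss_tail n).
Proof.
move=> s; apply: differentiable_continuous; apply/derivable1_diffP.
by case: (is_derive_gauss_tail n s).
Qed.

Lemma continuous_gauss_tail_density n : continuous (gauss_tail_density n).
Proof.
move=> s; apply: differentiable_continuous; apply/derivable1_diffP.
have := is_derive_monomial_gauss n.*2.+1 (2 / n`!%:R) s.
rewrite (_ : (fun t => _) = gauss_tail_density n); first by case.
by apply/funext => t; rewrite /gauss_tail_density; congr (_ * _); ring.
Qed.

Lemma gauss_tail_density_ge0 n (s : R) : 0 <= s -> 0 <= gauss_tail_density n s.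
Proof. by move=> s0; rewrite !mulr_ge0 ?expR_ge0// ?exprn_ge0. Qed.

Lemma integral_gauss_tail_density n (a : R) : 0 <= a ->
  (\int[mu]_(s in `]a, +oo[) (gauss_tail_density n s)%:E = (gauss_tail n a)%:E)%E.
Proof.
move=> a0.
have mg : measurable_fun setT (gauss_tail_density n).
  by apply: continuous_measurable_fun; exact: continuous_gauss_tail_density.
rewrite integral_itv_obnd_cbnd; last first.
  by apply/measurable_EFinP; exact: measurable_funTS.
rewrite (@ge0_continuous_FTC2y _ _ (fun s => - gauss_tail n s) _ 0).
- by rewrite EFinN oppeK add0e.
- by move=> x ax; apply: gauss_tail_density_ge0; exact: le_trans ax.
- by apply: continuous_subspaceT; exact: continuous_gauss_tail_density.
- by rewrite -oppr0; apply: cvgN; exact: gauss_tail_cvg.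
- by move=> x _; apply: derivableN; case: (is_derive_gauss_tail n x).
- by apply: cvgN; apply: cvg_at_right_filter; exact: continuous_gauss_tail.
- move=> x _; rewrite derive1E deriveN; last by case: (is_derive_gauss_tail n x).
  by rewrite (@derive_val _ _ _ _ _ _ _ (is_derive_gauss_tail n x)) opprK.
Qed.

(** In the layer formula the disc area contributes s^2, and s^2 times the density of index n is n+1
    times that of index n+1, whose total integral is 1. The area of the unit disc stays symbolic
    because its value is derived from the case n = 0. *)
Lemma integral_gauss_tail_cabs n :
  (\int[lebC]_z (gauss_tail n (cabs z))%:E =
   (n.+1)%:R%:E * lebC (disc 0 1 : set (plane R)))%E.
Proof.
have mg m : measurable_fun setT (gauss_tail_density m).
  by apply: continuous_measurable_fun; exact: continuous_gauss_tail_density.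
transitivity (\int[lebC]_z \int[mu]_(s in `]cabs z, +oo[)
    (gauss_tail_density n s)%:E)%E.
  by apply: eq_integral => z _; rewrite integral_gauss_tail_density// cabs_ge0.
rewrite integral_layer//; last exact: gauss_tail_density_ge0.
transitivity (\int[mu]_(s in `]0%R, +oo[) ((n.+1)%:R%:E * lebC (disc 0 1 : set (plane R)) *
    (gauss_tail_density n.+1 s)%:E))%E.
  apply: eq_integral => s; rewrite inE/= in_itv/= andbT => s0.
  rewrite (lebC_disc_scale 0 s0) muleA [RHS]muleAC -!EFinM.
  congr (_ * _)%E; congr EFin; rewrite /gauss_tail_density factS natrM doubleS !exprS.
  have n0 : (n.+1)%:R != 0 :> R by rewrite pnatr_eq0.
  have f0 : n`!%:R != 0 :> R by rewrite pnatr_eq0 -lt0n fact_gt0.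
  by field; rewrite f0/= nat1r.
rewrite ge0_integralZl//.
- rewrite integral_gauss_tail_density// /gauss_tail big_ord_recl big1 ?addr0.
    by rewrite fact0 !expr0n/= oppr0 expR0 divr1 mulr1 mule1.
  by move=> i _; rewrite expr0n/= !mul0r.
- by apply/measurable_EFinP; apply: measurable_funTS; exact: mg.
- move=> s; rewrite /= in_itv/= andbT => s0.
  by rewrite lee_fin gauss_tail_density_ge0// ltW.
- by rewrite mule_ge0// lee_fin.
Qed.

(** The case n = 0 above identifies this area with the planar Gaussian integral, which factors into
    two one-dimensional ones, each equal to the square root of pi. *)
Lemma lebC_unit_disc : lebC (disc 0 1 : set (plane R)) = pi%:E.
Proof.
rewrite -[LHS]mul1e -(integral_gauss_tail_cabs 0).
transitivity (\int[lebC]_z ((@gauss_fun R z.1)%:E * (@gauss_fun R z.2)%:E))%E.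
  apply: eq_integral => z _; rewrite /gauss_tail big_ord1 fact0 expr0 divr1 mul1r.
  by rewrite cabs_sqr /gauss_fun -EFinM -expRD opprD.
have mg : measurable_fun setT (EFin \o (@gauss_fun R)).
  by apply/measurable_EFinP; exact: measurable_gauss_fun.
rewrite fubini_tonelli1/=; last 2 first.
- apply: emeasurable_funM.
    exact: (measurableT_comp mg measurable_fst).
  exact: (measurableT_comp mg measurable_snd).
- by move=> z; rewrite mule_ge0// lee_fin gauss_fun_ge0.
transitivity (\int[mu]_x ((Num.sqrt pi)%:E * (gauss_fun x)%:E))%E.
  apply: eq_integral => x _; rewrite /fubini_F/=.
  transitivity (\int[mu]_y ((gauss_fun x)%:E * (gauss_fun y)%:E))%E => //.
  rewrite ge0_integralZl// ?lee_fin ?gauss_fun_ge0//; last first.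
    by move=> y _; rewrite lee_fin gauss_fun_ge0.
  by rewrite integralT_gauss muleC.
rewrite ge0_integralZl// ?lee_fin ?sqrtr_ge0//; last first.
  by move=> y _; rewrite lee_fin gauss_fun_ge0.
by rewrite integralT_gauss -EFinM -expr2 sqr_sqrtr// pi_ge0.
Qed.

Lemma measurable_monomial_gauss n (c : R) :
  measurable_fun setT (fun z : plane R => cabs z ^+ n * c * expR (- cabs z ^+ 2)).
Proof.
have mc := @measurable_cabs R.
apply: measurable_funM.
  by apply: measurable_funM => //; exact: measurable_funX.
apply: (measurableT_comp (@measurable_expR R)).
by apply: measurableT_comp => //; exact: measurable_funX.
Qed.

(** The tails of index n+1 and n differ by one normalised monomial, so its integral is (n+2) pi -
    (n+1) pi = pi. *)
Lemma integral_cabs_gauss n :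
  (\int[lebC]_z (cabs z ^+ n.*2 * expR (- cabs z ^+ 2))%:E = (pi * n`!%:R)%:E :> \bar R)%E.
Proof.
pose F (m : nat) (z : plane R) : R := cabs z ^+ m.*2 / m`!%:R * expR (- cabs z ^+ 2).
have F0 m z : 0 <= F m z.
  by rewrite /F !mulr_ge0 ?expR_ge0// exprn_ge0// cabs_ge0.
have mF m : measurable_fun setT (F m) by exact: measurable_monomial_gauss.
have fact_neq0 m : m`!%:R != 0 :> R by rewrite pnatr_eq0 -lt0n fact_gt0.
suff FE : (\int[lebC]_z (F n z)%:E = pi%:E)%E.
  transitivity (\int[lebC]_z ((n`!%:R)%:E * (F n z)%:E))%E.
    apply: eq_integral => z _; rewrite -EFinM /F; congr EFin.
    by field; exact: fact_neq0.
  rewrite ge0_integralZl//.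
  - by rewrite FE -EFinM mulrC.
  - exact/measurable_EFinP.
  - by move=> z _; rewrite lee_fin.
have tail0 z : gauss_tail 0 (cabs z) = F 0 z by rewrite /gauss_tail big_ord1.
have tailS m z : gauss_tail m.+1 (cabs z) = gauss_tail m (cabs z) + F m.+1 z.
  by rewrite /gauss_tail big_ord_recr.
case: n => [|n].
  have := integral_gauss_tail_cabs 0; rewrite mul1e lebC_unit_disc => <-.
  by apply: eq_integral => z _; rewrite tail0.
have := integral_gauss_tail_cabs n.+1; rewrite lebC_unit_disc.
under eq_integral do rewrite tailS EFinD.
rewrite ge0_integralD//.
- rewrite integral_gauss_tail_cabs lebC_unit_disc -!EFinM.
  case: (\int[lebC]_z (F n.+1 z)%:E)%E => [y| |]//= [yE].
  congr EFin; apply: (addrI (n.+1%:R * pi)); rewrite [LHS]yE.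
  by rewrite -[n.+2%:R]natr1 mulrDl mul1r.
- move=> z _; rewrite lee_fin /gauss_tail sumr_ge0// => i _.
  by rewrite !mulr_ge0 ?expR_ge0// exprn_ge0// cabs_ge0.
- apply/measurable_EFinP; apply: (measurableT_comp _ (@measurable_cabs R)).
  by apply: continuous_measurable_fun; exact: continuous_gauss_tail.
- by move=> z _; rewrite lee_fin.
- exact/measurable_EFinP.
Qed.

End RadialIntegral.

(** * The Ginibre kernel *)

Section GinibreBasis.
Variable R : realType.
Implicit Types (z w : plane R).

(** The orthonormal monomials of the Bargmann-Fock space, with the Gaussian weight included in the
    functions. Removing index 0 gives the Palm kernel. *)
Definition ginibre_basis n z : R[i] :=
  toC z ^+ n * (expR (- (cabs z ^+ 2 / 2)) / Num.sqrt (pi * n`!%:R))%:C%C.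

Lemma measurable_toC_exp n :
  measurable_fun setT (fun z : plane R => complex.Re (toC z ^+ n)) /\
  measurable_fun setT (fun z : plane R => complex.Im (toC z ^+ n)).
Proof.
elim: n => [|n [ih1 ih2]].
  by split; under eq_fun do rewrite expr0; exact: measurable_cst.
have [m1 m2] := @measurable_Re_mul _ _ _ (@toC R) (fun z => toC z ^+ n)
  measurable_fst measurable_snd ih1 ih2.
by split; under eq_fun do rewrite exprS.
Qed.

Lemma csq_exp (x : R[i]) n : csq (x ^+ n) = csq x ^+ n.
Proof.
elim: n => [|n ih]; first by rewrite !expr0 /csq/= expr1n expr0n/= addr0.
by rewrite !exprS csqM ih.
Qed.

Lemma csq_real (x : R) : csq x%:C%C = x ^+ 2.
Proof. by rewrite /csq/= expr0n/= addr0. Qed.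

Lemma pi_fact_gt0 n : 0 < pi * n`!%:R :> R.
Proof. by rewrite mulr_gt0 ?pi_gt0// ltr0n fact_gt0. Qed.

Lemma csq_ginibre_basis n z :
  csq (ginibre_basis n z) =
  (pi * n`!%:R)^-1 * (cabs z ^+ n.*2 * expR (- cabs z ^+ 2)).
Proof.
rewrite /ginibre_basis csqM csq_exp csq_toC csq_real -exprM mul2n.
rewrite expr_div_n (sqr_sqrtr (ltW (pi_fact_gt0 n))) mulrA [RHS]mulrC.
by congr (_ * _ / _); rewrite expr2 -expRD; congr expR; field.
Qed.

Lemma square_integrable_ginibre_basis n : square_integrable lebC (ginibre_basis n).
Proof.
have [m1 m2] := measurable_toC_exp n.
have mr : measurable_fun setT (fun z : plane R =>
    expR (- (cabs z ^+ 2 / 2)) / Num.sqrt (pi * n`!%:R)).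
  apply: measurable_funM => //; apply: (measurableT_comp (@measurable_expR R)).
  apply: measurableT_comp => //; apply: measurable_funM => //.
  by apply: measurable_funX; exact: measurable_cabs.
have [m3 m4] := @measurable_Re_mul _ _ _ (fun z => toC z ^+ n)
  (fun z => (expR (- (cabs z ^+ 2 / 2)) / Num.sqrt (pi * n`!%:R))%:C%C)
  m1 m2 mr (measurable_cst (0 : R)).
split => //; under eq_fun do rewrite csq_ginibre_basis.
apply: integrable_scale; apply/integrableP; split.
  apply/measurable_EFinP; have := @measurable_monomial_gauss R n.*2 1.
  by under eq_fun do rewrite mulr1.
rewrite (eq_integral (fun z => (cabs z ^+ n.*2 * expR (- cabs z ^+ 2))%:E)).
  by rewrite integral_cabs_gauss ltry.
move=> z _; rewrite /= ger0_norm// mulr_ge0 ?expR_ge0// exprn_ge0//.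
exact: cabs_ge0.
Qed.

Lemma cip_ginibre_basis_same n :
  cip lebC (ginibre_basis n) (ginibre_basis n) = 1.
Proof.
rewrite cip_self; congr (_%:C%C).
transitivity (\int[@lebC R]_z ((pi * n`!%:R)^-1 * (cabs z ^+ n.*2 * expR (- cabs z ^+ 2)))).
  by apply: eq_Rintegral => z _; rewrite csq_ginibre_basis.
rewrite RintegralZl//.
  rewrite /Rintegral integral_cabs_gauss/= mulVf//.
  by apply: lt0r_neq0; exact: pi_fact_gt0.
have [_ _] := square_integrable_ginibre_basis n.
move=> /(integrable_scale (pi * n`!%:R)); apply: eq_integrable => // z _ /=.
rewrite csq_ginibre_basis mulVKf//.
by apply: lt0r_neq0; exact: pi_fact_gt0.
Qed.

Lemma measurable_rotation c s : measurable_fun setT (@rotation R c s).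
Proof.
have m1 a : measurable_fun setT (fun z : plane R => a * z.1).
  by apply: measurable_funM => //; exact: measurable_fst.
have m2 a : measurable_fun setT (fun z : plane R => a * z.2).
  by apply: measurable_funM => //; exact: measurable_snd.
apply: measurable_fun_pair.
  by apply: measurable_funB; [exact: m1|exact: m2].
by apply: measurable_funD; [exact: m1|exact: m2].
Qed.

Lemma Rintegral_rotation c s (f : plane R -> R) :
  c ^+ 2 + s ^+ 2 = 1 -> 1 + c != 0 ->
  lebC.-integrable setT (EFin \o f) ->
  \int[lebC]_z f (rotation c s z) = \int[lebC]_z f z.
Proof.
move=> cs c1 fi; have mr := measurable_rotation c s.
have mf := (integrableP _ _ _ fi).1.
have eqm (A : set (plane R)) : measurable A -> A `<=` setT ->
    pushforward lebC (rotation c s) A = lebC A.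
  by move=> mA _; exact: lebC_rotation.
rewrite /Rintegral; congr fine.
transitivity (\int[pushforward lebC (rotation c s)]_z (f z)%:E)%E; last first.
  exact: eq_measure_integral.
rewrite integral_pushforward//; apply/integrableP; split.
  exact: (measurableT_comp mf mr).
rewrite /= -(@ge0_integral_pushforward _ _ _ _ _ _ mr lebC setT (fun z => `|f z|%:E))//.
- rewrite (eq_measure_integral lebC eqm).
  by have [_] := integrableP _ _ _ fi.
- exact: mr.
- exact: (measurableT_comp (@abse_measurable R setT) mf).
Qed.

Lemma expr_cos_sin (x : R) n :
  (Complex (cos x) (sin x)) ^+ n = Complex (cos (n%:R * x)) (sin (n%:R * x)).
Proof.
elim: n => [|n ih]; first by rewrite expr0 mul0r cos0 sin0.
rewrite exprS ih -natr1 mulrDl mul1r addrC cosD sinD.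
by apply/eqP; rewrite eq_complex/= !eqxx andTb; apply/eqP; ring.
Qed.

Lemma toC_rotation c s z : toC (@rotation R c s z) = Complex c s * toC z.
Proof. by apply/eqP; rewrite eq_complex/= eqxx/= addrC. Qed.

(** A rotation by a suitable angle multiplies the integrand by i and preserves the measure, so the
    integral equals i times itself. *)
Lemma cip_ginibre_basis_neq b m :
  cip lebC (ginibre_basis (b + m.+1)) (ginibre_basis b) = 0.
Proof.
(* The degrees differ by m+1, so the rotation acts by e^(i (m+1) x) = i. Moreover x <= pi/2, so the
   cosine is nonnegative and the factorisation into shears applies. *)
pose x : R := pi / (2 * m.+1%:R).
have x0 : 0 <= x by rewrite divr_ge0 ?pi_ge0.
have m0 : m.+1%:R != 0 :> R by rewrite pnatr_eq0.
have xpi : x <= pi / 2.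
  rewrite ler_pM2l ?pi_gt0// lef_pV2 ?posrE ?mulr_gt0 ?ltr0n//.
  by rewrite ler_peMr// ler1n.
have cs : cos x ^+ 2 + sin x ^+ 2 = 1 by exact: cos2Dsin2.
have c1 : 1 + cos x != 0.
  by rewrite gt_eqF// ltr_wpDr// cos_ge0_pihalf// xpi andbT (le_trans _ x0)// oppr_le0 divr_ge0 ?pi_ge0.
set w := Complex (cos x) (sin x).
have wJ : w * conjc w = 1.
  by rewrite -csqE /csq/= cs.
have wm : w ^+ m.+1 = Complex 0 1.
  rewrite expr_cos_sin (_ : m.+1%:R * x = pi / 2) ?cos_pihalf ?sin_pihalf//.
  by rewrite /x; field.
pose h z := ginibre_basis (b + m.+1) z * conjc (ginibre_basis b z).
have [h1 h2] : cintegrable lebC h.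
  by apply: cintegrable_mul_conj; exact: square_integrable_ginibre_basis.
have cabsr z : cabs (rotation (cos x) (sin x) z) = cabs z.
  rewrite /cabs toC_rotation ComplexField.Normc.normcM.
  by rewrite [X in X * _](_ : _ = 1) ?mul1r//= cs sqrtr1.
have hr z : h (rotation (cos x) (sin x) z) = Complex 0 1 * h z.
  have <- : w ^+ (b + m.+1) * conjc w ^+ b = Complex 0 1.
    by rewrite exprD mulrAC -exprMn wJ expr1n mul1r wm.
  rewrite /h /ginibre_basis cabsr toC_rotation -/w !exprMn.
  have rM : {morph (@conjc R) : u v / u * v} by exact: rmorphM.
  have rX n u : conjc (u ^+ n) = (conjc u : R[i]) ^+ n by exact: rmorphXn.
  by rewrite !rM !rX; ring.
have hi : cintegrable lebC h by [].
have : cint lebC h = Complex 0 1 * cint lebC h.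
  rewrite -cintZ//; apply/eqP; rewrite eq_complex/= -(Rintegral_rotation cs c1 h1).
  rewrite -(Rintegral_rotation cs c1 h2).
  by apply/andP; split; apply/eqP/eq_Rintegral => z _; rewrite hr.
rewrite /cip -/h; case: (cint lebC h) => u v /eqP; rewrite eq_complex/=.
rewrite !mul0r !mul1r sub0r add0r => /andP[/eqP uv /eqP vu].
have u0 : u = 0 by lra.
by apply/eqP; rewrite eq_complex/= vu u0 eqxx.
Qed.

Lemma cip_ginibre_basis a b :
  cip lebC (ginibre_basis a) (ginibre_basis b) = (a == b)%:R.
Proof.
have [ab|ba|->] := ltngtP a b; last exact: cip_ginibre_basis_same.
  rewrite -cip_conj; [|exact: square_integrable_ginibre_basis..].
  by rewrite -(subnKC ab) addSnnS cip_ginibre_basis_neq conjc0.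
by rewrite -(subnKC ba) addSnnS cip_ginibre_basis_neq.
Qed.

End GinibreBasis.

(** * Truncation error of the complex exponential series *)

Section ComplexExponential.
Variable R : realType.
Implicit Types (f g : R -> R[i]) (w : R[i]).

Lemma Re_add (v w : R[i]) : complex.Re (v + w) = complex.Re v + complex.Re w.
Proof. by case: v w => [a b] [c e]. Qed.

Lemma Im_add (v w : R[i]) : complex.Im (v + w) = complex.Im v + complex.Im w.
Proof. by case: v w => [a b] [c e]. Qed.

(** Differentiation in a real parameter only: the exponential and its truncations are compared along
    the segment from 0 to w. *)
Definition is_cderive f (t : R) (df : R[i]) :=
  is_derive t 1 (fun x => complex.Re (f x)) (complex.Re df) /\
  is_derive t 1 (fun x => complex.Im (f x)) (complex.Im df).

Lemma is_cderiveM f g t df dg : is_cderive f t df -> is_cderive g t dg ->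
  is_cderive (fun x => f x * g x) t (f t * dg + df * g t).
Proof.
move=> [f1 f2] [g1 g2]; split.
  under eq_fun do rewrite Re_mul.
  apply: is_derive_eq; rewrite Re_add !Re_mul /GRing.scale/=; ring.
under eq_fun do rewrite Im_mul.
apply: is_derive_eq; rewrite Im_add !Im_mul /GRing.scale/=; ring.
Qed.

Lemma is_cderiveD f g t df dg : is_cderive f t df -> is_cderive g t dg ->
  is_cderive (fun x => f x + g x) t (df + dg).
Proof.
move=> [f1 f2] [g1 g2]; split.
  by under eq_fun do rewrite Re_add; rewrite Re_add; exact: is_deriveD.
by under eq_fun do rewrite Im_add; rewrite Im_add; exact: is_deriveD.
Qed.

Lemma is_cderive_monomial n w t :
  is_cderive (fun x => (x ^+ n)%:C%C * w) t ((n%:R * t ^+ n.-1)%:C%C * w).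
Proof.
have h1 : is_derive t 1 (fun x : R => x ^+ n) (n%:R * t ^+ n.-1).
  have := @is_deriveX _ _ (id : R -> R) n t 1 1 (is_derive_id _ _).
  by rewrite exprfctE /GRing.scale/= mulr1.
split.
  under eq_fun do rewrite Re_mul/= mul0r subr0.
  by apply: is_derive_eq; rewrite Re_mul/= /GRing.scale/=; ring.
under eq_fun do rewrite Im_mul/= mul0r addr0.
by apply: is_derive_eq; rewrite Im_mul/= /GRing.scale/=; ring.
Qed.

Definition exp_trunc n w : R[i] := \sum_(k < n.+1) (k`!%:R^-1)%:C%C * w ^+ k.

(** The derivative is w times the truncation of order n-1. Writing it as order n minus the top term
    also covers n = 0, and makes the main part cancel against the derivative of e^(-tw). *)
Lemma is_cderive_exp_trunc n w t :
  is_cderive (fun x => exp_trunc n (x%:C%C * w)) t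
    (w * exp_trunc n (t%:C%C * w) - (n`!%:R^-1)%:C%C * w * (t%:C%C * w) ^+ n).
Proof.
have pE k x : (k`!%:R^-1)%:C%C * (x%:C%C * w) ^+ k =
    (x ^+ k)%:C%C * ((k`!%:R^-1)%:C%C * w ^+ k) :> R[i].
  by rewrite exprMn rmorphXn/= mulrCA.
elim: n => [|n ih].
  under eq_fun do rewrite /exp_trunc big_ord1 pE.
  have := is_cderive_monomial 0 ((0`!%:R^-1)%:C%C * w ^+ 0) t.
  congr is_cderive; rewrite /exp_trunc big_ord1 !expr0 fact0 invr1 !mul0r.
  by rewrite rmorph1 !mulr1 mul1r subrr.
under eq_fun do rewrite /exp_trunc big_ord_recr/= pE.
have := is_cderiveD ih (is_cderive_monomial n.+1 ((n.+1`!%:R^-1)%:C%C * w ^+ n.+1) t).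
congr is_cderive; rewrite [in RHS]/exp_trunc big_ord_recr/= -/(exp_trunc n _).
have -> : (n.+1%:R * t ^+ n)%:C%C * ((n.+1`!%:R^-1)%:C%C * w ^+ n.+1) =
    (n`!%:R^-1)%:C%C * w * (t%:C%C * w) ^+ n.
  have fE : (n.+1`!%:R^-1)%:C%C = (n.+1%:R^-1)%:C%C * (n`!%:R^-1)%:C%C :> R[i].
    by rewrite factS natrM invfM rmorphM.
  have nE : (n.+1%:R)%:C%C * (n.+1%:R^-1)%:C%C = 1 :> R[i].
    by rewrite -rmorphM mulfV ?pnatr_eq0.
  have tE : (n.+1%:R * t ^+ n)%:C%C = (n.+1%:R)%:C%C * t%:C%C ^+ n :> R[i].
    by rewrite -rmorphXn -rmorphM.
  rewrite fE tE exprMn exprS.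
  transitivity (((n.+1%:R)%:C%C * (n.+1%:R^-1)%:C%C) *
    ((n`!%:R^-1)%:C%C * w * (t%:C%C ^+ n * w ^+ n))); first by ring.
  by rewrite nE mul1r.
ring.
Qed.

Lemma is_cderive_cexpN w t :
  is_cderive (fun x => cexp (- (x%:C%C * w))) t (- w * cexp (- (t%:C%C * w))).
Proof.
case: w => a b; split.
  rewrite (_ : (fun x => _) = (fun x => expR (- (x * a)) * cos (x * b))); last first.
    by apply/funext => x; rewrite /cexp/= !mul0r !subr0 !addr0 ?cosN ?sinN.
  apply: is_derive_eq; rewrite /cexp/= !mul0r !subr0 !addr0 ?cosN ?sinN /GRing.scale/=; ring.
rewrite (_ : (fun x => _) = (fun x => - (expR (- (x * a)) * sin (x * b)))); last first.
  by apply/funext => x; rewrite /cexp/= !mul0r !subr0 !addr0 ?cosN ?sinN mulrN.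
apply: is_derive_eq; rewrite /cexp/= !mul0r !subr0 !addr0 ?cosN ?sinN /GRing.scale/=; ring.
Qed.

Lemma cexpD v w : cexp (v + w) = cexp v * cexp w :> R[i].
Proof.
case: v w => [a b] [c e]; rewrite /cexp/= expRD cosD sinD.
by apply/eqP; rewrite eq_complex/=; apply/andP; split; apply/eqP; ring.
Qed.

Lemma cexp0 : cexp 0 = 1 :> R[i].
Proof. by rewrite /cexp/= expR0 cos0 sin0 mul1r. Qed.

Lemma normc_cexp w : normc (cexp w) = expR (complex.Re w).
Proof.
rewrite /cexp ComplexField.Normc.normcM normc_real ger0_norm ?expR_ge0//=.
by rewrite cos2Dsin2 sqrtr1 mulr1.
Qed.

Lemma le_norm_increment (f df : R -> R) (M : R) :
  (forall t : R, is_derive t (1 : R) f (df t)) -> (forall t, 0 <= t <= 1 -> `|df t| <= M) ->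
  `|f 1 - f 0| <= M.
Proof.
move=> fE dfM.
have [|c c01 ->] := @MVT_segment R f df 0 1 ler01 (fun x _ => fE x).
  by apply: derivable_within_continuous => x _; case: (fE x).
by rewrite subr0 mulr1; apply: dfM; move: c01; rewrite in_itv.
Qed.

Lemma normc_le_ReIm (z : R[i]) : normc z <= `|complex.Re z| + `|complex.Im z|.
Proof.
case: z => a b /=; rewrite -(ger0_norm (addr_ge0 (normr_ge0 a) (normr_ge0 b))).
rewrite -sqrtr_sqr ler_wsqrtr// sqrrD !real_normK ?num_real//.
by rewrite -addrA lerD2l lerDr mulrn_wge0// mulr_ge0.
Qed.

Lemma normcX (z : R[i]) n : normc (z ^+ n) = normc z ^+ n.
Proof.
elim: n => [|n ih]; first by rewrite !expr0 ComplexField.Normc.normc1.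
by rewrite !exprS ComplexField.Normc.normcM ih.
Qed.

(** Let G(t) = e^(-tw) E_n(tw), with E_n the truncated series. Then G(0) = 1, the derivative of G
    keeps only the top term, and the error is e^w (G(1) - G(0)). The factor 2 comes from applying
    the mean value theorem to the two parts separately; e^(2r) collects e^(-tw) and e^w. *)
Lemma normc_exp_truncB_le n w (r : R) : normc w <= r ->
  normc (exp_trunc n w - cexp w) <= 2 * expR (2 * r) * r * exp_coeff r n.
Proof.
move=> wr; have r0 : 0 <= r := le_trans (normc_ge0 _) wr.
pose G (x : R) := cexp (- (x%:C%C * w)) * exp_trunc n (x%:C%C * w).
pose dG (t : R) := - (cexp (- (t%:C%C * w)) * ((n`!%:R^-1)%:C%C * w * (t%:C%C * w) ^+ n)).
have GE t : is_cderive G t (dG t).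
  have := is_cderiveM (is_cderive_cexpN w t) (is_cderive_exp_trunc n w t).
  by congr is_cderive; rewrite /dG; ring.
pose M := expR r * r * exp_coeff r n.
have dGM t : 0 <= t <= 1 -> normc (dG t) <= M.
  move=> /andP[t0 t1]; rewrite /dG normcN ComplexField.Normc.normcM normc_cexp.
  rewrite [X in _ * X]ComplexField.Normc.normcM [X in _ * (X * _)]ComplexField.Normc.normcM.
  have ntw : normc (t%:C%C * w) <= r.
    rewrite ComplexField.Normc.normcM normc_real ger0_norm//.
    by apply: le_trans wr; rewrite ler_piMl// normc_ge0.
  rewrite /M -[leRHS]mulrA; apply: ler_pM.
  - exact: expR_ge0.
  - by rewrite !mulr_ge0 ?normc_ge0.
  - rewrite ler_expR; apply: le_trans ntw; rewrite -normcN.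
    by apply: le_trans (normr_Re_le _); exact: ler_norm.
  rewrite normc_real ger0_norm ?invr_ge0// normcX.
  have -> : r * exp_coeff r n = n`!%:R^-1 * r * r ^+ n by rewrite /exp_coeff/=; ring.
  rewrite -!mulrA ler_wpM2l ?invr_ge0//; apply: ler_pM; rewrite ?exprn_ge0 ?normc_ge0//.
  by rewrite lerXn2r ?nnegrE ?normc_ge0.
have e1 : `|complex.Re (G 1) - complex.Re (G 0)| <= M.
  apply: (@le_norm_increment (fun x => complex.Re (G x)) (fun t => complex.Re (dG t))).
    by move=> t; exact: (GE t).1.
  by move=> t t01; exact: le_trans (normr_Re_le _) (dGM t t01).
have e2 : `|complex.Im (G 1) - complex.Im (G 0)| <= M.
  apply: (@le_norm_increment (fun x => complex.Im (G x)) (fun t => complex.Im (dG t))).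
    by move=> t; exact: (GE t).2.
  by move=> t t01; exact: le_trans (normr_Im_le _) (dGM t t01).
have G0 : G 0 = 1.
  rewrite /G mul0r oppr0 cexp0 mul1r /exp_trunc big_ord_recl big1 ?addr0.
    by rewrite expr0 mulr1 fact0 invr1.
  by move=> i _; rewrite expr0n/= mulr0.
have wE : exp_trunc n w - cexp w = cexp w * (G 1 - G 0).
  rewrite G0 mulrBr mulr1 /G mul1r mulrA -cexpD subrr cexp0 mul1r.
  by [].
rewrite wE ComplexField.Normc.normcM normc_cexp.
have nG : normc (G 1 - G 0) <= 2 * M.
  apply: le_trans (normc_le_ReIm _) _; rewrite mulr_natl mulr2n.
  by apply: lerD; [move: e1|move: e2]; case: (G 1) (G 0) => [? ?] [? ?].
have -> : 2 * expR (2 * r) * r * exp_coeff r n = expR r * (2 * M).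
  have -> : expR (2 * r) = expR r * expR r by rewrite -expRD; congr expR; ring.
  by rewrite /M; ring.
apply: ler_pM; rewrite ?expR_ge0 ?normc_ge0// ler_expR.
by apply: le_trans wr; apply: le_trans (normr_Re_le _); exact: ler_norm.
Qed.

End ComplexExponential.

Section ComplexMeasurable.
Context d (T : measurableType d) (R : realType).
Implicit Types f g : T -> R[i].

Definition cmeasurable f :=
  measurable_fun setT (fun x => complex.Re (f x)) /\
  measurable_fun setT (fun x => complex.Im (f x)).

Lemma cmeasurable_cst c : cmeasurable (fun=> c).
Proof. by split; exact: measurable_cst. Qed.

Lemma cmeasurable_real (h : T -> R) : measurable_fun setT h ->
  cmeasurable (fun x => (h x)%:C%C).
Proof. by move=> mh; split => //; exact: measurable_cst. Qed.

Lemma cmeasurableM f g : cmeasurable f -> cmeasurable g ->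
  cmeasurable (fun x => f x * g x).
Proof. by move=> [f1 f2] [g1 g2]; exact: measurable_Re_mul. Qed.

Lemma cmeasurableD f g : cmeasurable f -> cmeasurable g ->
  cmeasurable (fun x => f x + g x).
Proof.
move=> [f1 f2] [g1 g2]; split.
- by under eq_fun do rewrite Re_add; exact: measurable_funD.
- by under eq_fun do rewrite Im_add; exact: measurable_funD.
Qed.

Lemma cmeasurable_conj f : cmeasurable f -> cmeasurable (fun x => conjc (f x)).
Proof.
move=> [f1 f2]; split.
- by rewrite (_ : (fun x => _) = (fun x => complex.Re (f x)))//;
    apply/funext => x; case: (f x).
- rewrite (_ : (fun x => _) = (fun x => - complex.Im (f x))).
    exact: measurableT_comp.
  by apply/funext => x; case: (f x).
Qed.

Lemma cmeasurable_sum (I : Type) (s : seq I) (h : I -> T -> R[i]) :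
  (forall i, cmeasurable (h i)) -> cmeasurable (fun x => \sum_(i <- s) h i x).
Proof.
move=> hi; elim: s => [|i s ih].
  by under eq_fun do rewrite big_nil; exact: cmeasurable_cst.
by under eq_fun do rewrite big_cons; exact: cmeasurableD.
Qed.

Lemma cmeasurable_prod (I : Type) (s : seq I) (h : I -> T -> R[i]) :
  (forall i, cmeasurable (h i)) -> cmeasurable (fun x => \prod_(i <- s) h i x).
Proof.
move=> hi; elim: s => [|i s ih].
  by under eq_fun do rewrite big_nil; exact: cmeasurable_cst.
by under eq_fun do rewrite big_cons; exact: cmeasurableM.
Qed.

Lemma cmeasurable_det n (A : T -> 'M[R[i]]_n) :
  (forall i j, cmeasurable (fun x => A x i j)) ->
  cmeasurable (fun x => \det (A x)).
Proof.
move=> mA; apply: cmeasurable_sum => s; apply: cmeasurableM.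
  exact: cmeasurable_cst.
exact: cmeasurable_prod.
Qed.

Lemma cmeasurable_cexp f : cmeasurable f -> cmeasurable (fun x => cexp (f x)).
Proof.
move=> [f1 f2]; apply: cmeasurableM.
  by apply: cmeasurable_real; exact: (measurableT_comp (@measurable_expR R)).
split.
- exact: (measurableT_comp (continuous_measurable_fun (@continuous_cos R)) f2).
- exact: (measurableT_comp (continuous_measurable_fun (@continuous_sin R)) f2).
Qed.

Lemma cmeasurable_toC (h : T -> plane R) : measurable_fun setT h ->
  cmeasurable (fun x => toC (h x)).
Proof.
by move=> mh; split;
  [exact: (measurableT_comp measurable_fst mh)|exact: (measurableT_comp measurable_snd mh)].
Qed.

End ComplexMeasurable.

(** * Finite-rank approximation of the Ginibre Palm kernel *)

Section GinibreKernel.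
Variable R : realType.
Implicit Types (z w : plane R) (D : set (plane R)).

Lemma cmeasurable_ginibre_kernel d (T : measurableType d) (f g : T -> plane R) :
  measurable_fun setT f -> measurable_fun setT g ->
  cmeasurable (fun x => ginibre_palm_kernel (f x) (g x)).
Proof.
move=> mf mg; apply: cmeasurableM.
  apply: cmeasurableM; first exact: cmeasurable_cst.
  apply: cmeasurableD; last exact: cmeasurable_cst.
  apply: cmeasurable_cexp; apply: cmeasurableM; first exact: cmeasurable_toC.
  by apply: cmeasurable_conj; exact: cmeasurable_toC.
apply: cmeasurable_real; apply: (measurableT_comp (@measurable_expR R)).
apply: measurable_funM => //; apply: measurable_funD; apply: measurable_funX.
  exact: (measurableT_comp (@measurable_cabs R)).
exact: (measurableT_comp (@measurable_cabs R)).
Qed.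

Lemma cmeasurable_restrict_ginibre D d (T : measurableType d) (f g : T -> plane R) :
  measurable D -> measurable_fun setT f -> measurable_fun setT g ->
  cmeasurable (fun x => restrict_ker D (@ginibre_palm_kernel R) (f x) (g x)).
Proof.
move=> mD mf mg; apply: cmeasurableM; last exact: cmeasurable_ginibre_kernel.
have mI : measurable_fun setT (\1_D : plane R -> R) by exact: measurable_indic.
by apply: cmeasurableM; apply: cmeasurable_real; exact: (measurableT_comp mI).
Qed.

Lemma ginibre_basis_mul_conj n z w :
  ginibre_basis n z * conjc (ginibre_basis n w) =
  (pi^-1)%:C%C * ((n`!%:R^-1)%:C%C * (toC z * conjc (toC w)) ^+ n)
  * (expR (- 2^-1 * (cabs z ^+ 2 + cabs w ^+ 2)))%:C%C :> R[i].
Proof.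
have e : (expR (- (cabs z ^+ 2 / 2)) / Num.sqrt (pi * n`!%:R)) *
  (expR (- (cabs w ^+ 2 / 2)) / Num.sqrt (pi * n`!%:R)) =
  pi^-1 * n`!%:R^-1 * expR (- 2^-1 * (cabs z ^+ 2 + cabs w ^+ 2)).
  rewrite mulrACA -expRD -invfM -expr2 (sqr_sqrtr (ltW (pi_fact_gt0 R n))) invfM mulrC.
  by congr (_ * expR _); ring.
have rM : {morph (@conjc R) : u v / u * v} by exact: rmorphM.
have rX m u : conjc (u ^+ m) = (conjc u : R[i]) ^+ m by exact: rmorphXn.
rewrite /ginibre_basis rM rX conjc_real mulrACA -rmorphM e exprMn.
by rewrite !rmorphM/=; ring.
Qed.

(** The shifted indices run over 1, ..., N, which is the truncated series of degree N without its
    constant term: the - 1 in the Palm kernel. *)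
Lemma finite_rank_ginibre N z w :
  finite_rank (fun a : 'I_N => ginibre_basis a.+1) z w =
  (pi^-1)%:C%C * (exp_trunc N (toC z * conjc (toC w)) - 1)
  * (expR (- 2^-1 * (cabs z ^+ 2 + cabs w ^+ 2)))%:C%C :> R[i].
Proof.
rewrite /exp_trunc big_ord_recl expr0 mulr1 fact0 invr1 addrC addKr.
rewrite mulr_sumr mulr_suml; apply: eq_bigr => a _.
by rewrite ginibre_basis_mul_conj.
Qed.

Lemma ginibre_gauss_le1 z w : expR (- 2^-1 * (cabs z ^+ 2 + cabs w ^+ 2)) <= 1 :> R.
Proof. by rewrite expR_le1 mulNr oppr_le0 mulr_ge0// addr_ge0 ?sqr_ge0. Qed.

Lemma pi_inv_le1 : pi^-1 <= 1 :> R.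
Proof. by rewrite invf_le1 ?pi_gt0// (le_trans _ (pi_ge2 R))// ler1n. Qed.

Lemma normc_kernel_factor_le z w (v : R[i]) (c : R) : normc v <= c ->
  normc ((pi^-1)%:C%C * v * (expR (- 2^-1 * (cabs z ^+ 2 + cabs w ^+ 2)))%:C%C) <= c.
Proof.
move=> vc; rewrite 2!ComplexField.Normc.normcM !normc_real.
rewrite !ger0_norm ?expR_ge0 ?invr_ge0 ?pi_ge0//.
apply: le_trans vc; rewrite mulrAC ler_piMl ?normc_ge0//.
by rewrite mulr_ile1 ?expR_ge0 ?invr_ge0 ?pi_ge0 ?pi_inv_le1 ?ginibre_gauss_le1.
Qed.

Definition exp_error (r : R) N : R := 2 * expR (2 * r) * r * exp_coeff r N.

Lemma exp_error_cvg (r : R) : exp_error r N @[N --> \oo] --> 0.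
Proof.
have := cvgM (cvg_cst (2 * expR (2 * r) * r)) (@cvg_exp_coeff R r).
by rewrite mulr0; apply.
Qed.

(** Uniform in [N], so that one constant bounds all the truncated kernels at once. *)
Lemma exp_error_le (r : R) N : 0 <= r -> exp_error r N <= 2 * expR (3 * r) * r.
Proof.
move=> r0; rewrite /exp_error (_ : 3 * r = 2 * r + r); last by ring.
rewrite expRD (_ : 2 * (_ * expR r) * r = 2 * expR (2 * r) * r * expR r); last by ring.
rewrite ler_wpM2l ?mulr_ge0 ?expR_ge0// /exp_coeff/= ler_pdivrMr ?ltr0n ?fact_gt0//.
by rewrite mulrC expr_le_expR.
Qed.

Section Bounded.
Variables (D : set (plane R)) (rho : R).
Hypothesis mD : measurable D.
Hypothesis Drho : forall z, D z -> cabs z <= rho.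

Lemma normc_toC_mul_le z w : D z -> D w -> normc (toC z * conjc (toC w)) <= rho ^+ 2.
Proof.
move=> Dz Dw; rewrite ComplexField.Normc.normcM.
rewrite (_ : normc (conjc _) = cabs w); last by rewrite /cabs /= sqrrN.
by rewrite expr2; apply: ler_pM; rewrite ?normc_ge0 ?cabs_ge0//; exact: Drho.
Qed.

Lemma lebC_bounded : (lebC D < +oo)%E.
Proof.
apply: (@le_lt_trans _ _ (lebC (disc 0 (`|rho| + 1) : set (plane R)))).
  apply: le_measure; rewrite ?inE//; first exact: measurable_disc.
  move=> z /Drho zr; rewrite /disc/= subr0 (le_lt_trans zr)// ltr_pwDr//.
  exact: ler_norm.
rewrite lebC_disc_scale ?ltr_pwDr//.
by rewrite lebC_unit_disc -EFinM ltry.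
Qed.

Lemma bonferroni_ginibre_le m (I := correlation_integral lebC D (@ginibre_palm_kernel R)) :
  \sum_(n < (m.*2).+1) (-1) ^+ n / n`!%:R * I n <=
  expR (- I 1 - (I 1 ^+ 2 - I 2) / 2) + I 1 ^+ (m.*2).+1 / (m.*2).+1`!%:R.
Proof.
pose r := rho ^+ 2; have r0 : 0 <= r by rewrite sqr_ge0.
(* The three terms bound the truncation error, the exponential, and the subtracted 1, so [C]
   dominates the kernel and all its truncations on D. *)
pose C : R := 2 * expR (3 * r) * r + expR r + 1.
have E0 : 0 <= 2 * expR (3 * r) * r by rewrite mulr_ge0// mulr_ge0// expR_ge0.
have C1 : 1 <= C by rewrite lerDr addr_ge0 ?expR_ge0.
have normE z w : D z -> D w -> normc (cexp (toC z * conjc (toC w))) <= expR r.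
  move=> Dz Dw; rewrite normc_cexp ler_expR.
  apply: le_trans (normc_toC_mul_le Dz Dw).
  by apply: le_trans (normr_Re_le _); exact: ler_norm.
have normB1 (v : R[i]) : normc (v - 1) <= normc v + 1.
  apply: le_trans (le_normcD _ _) _.
  by rewrite normcN ComplexField.Normc.normc1.
apply: (@bonferroni_correlation_le _ _ R lebC D mD lebC_bounded
  (@ginibre_palm_kernel R) (fun a => ginibre_basis a.+1) (exp_error r) C m C1).
- by move=> a; exact: square_integrable_ginibre_basis.
- by move=> a b; rewrite cip_ginibre_basis eqSS.
- move=> n; apply: (cmeasurable_det _).1 => i j.
  rewrite /ker_mx; under eq_fun do rewrite mxE.
  by apply: cmeasurable_restrict_ginibre => //; exact: measurable_tnth.
- move=> z w Dz Dw; apply: normc_kernel_factor_le.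
  apply: le_trans (normB1 _) _; rewrite lerD2r.
  by apply: le_trans (normE _ _ Dz Dw) _; rewrite lerDr.
- move=> N z w Dz Dw; rewrite finite_rank_ginibre; apply: normc_kernel_factor_le.
  apply: le_trans (normB1 _) _; rewrite lerD2r.
  rewrite -[X in normc X](subrK (cexp (toC z * conjc (toC w)))).
  apply: le_trans (le_normcD _ _) _; apply: lerD; last exact: normE.
  apply: le_trans (exp_error_le N r0).
  exact: normc_exp_truncB_le (normc_toC_mul_le Dz Dw).
- move=> N z w Dz Dw; rewrite finite_rank_ginibre /ginibre_palm_kernel.
  rewrite -mulrBl -mulrBr opprB addrA subrK.
  apply: normc_kernel_factor_le.
  exact: normc_exp_truncB_le (normc_toC_mul_le Dz Dw).
- exact: exp_error_cvg.
Qed.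

End Bounded.
End GinibreKernel.

Section RealPowerIntegral.
Context d (T : measurableType d) (R : realType).
Variable mu : {sigma_finite_measure set T -> \bar R}.

Lemma Rintegral_power_prod n (h : 'I_n -> T -> R) :
  (forall i, mu.-integrable setT (EFin \o h i)) ->
  (power_measure mu n).-integrable setT
    (EFin \o (fun t : n.-tuple T => \prod_i h i (tnth t i))) /\
  \int[power_measure mu n]_t (\prod_i h i (tnth t i)) = \prod_i \int[mu]_x h i x.
Proof.
move=> hi; have ci i : cintegrable mu (fun x => (h i x)%:C%C).
  by split; [exact: hi|exact: integrable0].
have [[h1 _] /(congr1 (@complex.Re _))] := cint_power_prod ci.
have pE (t : n.-tuple T) :
    \prod_i (h i (tnth t i))%:C%C = (\prod_i h i (tnth t i))%:C%C :> R[i].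
  by rewrite rmorph_prod.
have -> : \prod_i cint mu (fun x => (h i x)%:C%C) = (\prod_i \int[mu]_x h i x)%:C%C.
  rewrite rmorph_prod; apply: eq_bigr => i _.
  by rewrite /cint/= [X in Complex _ X]/Rintegral integral0.
move=> hE; split.
  by apply: eq_integrable h1 => // t _ /=; rewrite pE.
by rewrite -[RHS]hE /cint/=; apply: eq_Rintegral => t _; rewrite pE.
Qed.

Lemma ge0_integral_power_measure1 (f : 1.-tuple T -> \bar R) :
  measurable_fun setT f -> (forall t, 0 <= f t)%E ->
  (\int[power_measure mu 1]_t f t = \int[mu]_x f [tuple x])%E.
Proof.
move=> mf f0.
rewrite ge0_integral_power_measureS// fubini_tonelli1//; last first.
  exact: (measurableT_comp mf (@measurable_tcons _ _ _)).
apply: eq_integral => x _; rewrite /fubini_F integral_power_measure0.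
  by congr f; exact/val_inj.
exact: (measurableT_comp (measurableT_comp mf (@measurable_tcons _ T 0))
  (pair1_measurable x)).
Qed.

Lemma ge0_integral_power_measure2 (f : 2.-tuple T -> \bar R) :
  measurable_fun setT f -> (forall t, 0 <= f t)%E ->
  (\int[power_measure mu 2]_t f t = \int[(mu \x mu)]_p f [tuple p.1; p.2])%E.
Proof.
move=> mf f0.
have mf' := measurableT_comp mf (@measurable_tcons _ T 1).
have mt : measurable_fun setT (fun p : T * T => [tuple p.1; p.2] : 2.-tuple T).
  rewrite (_ : (fun p => _) =
    (fun p : T * T => tcons (p.1, tcons (p.2, [tuple] : 0.-tuple T)))); last first.
    by apply/funext => p; apply/val_inj.
  apply: (measurableT_comp (@measurable_tcons _ T 1)).
  apply: measurable_fun_pair; first exact: measurable_fst.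
  apply: (measurableT_comp (@measurable_tcons _ T 0)).
  by apply: measurable_fun_pair; [exact: measurable_snd|exact: measurable_cst].
have mft : measurable_fun setT (fun p : T * T => f [tuple p.1; p.2]).
  exact: (measurableT_comp mf mt).
rewrite ge0_integral_power_measureS// [LHS]fubini_tonelli1//.
rewrite [RHS]fubini_tonelli1//.
apply: eq_integral => x _; rewrite /fubini_F ge0_integral_power_measure1//.
exact: (measurableT_comp mf' (pair1_measurable x)).
Qed.

Variable D : set T.
Hypothesis mD : measurable D.
Hypothesis finD : (mu D < +oo)%E.

Lemma integrable_tuple_pow_le n (F : n.-tuple T -> R) (C : R) :
  measurable_fun setT F -> (forall t, `|F t| <= C * \1_(tuple_pow D) t) ->
  (power_measure mu n).-integrable setT (EFin \o F) /\
  `|\int[power_measure mu n]_t F t| <= C * fine (mu D) ^+ n.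
Proof.
move=> mF FC; have [indi indE] := indic_tuple_pow_integral mD finD n.
have ci := integrable_scale C indi.
have Fi : (power_measure mu n).-integrable setT (EFin \o F) by exact: (integrable_le mF ci FC).
split => //; apply: le_trans (le_normr_Rintegral _ _) _ => //.
rewrite -indE -RintegralZl//; apply: le_Rintegral => //; exact: integrable_norm.
Qed.

End RealPowerIntegral.

(** * Values of the kernel and its first two correlation integrals *)

Section GinibreKernelValues.
Variable R : realType.
Implicit Types (z w : plane R) (D : set (plane R)).

Lemma ginibre_kernel_diag z :
  ginibre_palm_kernel z z = (pi^-1 * (1 - expR (- cabs z ^+ 2)))%:C%C.
Proof.
rewrite /ginibre_palm_kernel (_ : toC z * _ = (cabs z ^+ 2)%:C%C); last first.
  by rewrite -csqE csq_toC.
rewrite (_ : cexp _ = (expR (cabs z ^+ 2))%:C%C); last first.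
  by rewrite /cexp/= cos0 sin0 mulr1.
rewrite (_ : - 2^-1 * _ = - cabs z ^+ 2); last by field.
rewrite -[1](rmorph1 (real_complex R)) -rmorphB -!rmorphM/=; congr (_%:C%C).
by rewrite -mulrA mulrBl mul1r expRxMexpNx_1.
Qed.

Lemma conjc_cexp (v : R[i]) : cexp (conjc v) = conjc (cexp v).
Proof.
case: v => a b; rewrite /cexp/= cosN sinN.
by apply/eqP; rewrite eq_complex/=; apply/andP; split; apply/eqP; ring.
Qed.

Lemma ginibre_kernel_conj z w :
  conjc (ginibre_palm_kernel z w) = ginibre_palm_kernel w z.
Proof.
have rM : {morph (@conjc R) : u v / u * v} by exact: rmorphM.
have rB : {morph (@conjc R) : u v / u - v} by exact: rmorphB.
rewrite /ginibre_palm_kernel !rM rB !conjc_real -conjc_cexp rM conjcK.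
by rewrite [conjc (toC z) * _]mulrC [cabs w ^+ 2 + _]addrC.
Qed.

(** This is |e^v - 1|^2 = e^(2 Re v) - 2 Re e^v + 1 times Gaussian weights, where 2 Re v - |z|^2 -
    |w|^2 = - |z - w|^2. The first term leads to J, the second is a cross term, and the last
    integrates to a square. *)
Lemma csq_ginibre_kernel z w :
  csq (ginibre_palm_kernel z w) = pi ^- 2 * (expR (- cabs (z - w) ^+ 2)
    - 2 * (complex.Re (cexp (toC z * conjc (toC w)))
           * (expR (- cabs z ^+ 2) * expR (- cabs w ^+ 2)))
    + expR (- cabs z ^+ 2) * expR (- cabs w ^+ 2)).
Proof.
rewrite /ginibre_palm_kernel !csqM !csq_real -exprVn -mulrA; congr (_ * _).
have e : expR (- cabs (z - w) ^+ 2) =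
    expR (2 * complex.Re (toC z * conjc (toC w))) *
    (expR (- cabs z ^+ 2) * expR (- cabs w ^+ 2)).
  rewrite -!expRD; congr expR; rewrite !cabs_sqr /=.
  by case: z w => [a b] [c e]/=; ring.
rewrite e; set v := toC z * _.
have -> : csq (cexp v - 1) = expR (2 * complex.Re v) - 2 * complex.Re (cexp v) + 1.
  rewrite (_ : expR (2 * _) = csq (cexp v)).
    by case: (cexp v) => a b; rewrite /csq/=; ring.
  rewrite /cexp csqM csq_real /csq/= cos2Dsin2 mulr1 -expRM_natl.
  by congr expR; ring.
have -> : expR (- 2^-1 * (cabs z ^+ 2 + cabs w ^+ 2)) ^+ 2 =
    expR (- cabs z ^+ 2) * expR (- cabs w ^+ 2).
  by rewrite -expRM_natl -expRD; congr expR; field.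
by ring.
Qed.

End GinibreKernelValues.

Lemma Re_sub (R : realType) (v w : R[i]) :
  complex.Re (v - w) = complex.Re v - complex.Re w.
Proof. by case: v w => [a b] [c e]. Qed.

Lemma det_mx2 (K : comNzRingType) (A : 'M[K]_2) :
  \det A = A ord0 ord0 * A (lift ord0 ord0) (lift ord0 ord0)
  - A ord0 (lift ord0 ord0) * A (lift ord0 ord0) ord0.
Proof.
have l1 : lift (lift ord0 ord0 : 'I_2) (ord0 : 'I_1) = ord0 by exact/val_inj.
rewrite (expand_det_row _ ord0) !big_ord_recl big_ord0 addr0 /cofactor !det_mx11.
rewrite !mxE !l1 /= expr0 expr1 !mul1r mulN1r.
by rewrite mulrN.
Qed.

Section GinibreCorrelations.
Variable R : realType.
Variables (D : set (plane R)) (rho : R).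
Hypothesis mD : measurable D.
Hypothesis Drho : forall z, D z -> cabs z <= rho.
Local Notation pm := (power_measure (@lebC R)).
Local Notation g := (fun z : plane R => expR (- cabs z ^+ 2)).

Let k := restrict_ker D (@ginibre_palm_kernel R).
Let I := correlation_integral lebC D (@ginibre_palm_kernel R).
Let finD : (lebC D < +oo)%E := lebC_bounded mD Drho.

(** The mean number of points lost in D through the conditioning at 0, that is, V/pi - I_1. *)
Definition gauss_mass : R := \int[lebC]_z (\1_D z * (pi^-1 * g z)).

Let kd (z : plane R) : R := \1_D z * (pi^-1 * (1 - g z)).

Let mI : measurable_fun setT (\1_D : plane R -> R).
Proof. exact: measurable_indic. Qed.

Let mg : measurable_fun setT g.
Proof.
by have := @measurable_monomial_gauss R 0 1; under eq_fun do rewrite expr0 !mul1r.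
Qed.

Let indD : lebC.-integrable setT (EFin \o (\1_D : plane R -> R)).
Proof. exact: integrable_indic_lty. Qed.

Let gle1 z : 0 <= g z <= 1.
Proof. by rewrite expR_ge0 expR_le1 oppr_le0 sqr_ge0. Qed.

Let integrable_D (F : plane R -> R) (C : R) : measurable_fun setT F ->
  (forall z, `|F z| <= C) ->
  lebC.-integrable setT (EFin \o (fun z => \1_D z * F z)).
Proof.
move=> mF FC; apply: (@integrable_le _ _ _ _ _ (fun z => C * \1_D z)).
- exact: measurable_funM.
- exact: integrable_scale.
- move=> z; rewrite normrM mulrC indicE.
  by case: (_ \in _); rewrite ?normr1 ?normr0 ?mulr1 ?mulr0.
Qed.

Let gD : lebC.-integrable setT (EFin \o (fun z => \1_D z * (pi^-1 * g z))).
Proof.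
apply: (@integrable_D _ 1); first exact: measurable_funM.
move=> z; have /andP[g0 g1] := gle1 z.
by rewrite ger0_norm ?mulr_ge0 ?invr_ge0 ?pi_ge0// mulr_ile1 ?invr_ge0 ?pi_ge0 ?pi_inv_le1.
Qed.

Let kdD : lebC.-integrable setT (EFin \o kd).
Proof.
apply: (@integrable_D _ 1).
  by apply: measurable_funM => //; exact: measurable_funB.
move=> z; have /andP[g0 g1] := gle1 z.
rewrite ger0_norm ?mulr_ge0 ?invr_ge0 ?pi_ge0 ?subr_ge0//.
by rewrite mulr_ile1 ?invr_ge0 ?pi_ge0 ?pi_inv_le1 ?subr_ge0// gerBl.
Qed.

Let integral_kd : \int[lebC]_z kd z = fine (lebC D) / pi - gauss_mass.
Proof.
rewrite /gauss_mass.
have -> : fine (lebC D) / pi = \int[lebC]_z (pi^-1 * \1_D z).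
  rewrite RintegralZl// mulrC; congr (_ * _).
  by rewrite /Rintegral integral_indic// setIT.
rewrite -RintegralB//; last exact: integrable_scale.
by apply: eq_Rintegral => z _; rewrite /kd; ring.
Qed.

Let diagE z : k z z = (kd z)%:C%C.
Proof.
rewrite /k /restrict_ker ginibre_kernel_diag -!rmorphM/= /kd; congr (_%:C%C).
by rewrite indicE; case: (_ \in _); rewrite ?mul1r ?mul0r.
Qed.

Lemma correlation_integral1 : I 1 = fine (lebC D) / pi - gauss_mass.
Proof.
have [_] := @Rintegral_power_prod _ _ R lebC 1 (fun=> kd) (fun=> kdD).
rewrite big_ord1 integral_kd => <-; apply: eq_Rintegral => t _.
by rewrite big_ord1 det_mx11 mxE -/k diagE.
Qed.

Let i0 : 'I_2 := ord0.
Let i1 : 'I_2 := lift ord0 ord0.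

Let det2E (t : 2.-tuple (plane R)) : complex.Re (\det (ker_mx k t)) =
  kd (tnth t i0) * kd (tnth t i1) - csq (k (tnth t i0) (tnth t i1)).
Proof.
rewrite det_mx2 !mxE -/i0 -/i1 !diagE.
have -> : k (tnth t i1) (tnth t i0) = conjc (k (tnth t i0) (tnth t i1)).
  have rM : {morph (@conjc R) : u v / u * v} by exact: rmorphM.
  rewrite /k /restrict_ker rM [X in _ = X * _]rM !conjc_real ginibre_kernel_conj.
  by rewrite [(\1_D (tnth t i1))%:C%C * _]mulrC.
by rewrite -csqE -rmorphM -rmorphB.
Qed.

(** The squared Hilbert-Schmidt norm of the kernel on D, hence I_1^2 - I_2. *)
Definition offdiag_mass : R :=
  \int[pm 2]_t csq (k (tnth t ord0) (tnth t (lift ord0 ord0))).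

Let DDE (t : 2.-tuple (plane R)) :
  \1_(tuple_pow D) t = \1_D (tnth t i0) * \1_D (tnth t i1) :> R.
Proof. by rewrite indic_tuple_pow !big_ord_recl big_ord0 mulr1. Qed.

(** [FJ] and [FX] are the Gaussian part and the cross part of the squared kernel, cut off to D^2;
    the third part is a product of two copies of [ga]. *)
Let FJ (t : 2.-tuple (plane R)) : R :=
  \1_(tuple_pow D) t * (pi ^- 2 * expR (- cabs (tnth t i0 - tnth t i1) ^+ 2)).

Let FX (t : 2.-tuple (plane R)) : R := \1_(tuple_pow D) t *
  (pi ^- 2 * (complex.Re (cexp (toC (tnth t i0) * conjc (toC (tnth t i1)))) *
  (g (tnth t i0) * g (tnth t i1)))).

Let ga (z : plane R) : R := \1_D z * (pi^-1 * g z).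

Let csqkE (t : 2.-tuple (plane R)) : csq (k (tnth t i0) (tnth t i1)) =
  FJ t - 2 * FX t + ga (tnth t i0) * ga (tnth t i1).
Proof.
have sqI (z : plane R) : \1_D z ^+ 2 = \1_D z :> R.
  by rewrite indicE; case: (_ \in _); rewrite ?expr1n ?expr0n.
rewrite /k /restrict_ker csqM [X in X * _]csqM !csq_real !sqI csq_ginibre_kernel.
by rewrite /FJ /FX /ga DDE -exprVn; ring.
Qed.

Let mDD : measurable_fun setT (fun t : 2.-tuple (plane R) => \1_(tuple_pow D) t : R).
Proof.
have [/measurable_int/measurable_EFinP h _] := indic_tuple_pow_integral mD finD 2.
exact: h.
Qed.

Let mgt (i : 'I_2) : measurable_fun setT (fun t : 2.-tuple (plane R) => g (tnth t i)).
Proof. by apply: (measurableT_comp mg); exact: measurable_tnth. Qed.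

Let pi2_le1 : 0 <= (pi ^- 2 : R) <= 1.
Proof.
by rewrite -exprVn sqr_ge0 exprn_ile1 ?invr_ge0 ?pi_ge0// pi_inv_le1.
Qed.

Let DD01 (t : 2.-tuple (plane R)) : 0 <= (\1_(tuple_pow D) t : R) <= 1.
Proof. by rewrite indicE; case: (_ \in _); rewrite ?lexx ?ler01. Qed.

Let FJi : (pm 2).-integrable setT (EFin \o FJ).
Proof.
apply: (@integrable_tuple_pow_le _ _ _ _ D mD finD 2 FJ 1 _ _).1.
  apply: measurable_funM => //; apply: measurable_funM => //.
  apply: (measurableT_comp (@measurable_expR R)); apply: measurableT_comp => //.
  apply: measurable_funX; apply: measurable_cabs_sub; exact: measurable_tnth.
move=> t; have /andP[d0 d1] := DD01 t; have /andP[p0 p1] := pi2_le1.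
rewrite /FJ ger0_norm ?mulr_ge0 ?expR_ge0// mul1r ler_piMr//.
by rewrite mulr_ile1 ?expR_ge0// expR_le1 oppr_le0 sqr_ge0.
Qed.

Let tuple_powP (t : 2.-tuple (plane R)) : \1_(tuple_pow D) t != 0 :> R ->
  D (tnth t i0) /\ D (tnth t i1).
Proof.
rewrite indicE; have [Dt _|nDt] := pselect (tuple_pow D t); first by split; exact: Dt.
by rewrite memNset// eqxx.
Qed.

Let FXm : measurable_fun setT FX.
Proof.
apply: measurable_funM => //; apply: measurable_funM => //; apply: measurable_funM.
  apply: (cmeasurable_cexp _).1; apply: cmeasurableM.
    by apply: cmeasurable_toC; exact: measurable_tnth.
  by apply: cmeasurable_conj; apply: cmeasurable_toC; exact: measurable_tnth.
by apply: measurable_funM; exact: mgt.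
Qed.

Let gg_le (t : 2.-tuple (plane R)) : 0 <= g (tnth t i0) * g (tnth t i1) <= 1.
Proof.
have /andP[g0 g1] := gle1 (tnth t i0); have /andP[h0 h1] := gle1 (tnth t i1).
by rewrite mulr_ge0//= mulr_ile1.
Qed.

Let factor_le (t : 2.-tuple (plane R)) (x C : R) :
  (D (tnth t i0) -> D (tnth t i1) -> `|x| <= C) ->
  `|\1_(tuple_pow D) t * (pi ^- 2 * (x * (g (tnth t i0) * g (tnth t i1))))|
  <= C * \1_(tuple_pow D) t.
Proof.
move=> xC; have [->|] := eqVneq (\1_(tuple_pow D) t : R) 0.
  by rewrite mul0r normr0 mulr0.
move=> /tuple_powP[D0 D1]; have {}xC := xC D0 D1.
have /andP[d0 d1] := DD01 t; have /andP[p0 p1] := pi2_le1.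
have /andP[g0 g1] := gg_le t.
rewrite normrM (ger0_norm d0) mulrC ler_wpM2r// !normrM (ger0_norm p0).
rewrite -[X in _ * (_ * X)]normrM (ger0_norm g0).
apply: le_trans xC; rewrite mulrCA ler_piMr// mulr_ile1//.
Qed.

Let FXi : (pm 2).-integrable setT (EFin \o FX).
Proof.
apply: (@integrable_tuple_pow_le _ _ _ _ D mD finD 2 FX (expR (rho ^+ 2)) FXm _).1.
move=> t; apply: factor_le => D0 D1.
apply: le_trans (normr_Re_le _) _; rewrite normc_cexp ler_expR.
apply: le_trans (normc_toC_mul_le Drho D0 D1).
by apply: le_trans (normr_Re_le _); exact: ler_norm.
Qed.

Let gai : (pm 2).-integrable setT
    (EFin \o (fun t : 2.-tuple (plane R) => ga (tnth t i0) * ga (tnth t i1))) /\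
  \int[pm 2]_t (ga (tnth t i0) * ga (tnth t i1)) = gauss_mass ^+ 2.
Proof.
have [h1 h2] := @Rintegral_power_prod _ _ R lebC 2 (fun=> ga) (fun=> gD).
have pE : (fun t : 2.-tuple (plane R) => \prod_(i < 2) ga (tnth t i)) =
    (fun t => ga (tnth t i0) * ga (tnth t i1)).
  by apply/funext => t; rewrite !big_ord_recl big_ord0 mulr1.
by move: h1 h2; rewrite pE !big_ord_recl big_ord0 mulr1 expr2.
Qed.

Let kdi : (pm 2).-integrable setT
    (EFin \o (fun t : 2.-tuple (plane R) => kd (tnth t i0) * kd (tnth t i1))) /\
  \int[pm 2]_t (kd (tnth t i0) * kd (tnth t i1)) = I 1 ^+ 2.
Proof.
have [h1 h2] := @Rintegral_power_prod _ _ R lebC 2 (fun=> kd) (fun=> kdD).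
have pE : (fun t : 2.-tuple (plane R) => \prod_(i < 2) kd (tnth t i)) =
    (fun t => kd (tnth t i0) * kd (tnth t i1)).
  by apply/funext => t; rewrite !big_ord_recl big_ord0 mulr1.
move: h1 h2; rewrite pE !big_ord_recl big_ord0 mulr1 expr2 correlation_integral1.
by rewrite integral_kd.
Qed.

Let FJXi : (pm 2).-integrable setT (EFin \o (fun t => FJ t - 2 * FX t)).
Proof.
exact: (integrableB measurableT FJi (integrable_scale 2 FXi)).
Qed.

Let csqki : (pm 2).-integrable setT
  (EFin \o (fun t : 2.-tuple (plane R) => csq (k (tnth t i0) (tnth t i1)))).
Proof.
under eq_fun do rewrite csqkE.
exact: (integrableD measurableT FJXi gai.1).
Qed.

Lemma correlation_integral2 : I 2 = I 1 ^+ 2 - offdiag_mass.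
Proof.
have [h1 <-] := kdi; rewrite /offdiag_mass -RintegralB//.
by apply: eq_Rintegral => t _; rewrite -det2E.
Qed.

Lemma offdiag_mass_ge0 : 0 <= offdiag_mass.
Proof. by apply: Rintegral_ge0 => t _; exact: csq_ge0. Qed.

Lemma offdiag_massE : offdiag_mass =
  \int[pm 2]_t FJ t - 2 * \int[pm 2]_t FX t + gauss_mass ^+ 2.
Proof.
rewrite -gai.2 -RintegralZl// -RintegralB//; last exact: integrable_scale.
rewrite -RintegralD//; last exact: gai.1.
by apply: eq_Rintegral => t _; rewrite csqkE.
Qed.

(** The mode removed by the conditioning, cut off to D; its squared norm is [gauss_mass]. *)
Let u (z : plane R) : R[i] := (\1_D z)%:C%C * ginibre_basis 0 z.

Let ui : square_integrable lebC u.
Proof.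
by apply: square_integrable_restrict => //; exact: square_integrable_ginibre_basis.
Qed.

Let csquE z : csq (u z) = \1_D z * (pi^-1 * g z).
Proof.
rewrite /u csqM csq_real csq_ginibre_basis fact0 mulr1 expr0 mul1r indicE.
by case: (_ \in _); rewrite ?expr1n ?expr0n.
Qed.

Lemma gauss_massE : gauss_mass = \int[lebC]_z csq (u z).
Proof. by apply: eq_Rintegral => z _; rewrite csquE. Qed.

Lemma gauss_mass_ge0 : 0 <= gauss_mass.
Proof. by rewrite gauss_massE; apply: Rintegral_ge0 => z _; exact: csq_ge0. Qed.

Lemma gauss_mass_le1 : gauss_mass <= 1.
Proof.
have [_ _ h0] := square_integrable_ginibre_basis R 0.
have <- : \int[@lebC R]_z csq (ginibre_basis 0 z) = 1.
  by apply: complexI; rewrite -cip_self cip_ginibre_basis_same.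
rewrite gauss_massE; apply: le_Rintegral => //; first by case: ui.
by move=> z _; rewrite /u csqM csq_real ler_piMl ?csq_ge0.
Qed.

(** Its integral is the n-th coefficient of [u] up to conjugation, so h_n(z) times the conjugate of
    h_n(w) integrates to the squared modulus of that coefficient. *)
Let h n (z : plane R) : R[i] := ginibre_basis n z * conjc (u z).

Let hi n : cintegrable lebC (h n).
Proof.
by apply: cintegrable_mul_conj => //; exact: square_integrable_ginibre_basis.
Qed.

(** The cross term with its exponential truncated at degree N: degrees 0 to N, with index 0 included
    because here the exponential appears without the - 1. *)
Let FXN N (t : 2.-tuple (plane R)) : R :=
  \sum_(n < N.+1) complex.Re (h n (tnth t i0) * conjc (h n (tnth t i1))).

Let hhi n : (pm 2).-integrable setT (EFin \o (fun t : 2.-tuple (plane R) =>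
    complex.Re (h n (tnth t i0) * conjc (h n (tnth t i1))))) /\
  \int[pm 2]_t complex.Re (h n (tnth t i0) * conjc (h n (tnth t i1))) =
  csq (cip lebC u (ginibre_basis n)).
Proof.
pose H (i : 'I_2) (z : plane R) := if i == i0 then h n z else conjc (h n z).
have Hi i : cintegrable lebC (H i).
  by rewrite /H; case: (i == i0); [exact: hi|exact: (cintegrable_conj (hi n))].
have [] := cint_power_prod Hi.
have pE : (fun t : 2.-tuple (plane R) => \prod_(i < 2) H i (tnth t i)) =
    (fun t => h n (tnth t i0) * conjc (h n (tnth t i1))).
  by apply/funext => t; rewrite !big_ord_recl big_ord0 mulr1.
rewrite pE => -[h1 _] /(congr1 (@complex.Re _)) hE; split => //.
rewrite [LHS]hE !big_ord_recl big_ord0 mulr1.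
have -> : cint lebC (H ord0) = conjc (cip lebC u (ginibre_basis n)).
  by rewrite cip_conj//; exact: square_integrable_ginibre_basis.
have -> : cint lebC (H (lift ord0 ord0)) = cip lebC u (ginibre_basis n).
  rewrite -[RHS]conjcK cip_conj//; last exact: square_integrable_ginibre_basis.
  by rewrite -(cint_conj (hi n)).
by rewrite mulrC -csqE.
Qed.

Let FXNi N : (pm 2).-integrable setT (EFin \o FXN N) /\
  \int[pm 2]_t FXN N t <= gauss_mass.
Proof.
have FE M : (pm 2).-integrable setT (EFin \o (fun t : 2.-tuple (plane R) =>
    \sum_(n < M) complex.Re (h n (tnth t i0) * conjc (h n (tnth t i1))))) /\
  \int[pm 2]_t (\sum_(n < M) complex.Re (h n (tnth t i0) * conjc (h n (tnth t i1))))
    = \sum_(n < M) csq (cip lebC u (ginibre_basis n)).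
  elim: M => [|M [ih1 ih2]].
    under eq_fun do rewrite big_ord0; rewrite big_ord0; split.
      exact: integrable0.
    by rewrite /Rintegral integral0.
  under eq_fun do rewrite big_ord_recr/=.
  have [h1 h2] := hhi M.
  by rewrite big_ord_recr/= -ih2 -h2 -RintegralD//; split => //;
    exact: (integrableD measurableT ih1 h1).
have [h1 h2] := FE N.+1; split => //; rewrite [leLHS]h2 gauss_massE.
apply: (@bessel _ _ R lebC N.+1 (fun n => ginibre_basis n) u) => //.
  by move=> a; exact: square_integrable_ginibre_basis.
by move=> a b; rewrite cip_ginibre_basis.
Qed.

Let FXNE N t : FXN N t = \1_(tuple_pow D) t *
  (pi ^- 2 * (complex.Re (exp_trunc N (toC (tnth t i0) * conjc (toC (tnth t i1)))) *
  (g (tnth t i0) * g (tnth t i1)))).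
Proof.
set z := tnth t i0; set w := tnth t i1.
pose e : R := expR (- 2^-1 * (cabs z ^+ 2 + cabs w ^+ 2)).
have hh n : h n z * conjc (h n w) =
    (\1_D z * \1_D w * pi ^- 2 * e ^+ 2)%:C%C *
    ((n`!%:R^-1)%:C%C * (toC z * conjc (toC w)) ^+ n).
  have rM : {morph (@conjc R) : u v / u * v} by exact: rmorphM.
  have -> : h n z * conjc (h n w) = (\1_D z)%:C%C * (\1_D w)%:C%C *
      (ginibre_basis n z * conjc (ginibre_basis n w)) *
      (ginibre_basis 0 w * conjc (ginibre_basis 0 z)).
    have hE x : h n x = (\1_D x)%:C%C * (ginibre_basis n x * conjc (ginibre_basis 0 x)).
      by rewrite /h /u rM conjc_real mulrCA.
    have hcE x : conjc (h n x) =
        (\1_D x)%:C%C * (conjc (ginibre_basis n x) * ginibre_basis 0 x).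
      by rewrite hE rM conjc_real [X in _ * X]rM conjcK.
    rewrite hcE hE.
    move: (ginibre_basis n z) (conjc (ginibre_basis n w)) (ginibre_basis 0 w)
      (conjc (ginibre_basis 0 z)) (\1_D z)%:C%C (\1_D w)%:C%C => *.
    by ring.
  rewrite !ginibre_basis_mul_conj expr0 fact0 invr1 [cabs w ^+ 2 + _]addrC -/e.
  have -> : (\1_D z * \1_D w * pi ^- 2 * e ^+ 2)%:C%C =
      (\1_D z)%:C%C * (\1_D w)%:C%C * ((pi^-1)%:C%C * (pi^-1)%:C%C)
      * (e%:C%C * e%:C%C) :> R[i].
    by rewrite -exprVn !expr2 !rmorphM.
  by rewrite (rmorph1 (real_complex R)); ring.
rewrite /FXN; under eq_bigr do rewrite -/z -/w hh Re_mul/= mul0r subr0.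
rewrite -mulr_sumr DDE -/z -/w.
have -> : e ^+ 2 = g z * g w.
  by rewrite /e -expRM_natl -expRD; congr expR; field.
rewrite /exp_trunc -[X in _ * X = _]raddf_sum.
by rewrite -/(exp_trunc _ _); ring.
Qed.

(** Expanding the exponential turns the integral into the sum of the squared coefficients of [u], at
    most its squared norm by Bessel. The inequality is proved for the truncations, whose error tends
    to 0 on a bounded set. *)
Lemma FX_le : \int[pm 2]_t FX t <= gauss_mass.
Proof.
pose V := fine (lebC D) ^+ 2.
have hN N : \int[pm 2]_t FX t <= gauss_mass + exp_error (rho ^+ 2) N * V.
  have [Ni Nle] := FXNi N; rewrite -lerBlDl.
  apply: (@le_trans _ _ (\int[pm 2]_t FX t - \int[pm 2]_t FXN N t)).
    by rewrite lerD2l lerN2.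
  rewrite -RintegralB//; apply: le_trans (ler_norm _) _.
  apply: (@integrable_tuple_pow_le _ _ _ _ D mD finD 2 (fun t => FX t - FXN N t) _ _ _).2.
    apply: measurable_funB => //.
    by have [/measurable_int/measurable_EFinP] := FXNi N.
  move=> t; rewrite FXNE /FX -mulrBr -mulrBr -mulrBl; apply: factor_le => D0 D1.
  rewrite -Re_sub; apply: le_trans (normr_Re_le _) _.
  rewrite -normcN opprB.
  by apply: normc_exp_truncB_le; exact: (normc_toC_mul_le Drho D0 D1).
have lim : gauss_mass + exp_error (rho ^+ 2) N * V @[N --> \oo] --> gauss_mass + 0 * V.
  apply: cvgD; first exact: cvg_cst.
  by apply: cvgM; [exact: exp_error_cvg|exact: cvg_cst].
rewrite mul0r addr0 in lim.
by apply: (ler_cvg_to (cvg_cst _) lim); apply: nearW => N; exact: hN.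
Qed.

(** Restrict both points to the disc. The integrand depends on their difference only, so the disc
    may be translated to the origin, where J is defined. *)
Lemma FJ_ge (c : plane R) (r : R) : (forall z, disc c r z -> D z) ->
  2 * J_coeff r <= \int[pm 2]_t FJ t.
Proof.
move=> cD; have FJm : measurable_fun setT FJ.
  by have /measurable_int/measurable_EFinP := FJi.
pose G (p : plane R * plane R) : \bar R :=
  (\1_D p.1 * \1_D p.2 * (pi ^- 2 * expR (- cabs (p.1 - p.2) ^+ 2)))%:E.
pose H b (p : plane R * plane R) : \bar R := (\1_(disc b r) p.1 * \1_(disc b r) p.2 *
  (pi ^- 2 * expR (- cabs (p.1 - p.2) ^+ 2)))%:E.
have mE : measurable_fun setT (fun p : plane R * plane R =>
    expR (- cabs (p.1 - p.2) ^+ 2)).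
  apply: (measurableT_comp (@measurable_expR R)); apply: measurableT_comp => //.
  apply: measurable_funX; apply: measurable_cabs_sub;
    [exact: measurable_fst|exact: measurable_snd].
have mB b : measurable (disc b r) by exact: measurable_disc.
have m2 (A : set (plane R)) : measurable A -> measurable_fun setT
    (fun p : plane R * plane R => \1_A p.1 * \1_A p.2 : R).
  move=> mA; apply: measurable_funM.
    exact: (measurableT_comp (measurable_indic mA) measurable_fst).
  exact: (measurableT_comp (measurable_indic mA) measurable_snd).
have mG : measurable_fun setT G.
  apply/measurable_EFinP; apply: measurable_funM; first exact: m2.
  exact: measurable_funM.
have mH b : measurable_fun setT (H b).
  apply/measurable_EFinP; apply: measurable_funM; first exact: m2.
  exact: measurable_funM.
have /andP[p0 _] := pi2_le1.
have H0 b p : (0 <= H b p)%E by rewrite lee_fin !mulr_ge0 ?expR_ge0.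
have G0 p : (0 <= G p)%E by rewrite lee_fin !mulr_ge0 ?expR_ge0.
have FJE : (\int[pm 2]_t FJ t)%:E = (\int[lebC \x lebC]_p G p)%E.
  rewrite /Rintegral fineK; last exact: integrable_fin_num.
  rewrite ge0_integral_power_measure2//.
  - by apply: eq_integral => p _; rewrite /G /FJ DDE.
  - exact/measurable_EFinP.
  - by move=> t; rewrite lee_fin /FJ !mulr_ge0 ?expR_ge0.
have HG : (\int[lebC \x lebC]_p H c p <= \int[lebC \x lebC]_p G p)%E.
  apply: ge0_le_integral => // p _; rewrite lee_fin ler_wpM2r ?mulr_ge0 ?expR_ge0//.
  have ind z : \1_(disc c r) z <= \1_D z :> R.
    rewrite !indicE; have [cz|ncz] := pselect (disc c r z).
      by rewrite !mem_set//; exact: cD.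
    by rewrite memNset.
  by apply: ler_pM => //; exact: ind.
have HH : (\int[lebC \x lebC]_p H c p = \int[lebC \x lebC]_p H 0%R p)%E.
  have shift : forall F : plane R -> \bar R, measurable_fun setT F ->
      (forall x, (0 <= F x)%E) ->
      (\int[lebC]_x F x = \int[lebC]_x F (affine_plane 1 c x))%E.
    by move=> F mF F0; rewrite ge0_integral_affine// expr1n invr1 mul1e.
  have mx b (x : plane R) : measurable_fun setT (fun y => H b (x, y)).
    exact: (measurableT_comp (mH b) (pair1_measurable x)).
  rewrite (fubini_tonelli1 (H c) (mH c) (H0 c)) (fubini_tonelli1 (H 0) (mH 0) (H0 0)).
  rewrite (shift (fubini_F lebC (H c))); last 2 first.
  - exact: (measurable_fun_fubini_tonelli_F (H c) (mH c) (H0 c)).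
  - by move=> x; exact: integral_ge0.
  apply: eq_integral => x _; rewrite /fubini_F.
  rewrite (shift (fun y => H c (affine_plane 1 c x, y)) (mx _ _)) => [|y]; last exact: H0.
  apply: eq_integral => y _; rewrite /H/=.
  have e : affine_plane 1 c x - affine_plane 1 c y = x - y.
    by case: x y => [x1 x2] [y1 y2]; congr pair => /=; ring.
  have e2 w : \1_(disc c r) (affine_plane 1 c w) = \1_(disc 0 r) w :> R.
    rewrite !indicE; congr (_ : bool)%:R; apply/idP/idP; rewrite !inE /disc/=;
      by rewrite cabs_affine// mul1r subr0.
  by rewrite e !e2.
pose Q := (\int[lebC \x lebC]_(p in disc 0 r `*` disc 0 r)
  (expR (- cabs (p.1 - p.2) ^+ 2))%:E)%E.
have HQ : (\int[lebC \x lebC]_p H 0%R p = (pi ^- 2)%:E * Q)%E.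
  have mBB : measurable (disc (0 : plane R) r `*` disc (0 : plane R) r).
    exact: measurableX.
  have -> : ((pi ^- 2)%:E * Q =
    \int[lebC \x lebC]_(p in disc (0 : plane R) r `*` disc (0 : plane R) r)
      ((pi ^- 2)%:E * (expR (- cabs (p.1 - p.2) ^+ 2))%:E))%E.
    rewrite /Q ge0_integralZl//.
    by apply/measurable_EFinP; exact: measurable_funTS.
  rewrite [RHS]integral_mkcond; apply: eq_integral => p _; rewrite patchE /H.
  have [[p1 p2]|np] := pselect ((disc (0 : plane R) r `*` disc (0 : plane R) r) p).
    by rewrite (mem_set (conj p1 p2 : (_ `*` _) p)) !indicE !mem_set// !mul1r EFinM.
  rewrite (memNset np) !indicE.
  have [p1|np1] := pselect (disc (0 : plane R) r p.1); last by rewrite (memNset np1) !mul0r.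
  have [p2|np2] := pselect (disc (0 : plane R) r p.2); last first.
    by rewrite (memNset np2) mulr0 mul0r.
  by case: np.
have : ((pi ^- 2)%:E * Q <= (\int[pm 2]_t FJ t)%:E)%E by rewrite -HQ -HH FJE.
have -> : 2 * J_coeff r = pi ^- 2 * fine Q.
  rewrite /J_coeff -/Q mulrA invfM mulrA mulfV ?mul1r//.
have pi2 : 0 < pi ^- 2 :> R by rewrite invr_gt0 exprn_gt0// pi_gt0.
have : (0 <= Q)%E by apply: integral_ge0 => p _; rewrite lee_fin expR_ge0.
(* [J_coeff] takes the finite part of [Q]; an infinite [Q] is ruled out by the finite bound just
   obtained. *)
case: Q {HQ} => [q _| _|]; last by rewrite leeNy_eq.
  by rewrite -EFinM lee_fin.
by rewrite gt0_muley ?lte_fin// leye_eq.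
Qed.

Lemma ginibre_exponent_le (c : plane R) (r : R) : (forall z, disc c r z -> D z) ->
  - I 1 - (I 1 ^+ 2 - I 2) / 2 <= - (fine (lebC D) / pi) + (3 / 2 - J_coeff r).
Proof.
move=> cD; rewrite correlation_integral2 opprB addrCA subrr addr0 offdiag_massE.
rewrite correlation_integral1.
have := FJ_ge cD; have := FX_le; have := gauss_mass_ge0; have := gauss_mass_le1.
move: gauss_mass (\int[pm 2]_t FX t) (\int[pm 2]_t FJ t) (fine _ / pi) (J_coeff r).
move=> a x j v J a1 a0 xa Jj.
(* With x <= a and j >= 2J the left side is at most - v + 2a - a^2/2 - J, and 3/2 - 2a + a^2/2 = (1
   - a)(3 - a)/2. *)
have : 0 <= (1 - a) * (3 - a) by rewrite mulr_ge0// subr_ge0// (le_trans a1)// ler1n.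
by rewrite expr2 => ?; lra.
Qed.

Lemma ginibre_exponent_le1 :
  - I 1 - (I 1 ^+ 2 - I 2) / 2 <= - (fine (lebC D) / pi) + 1.
Proof.
rewrite correlation_integral2 opprB addrCA subrr addr0 correlation_integral1.
by have := offdiag_mass_ge0; have := gauss_mass_le1; lra.
Qed.

End GinibreCorrelations.

(** * Void probabilities of determinantal processes *)

Section CountingTuples.
Variable R : realType.

Lemma card_uniq_tuples_set (T : choiceType) (A : set T) n : finite_set A ->
  counting [set t : n.-tuple T | uniq t /\ forall i, A (tnth t i)] =
  ((#|` fset_set A|%fset ^_ n)%:R%:E : \bar R).
Proof.
move=> finA; pose X := fset_set A.
pose Q := [pred t : n.-tuple X | uniq t].
pose f (t : n.-tuple X) : n.-tuple T := [tuple of map val t].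
have f_inj : injective f.
  by move=> s t /(congr1 val)/= /(inj_map val_inj) /val_inj.
pose s := [seq f t | t <- enum Q].
pose S := [fset t in s]%fset.
have SE : [set t : n.-tuple T | uniq t /\ forall i, A (tnth t i)] = [set` S].
  apply/seteqP; split => t /=.
    move=> [ut At].
    have tX i : tnth t i \in X by rewrite in_fset_set// inE.
    pose t' : n.-tuple X := [tuple [` tX i]%fset | i < n].
    have tE : t = f t'.
      by apply: eq_from_tnth => i; rewrite tnth_map tnth_mktuple.
    rewrite !inE tE; apply: map_f; rewrite mem_enum inE.
    by move: ut; rewrite {1}tE /f /= map_inj_uniq//; exact: val_inj.
  rewrite !inE => /mapP[t']; rewrite mem_enum inE => ut' ->; split.
    by rewrite /f /= map_inj_uniq//; exact: val_inj.
  move=> i; rewrite /f tnth_map; have := valP (tnth t' i).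
  by rewrite in_fset_set// inE.
rewrite SE /counting asboolT; last exact: finite_fset.
rewrite set_fsetK card_fseq undup_id; last by rewrite map_inj_uniq ?enum_uniq.
rewrite size_map -cardE; congr (_%:R%:E).
have := @card_uniq_tuples X n predT; rewrite cardT -cardT -cardfE => <-.
by apply: eq_card => t; rewrite !inE all_predT.
Qed.

Lemma alternating_bin N k :
  \sum_(n < k.+1) (-1) ^+ n * 'C(N.+1, n)%:R = (-1) ^+ k * 'C(N, k)%:R :> R.
Proof.
elim: k => [|k ih]; first by rewrite big_ord1 !bin0.
by rewrite big_ord_recr/= ih binS natrD exprS; ring.
Qed.

(** For N > 0 the even partial sum collapses by Pascal's rule to the binomial coefficient of N-1 and
    2m; for N = 0 only its first term survives. *)
Lemma alternating_ffact_ge N m :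
  (N == 0)%:R <= \sum_(n < (m.*2).+1) (-1) ^+ n / n`!%:R * (N ^_ n)%:R :> R.
Proof.
have fact_neq0 n : n`!%:R != 0 :> R by rewrite pnatr_eq0 -lt0n fact_gt0.
rewrite (eq_bigr (fun n : 'I_(m.*2).+1 => (-1) ^+ n * 'C(N, n)%:R)); last first.
  by move=> n _; rewrite -bin_ffact natrM; field; exact: fact_neq0.
case: N => [|N]; last by rewrite alternating_bin -muln2 exprM sqrr_sign mul1r.
by rewrite big_ord_recl big1 ?addr0 ?mul1r// => i _; rewrite bin0n mulr0.
Qed.

End CountingTuples.

Section Determinantal.
Context {R : realType} {d : measure_display} {Omega : measurableType d}.
Variable P : probability Omega R.
Variables (psi : Omega -> set (plane R)) (K : plane R -> plane R -> R[i]).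
Variables (D : set (plane R)) (rho : R).
Hypothesis mD : measurable D.
Hypothesis Drho : forall z, D z -> cabs z <= rho.
Hypothesis psiK : determinantal P K psi.

Definition npoints (w : Omega) : nat := #|` fset_set (psi w `&` D)|%fset.

Lemma finite_points w : finite_set (psi w `&` D).
Proof.
have [[h _] _] := psiK; apply: sub_finite_set (h w (rho + 1)).
move=> z [pz Dz]; split => //; rewrite /disc/= subr0.
by rewrite (le_lt_trans (Drho Dz))// ltrDl.
Qed.

Lemma num_pointsE w : num_points psi D w = (npoints w)%:R%:E.
Proof. by rewrite /num_points /counting asboolT//; exact: finite_points. Qed.

Lemma measurable_npoints : measurable_fun setT (fun w => (npoints w)%:R : R).
Proof.
have [[_ h] _] := psiK; apply/measurable_EFinP.
rewrite (_ : EFin \o _ = num_points psi D); first exact: h.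
by apply/funext => w; rewrite num_pointsE.
Qed.

Lemma npoints_eq0 w : (npoints w == 0)%N = `[< psi w `&` D = set0 >].
Proof.
rewrite /npoints cardfs_eq0; apply/eqP/asboolP => [h|->]; last by rewrite fset_set0.
exact: fset_set_set0 (finite_points w) h.
Qed.

Lemma measurable_void : measurable [set w | psi w `&` D = set0].
Proof.
rewrite (_ : [set w | _] = (fun w => (npoints w)%:R : R) @^-1` [set 0]).
  by rewrite -[X in measurable X]setTI; exact: measurable_npoints.
apply/seteqP; split => w /=.
  by move/asboolP; rewrite -npoints_eq0 => /eqP ->.
by move/eqP; rewrite pnatr_eq0 npoints_eq0 => /asboolP.
Qed.

Lemma measurable_npoints_ffact n :
  measurable_fun setT (fun w => (npoints w ^_ n)%:R : R).
Proof.
elim: n => [|n ih]; first by under eq_fun do rewrite ffactn0; exact: measurable_cst.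
(* The truncated subtraction of natural numbers becomes a maximum with 0 over the reals, which is
   visibly measurable. *)
rewrite (_ : (fun w => _) = (fun w => (npoints w ^_ n)%:R *
   Num.max ((npoints w)%:R - n%:R) 0)).
  apply: measurable_funM => //; apply: measurable_maxr => //.
  by apply: measurable_funB => //; exact: measurable_npoints.
apply/funext => w; rewrite ffactnSr natrM; congr (_ * _).
have [nN|Nn] := leqP n (npoints w).
  by rewrite natrB// max_l// subr_ge0 ler_nat.
have /eqP -> : (npoints w - n == 0)%N by rewrite subn_eq0 ltnW.
by rewrite max_r// subr_le0 ler_nat ltnW.
Qed.

Hypothesis Ki : forall n, (power_measure lebC n).-integrable setT
  (EFin \o (fun t : n.-tuple (plane R) => complex.Re (\det (ker_mx (restrict_ker D K) t)))).

Lemma integral_npoints_ffact n :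
  (\int[P]_w ((npoints w ^_ n)%:R)%:E = (correlation_integral lebC D K n)%:E)%E.
Proof.
rewrite /correlation_integral /Rintegral fineK; last by apply: integrable_fin_num => //; exact: Ki.
(* Order 0 is separate, since the determinantal property speaks of k >= 1: both sides are then 1. *)
case: n => [|n].
  transitivity (\int[P]_w (cst 1 w))%E.
    by apply: eq_integral => w _; rewrite ffactn0.
  rewrite integral_cst// mul1e; transitivity (1%E : \bar R).
    exact: probability_setT.
  rewrite [RHS]integral_power_measure0.
    by rewrite det_mx00.
  by have /measurable_int := Ki 0.
have mB : measurable (tuple_pow D : set (n.+1.-tuple (plane R))).
  rewrite (_ : tuple_pow D = (fun t : n.+1.-tuple (plane R) =>
     \1_(tuple_pow D) t : R) @^-1` [set 1]).
    rewrite -[X in measurable X]setTI.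
    have [/measurable_int/measurable_EFinP h _] :=
      indic_tuple_pow_integral mD (lebC_bounded mD Drho) n.+1.
    exact: h.
  apply/seteqP; split => t /=; first by move=> Dt; rewrite indicE mem_set.
  rewrite indicE; have [//|nDt] := pselect (tuple_pow D t).
  by rewrite memNset// => /eqP; rewrite eq_sym oner_eq0.
have [_ /(_ n.+1 (tuple_pow D) isT mB)] := psiK.
rewrite (eq_integral (fun w => ((npoints w ^_ n.+1)%:R)%:E)); last first.
  move=> w _; rewrite -card_uniq_tuples_set; last exact: finite_points.
  congr counting; apply/seteqP; split => t /=.
    by move=> [ut pt Dt]; split => // i; split.
  by move=> [ut pD]; split => // i; have [] := pD i.
move=> ->; rewrite [LHS]integral_mkcond; apply: eq_integral => t _.
rewrite patchE /= det_restrict_ker indicE.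
case: (boolP (t \in _)) => _; first by rewrite mul1r.
by rewrite mul0r.
Qed.

Lemma integrable_npoints_ffact n :
  P.-integrable setT (EFin \o (fun w => (npoints w ^_ n)%:R)).
Proof.
apply/integrableP; split; first exact/measurable_EFinP/measurable_npoints_ffact.
rewrite (eq_integral (fun w => ((npoints w ^_ n)%:R)%:E)).
  by rewrite integral_npoints_ffact ltry.
by move=> w _; rewrite /= ger0_norm.
Qed.

Let void_indicE w : \1_[set w | psi w `&` D = set0] w = (npoints w == 0%N)%:R :> R.
Proof.
by rewrite indicE npoints_eq0; congr ((_ : bool)%:R).
Qed.

Let void_Rintegral : fine (P [set w | psi w `&` D = set0]) =
  \int[P]_w \1_[set w | psi w `&` D = set0] w.
Proof. by rewrite /Rintegral integral_indic ?setIT//; exact: measurable_void. Qed.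

Let void_integrable : P.-integrable setT
  (EFin \o (\1_[set w | psi w `&` D = set0] : Omega -> R)).
Proof. by apply: integrable_indic; exact: measurable_void. Qed.

Lemma void_bonferroni m : fine (P [set w | psi w `&` D = set0]) <=
  \sum_(n < (m.*2).+1) (-1) ^+ n / n`!%:R * correlation_integral lebC D K n.
Proof.
have sumE M : P.-integrable setT (EFin \o (fun w =>
    \sum_(n < M) (-1) ^+ n / n`!%:R * (npoints w ^_ n)%:R : R)) /\
  \int[P]_w (\sum_(n < M) (-1) ^+ n / n`!%:R * (npoints w ^_ n)%:R) =
  \sum_(n < M) (-1) ^+ n / n`!%:R * correlation_integral lebC D K n.
  elim: M => [|M [ih1 ih2]].
    under eq_fun do rewrite big_ord0; rewrite big_ord0; split.
      exact: integrable0.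
    by rewrite /Rintegral integral0.
  under eq_fun do rewrite big_ord_recr/=.
  have h1 := integrable_scale ((-1) ^+ M / M`!%:R) (integrable_npoints_ffact M).
  split; first exact: (integrableD measurableT ih1 h1).
  rewrite RintegralD// ih2 RintegralZl ?big_ord_recr//=; last first.
    exact: integrable_npoints_ffact.
  by rewrite {1}/Rintegral integral_npoints_ffact.
have [h1 <-] := sumE (m.*2).+1; rewrite void_Rintegral; apply: le_Rintegral => //.
by move=> w _; rewrite void_indicE alternating_ffact_ge.
Qed.

Lemma void_ge_first_moment :
  1 - correlation_integral lebC D K 1 <= fine (P [set w | psi w `&` D = set0]).
Proof.
have i1 : P.-integrable setT (EFin \o (fun=> 1 : R)).
  exact: finite_measure_integrable_cst.
have in1 := integrable_npoints_ffact 1.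
have <- : \int[P]_w (1 - (npoints w ^_ 1)%:R) = 1 - correlation_integral lebC D K 1.
  rewrite (RintegralB measurableT i1 in1); congr (_ - _).
    rewrite Rintegral_cst// mul1r -[RHS]/(fine 1%:E); congr fine.
    exact: probability_setT.
  by rewrite {1}/Rintegral integral_npoints_ffact.
rewrite void_Rintegral; apply: le_Rintegral => //.
  exact: (integrableB measurableT i1 in1).
move=> w _; rewrite void_indicE ffactn1; case: (npoints w) => [|N] /=.
  by rewrite subr0.
by rewrite subr_le0 ler1n.
Qed.

End Determinantal.

(** * Upper and lower bounds for the Ginibre void probability *)

Section GinibreVoid.
Context {R : realType} {d : measure_display} {Omega : measurableType d}.
Variable P : probability Omega R.
Variable phi : Omega -> set (plane R).
Hypothesis hphi : determinantal P (@ginibre_palm_kernel R) phi.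
Variables (D : set (plane R)) (rho : R).
Hypothesis mD : measurable D.
Hypothesis Drho : forall z, D z -> cabs z <= rho.
Let I := correlation_integral lebC D (@ginibre_palm_kernel R).

Let Ki n : (power_measure lebC n).-integrable setT
  (EFin \o (fun t : n.-tuple (plane R) =>
    complex.Re (\det (ker_mx (restrict_ker D (@ginibre_palm_kernel R)) t)))).
Proof.
apply: (integrable_det_restrict mD (lebC_bounded mD Drho) (C := expR (rho ^+ 2) + 1)).
  apply: (cmeasurable_det _).1 => i j.
  rewrite /ker_mx; under eq_fun do rewrite mxE.
  by apply: cmeasurable_restrict_ginibre => //; exact: measurable_tnth.
move=> z w Dz Dw; apply: normc_kernel_factor_le.
apply: le_trans (le_normcD _ _) _; rewrite normcN ComplexField.Normc.normc1 lerD2r.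
rewrite normc_cexp ler_expR; apply: le_trans (normc_toC_mul_le Drho Dz Dw).
by apply: le_trans (normr_Re_le _); exact: ler_norm.
Qed.

Lemma ginibre_void_le : fine (P [set w | phi w `&` D = set0]) <=
  expR (- I 1 - (I 1 ^+ 2 - I 2) / 2).
Proof.
apply/ler_addgt0Pr => e e0.
(* The remainder is a term of the exponential series of [I 1], hence eventually below [e]; it is
   read at index 2N+1 >= N. *)
have /cvgrPdist_le/(_ _ e0)[N _ hN] := @cvg_exp_coeff R (I 1).
apply: le_trans (void_bonferroni mD Drho hphi Ki N) _.
apply: le_trans (bonferroni_ginibre_le mD Drho N) _; rewrite lerD2l.
have /hN : (N <= (N.*2).+1)%N by rewrite -addnn -addnS leq_addr.
by rewrite sub0r normrN; apply: le_trans; exact: ler_norm.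
Qed.

Lemma ginibre_void_le_J (c : plane R) (r : R) : (forall z, disc c r z -> D z) ->
  fine (P [set w | phi w `&` D = set0]) <=
  expR (- (fine (lebC D) / pi)) * expR (3 / 2 - J_coeff r).
Proof.
move=> cD; apply: le_trans ginibre_void_le _; rewrite -expRD ler_expR.
exact: (ginibre_exponent_le mD Drho cD).
Qed.

Lemma ginibre_void_le1 :
  fine (P [set w | phi w `&` D = set0]) <=
  expR (- (fine (lebC D) / pi)) * expR 1.
Proof.
apply: le_trans ginibre_void_le _; rewrite -expRD ler_expR.
exact: (ginibre_exponent_le1 mD Drho).
Qed.

(** On D one has 1 - e^(-|z|^2) <= |z|^2 <= rho^2, which bounds the mean number of points by rho^2
    V/pi. *)
Lemma ginibre_void_ge :
  1 - rho ^+ 2 * (fine (lebC D) / pi) <= fine (P [set w | phi w `&` D = set0]).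
Proof.
apply: le_trans (void_ge_first_moment mD Drho hphi Ki); rewrite lerD2l lerN2.
rewrite (correlation_integral1 mD Drho).
have DI := integrable_indic_lty mD (lebC_bounded mD Drho).
have mg : measurable_fun setT (fun z : plane R => pi^-1 * expR (- cabs z ^+ 2)).
  apply: measurable_funM => //.
  by have := @measurable_monomial_gauss R 0 1; under eq_fun do rewrite expr0 !mul1r.
have : (1 - rho ^+ 2) * (fine (lebC D) / pi) <= gauss_mass D.
  have -> : (1 - rho ^+ 2) * (fine (lebC D) / pi) =
      \int[lebC]_z ((1 - rho ^+ 2) / pi * \1_D z).
    rewrite RintegralZl// -mulrA [_ / pi]mulrC; congr (_ * (_ * _)).
    by rewrite /Rintegral integral_indic// setIT.
  apply: le_Rintegral => //; first exact: integrable_scale.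
    apply: (@integrable_le _ _ _ _ _ (\1_D : plane R -> R)) => //.
      by apply: measurable_funM => //; exact: measurable_indic.
    move=> z; rewrite ger0_norm ?mulr_ge0 ?invr_ge0 ?pi_ge0 ?expR_ge0//.
    rewrite ler_piMr// mulr_ile1 ?invr_ge0 ?pi_ge0 ?expR_ge0 ?pi_inv_le1//.
    by rewrite expR_le1 oppr_le0 sqr_ge0.
  move=> z _; rewrite indicE; have [Dz|nDz] := pselect (D z); last first.
    by rewrite memNset// mulr0 mul0r.
  rewrite mem_set// mulr1 mul1r mulrC ler_wpM2l ?invr_ge0 ?pi_ge0//.
  apply: le_trans (expR_ge1Dx _); rewrite lerD2l lerN2 lerXn2r ?nnegrE ?cabs_ge0//.
    exact: le_trans (cabs_ge0 z) (Drho Dz).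
  exact: Drho.
by rewrite mulrBl mul1r; lra.
Qed.

End GinibreVoid.

(** * Voronoi cells and flowers *)

Section Flower.
Variable R : realType.
Implicit Types (psi A : set (plane R)).

Definition flower k (t : k.-tuple (plane R)) : set (plane R) :=
  \bigcup_(i in [set: 'I_k]) disc (tnth t i) (cabs (tnth t i)).

Lemma voronoi_cell0P psi z :
  voronoi_cell0 psi z <-> psi `&` disc z (cabs z) = set0.
Proof.
split=> [h|h u pu].
  apply/seteqP; split => // u [pu]; rewrite /disc/= cabs_subC ltNge.
  by rewrite (h u pu).
rewrite leNgt; apply/negP => uz.
by have : (psi `&` disc z (cabs z)) u by [split=> //; rewrite /disc/= cabs_subC]; rewrite h.
Qed.

Lemma voronoi_cell0_tuple psi k (t : k.-tuple (plane R)) :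
  (forall i, voronoi_cell0 psi (tnth t i)) <-> psi `&` flower t = set0.
Proof.
split=> [h|h i].
  apply/seteqP; split => // u [pu [i _ ui]].
  by have /voronoi_cell0P <- := h i.
apply/voronoi_cell0P; apply/seteqP; split => // u [pu ui].
by rewrite -h; split => //; exists i.
Qed.

Lemma measurable_flower k (t : k.-tuple (plane R)) : measurable (flower t).
Proof.
apply: fin_bigcup_measurable; first exact: finite_finset.
by move=> i _; exact: measurable_disc.
Qed.

Lemma flower_bounded k (t : k.-tuple (plane R)) (r : R) :
  (forall i, cabs (tnth t i) <= r) -> forall z, flower t z -> cabs z <= 2 * r.
Proof.
(* Each disc has the origin on its boundary circle, so its diameter 2|z_i| bounds the distance to
   0. *)
move=> tr z [i _ zi]; rewrite -(subrK (tnth t i) z).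
apply: le_trans (cabs_triangle _ _) _; rewrite mulr_natl mulr2n.
by apply: lerD => //; apply: le_trans (ltW zi) _.
Qed.

(** Any finite radius serves: where this is used, only the boundedness of the flower matters. *)
Lemma tuple_cabs_bounded k (t : k.-tuple (plane R)) :
  forall i, cabs (tnth t i) <= \sum_j cabs (tnth t j).
Proof.
by move=> i; rewrite (bigD1 i)//= lerDl sumr_ge0// => j _; exact: cabs_ge0.
Qed.

End Flower.

(** * Mean powers of the area of a Voronoi cell *)

Section TuplePower.
Context d (T : measurableType d) (R : realType).
Variable mu : {sigma_finite_measure set T -> \bar R}.

Lemma measurable_tuple_pow n (A : set T) : measurable A ->
  measurable (tuple_pow A : set (n.-tuple T)).
Proof.
move=> mA; rewrite (_ : tuple_pow A =
    \bigcap_(i in [set: 'I_n]) (fun t : n.-tuple T => tnth t i) @^-1` A).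
  apply: fin_bigcap_measurable; first exact: finite_finset.
  by move=> i _; rewrite -[X in measurable X]setTI; exact: measurable_tnth.
by apply/seteqP; split => t /= h i; [move=> _|]; exact: h.
Qed.

Lemma power_measure_tuple_pow n (A : set T) : measurable A ->
  power_measure mu n (tuple_pow A) = (mu A ^+ n)%E.
Proof.
move=> mA; elim: n => [|n ih].
  rewrite expe0 /= diracE mem_set//.
  by move=> -[].
rewrite expeS -ih -product_measure1E//; last exact: measurable_tuple_pow.
rewrite /= /pm_step /pushforward; congr (product_measure1 _ _ _).
apply/seteqP; split => -[x t] /=.
  move=> h; split; first exact: (h ord0).
  by move=> i; have := h (lift ord0 i); rewrite /tcons tnthS.
move=> [/= Ax At] i; case: (unliftP ord0 i) => [j ->|->//].
by rewrite /tcons tnthS; exact: At.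
Qed.

End TuplePower.

Lemma product_measure1_ysection d1 d2 (T1 : measurableType d1)
    (T2 : measurableType d2) (R : realType)
    (m1 : {sigma_finite_measure set T1 -> \bar R})
    (m2 : {sigma_finite_measure set T2 -> \bar R}) (A : set (T1 * T2)) :
  measurable A ->
  (\int[m1]_x m2 (xsection A x) = \int[m2]_y m1 (ysection A y))%E.
Proof.
move=> mA; apply: (@product_measure_unique _ _ _ _ _ m1 m2
  (m1 \x^ m2)%E _ _ mA) => B C mB mC.
exact: product_measure2E.
Qed.

Section PointProcess.
Context {R : realType} {d : measure_display} {Omega : measurableType d}.
Variable P : probability Omega R.
Variable psi : Omega -> set (plane R).
Hypothesis hpsi : point_process psi.

Lemma num_points_eq0 (A : set (plane R)) w :
  num_points psi A w = 0%E <-> psi w `&` A = set0.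
Proof.
rewrite /num_points /counting; split => [|->]; last first.
  by rewrite asboolT ?fset_set0//; exact: finite_set0.
case: asboolP => // fA /eqP; rewrite eqe pnatr_eq0 cardfs_eq0 => /eqP.
exact: fset_set_set0.
Qed.

Lemma measurable_empty_event (A : set (plane R)) : measurable A ->
  measurable [set w | psi w `&` A = set0].
Proof.
move=> mA; have [_ /(_ A mA) mn] := hpsi.
rewrite (_ : [set w | _] = num_points psi A @^-1` [set 0%E]).
  by rewrite -[X in measurable X]setTI; exact: mn.
by apply/seteqP; split => w /num_points_eq0.
Qed.

Definition cell_graph : set (Omega * plane R) :=
  [set p | voronoi_cell0 (psi p.1) p.2].

(* A point [u] violates [|z| <= |z - u|] iff it lies in a rational disc all of
   whose points do. *)
Lemma measurable_cell_graph : measurable cell_graph.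
Proof.
pose q (x : rat * rat * rat) : plane R := (ratr x.1.1, ratr x.1.2).
pose N (x : rat * rat * rat) : set Omega :=
  ~` [set w | psi w `&` disc (q x) (ratr x.2) = set0].
pose Z (x : rat * rat * rat) : set (plane R) :=
  ~` [set z | cabs z < cabs (z - q x) + ratr x.2].
rewrite (_ : cell_graph = ~` (\bigcup_x (N x `*` Z x))).
  apply: measurableC; apply: countable_bigcupT_measurable; first exact: countableP.
  move=> x; apply: measurableX; apply: measurableC.
    by apply: measurable_empty_event; exact: measurable_disc.
  apply: measurable_set_ltr; first exact: measurable_cabs.
  apply: measurable_funD => //.
  by apply: measurable_cabs_sub => //; exact: measurable_cst.
apply/seteqP; split => -[w z] /=.
  move=> h -[x _ [/= /eqP/set0P[u [pu ux]] /negP]]; rewrite -leNgt.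
  have := h u pu; rewrite /disc/= in ux.
  have := cabs_triangle (z - q x) (q x - u); rewrite subrKA [cabs (q x - u)]cabs_subC.
  by lra.
apply: contra_notP => /existsNP[u /not_implyP[pu /negP]]; rewrite -ltNge => zu.
(* The slack is 4e: a centre q within e of u and a radius between e and 2e give |z - q| + radius <
   |z - u| + 3e < |z|. *)
set e := (cabs z - cabs (z - u)) / 4.
have e0 : 0 < e by rewrite divr_gt0// subr_gt0.
have [a /andP[a1 a2]] : exists a : rat, u.1 - e / 2 < ratr a < u.1 + e / 2.
  have [|a] := @rat_in_itvoo R (u.1 - e / 2) (u.1 + e / 2); first by lra.
  by rewrite in_itv/=; exists a.
have [b /andP[b1 b2]] : exists b : rat, u.2 - e / 2 < ratr b < u.2 + e / 2.
  have [|b] := @rat_in_itvoo R (u.2 - e / 2) (u.2 + e / 2); first by lra.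
  by rewrite in_itv/=; exists b.
have [c /andP[c1 c2]] : exists c : rat, e < ratr c < e * 2.
  have [|c] := @rat_in_itvoo R e (e * 2); first by lra.
  by rewrite in_itv/=; exists c.
have uq : cabs (u - q (a, b, c)) < e.
  rewrite -(@ltr_pXn2r _ 2)// ?nnegrE ?cabs_ge0 ?(ltW e0)//.
  rewrite cabs_sqr/=.
  have h1 : (u.1 - ratr a) ^+ 2 <= (e / 2) ^+ 2.
    by rewrite -[leLHS]real_normK ?num_real// lerXn2r ?nnegrE ?normr_ge0 ?ler_norml; lra.
  have h2 : (u.2 - ratr b) ^+ 2 <= (e / 2) ^+ 2.
    by rewrite -[leLHS]real_normK ?num_real// lerXn2r ?nnegrE ?normr_ge0 ?ler_norml; lra.
  by nra.
exists (a, b, c) => //; split => /=.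
  by apply/eqP/set0P; exists u; split => //; rewrite /disc/= (lt_trans uq).
apply/negP; rewrite -leNgt.
have := cabs_triangle (z - u) (u - q (a, b, c)); rewrite subrKA.
rewrite /e in uq c1 c2 *; lra.
Qed.

Variable k : nat.

Lemma measurable_flower_graph :
  measurable [set p : Omega * k.-tuple (plane R) | psi p.1 `&` flower p.2 = set0].
Proof.
rewrite (_ : [set p | _] = \bigcap_(i in [set: 'I_k])
   (fun p : Omega * k.-tuple (plane R) => (p.1, tnth p.2 i)) @^-1` cell_graph).
  apply: fin_bigcap_measurable; first exact: finite_finset.
  move=> i _; rewrite -[X in measurable X]setTI.
  have m : measurable_fun setT
      (fun p : Omega * k.-tuple (plane R) => (p.1, tnth p.2 i)).
    apply: measurable_fun_pair; first exact: measurable_fst.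
    exact: (measurableT_comp (measurable_tnth i) measurable_snd).
  by apply: m => //; exact: measurable_cell_graph.
apply/seteqP; split => -[w t] /=.
  by move=> /voronoi_cell0_tuple h i _; exact: h.
by move=> h; apply/voronoi_cell0_tuple => i; exact: (h i).
Qed.

Lemma measurable_void_prob :
  measurable_fun setT (fun t : k.-tuple (plane R) =>
    P [set w | psi w `&` flower t = set0]).
Proof.
have := measurable_fun_ysection P measurable_flower_graph.
apply: eq_measurable_fun => t _; congr (P _).
by apply/seteqP; split => w; rewrite /ysection/= inE.
Qed.

Lemma mean_area_powE (A : set (plane R)) : measurable A ->
  mean_area_pow P k (fun w => voronoi_cell0 (psi w) `&` A) =
  (\int[power_measure lebC k]_(t in tuple_pow A)
     P [set w | psi w `&` flower t = set0])%E.
Proof.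
move=> mA; have mtA := @measurable_tuple_pow _ _ k _ mA.
set G := [set p : Omega * k.-tuple (plane R) | psi p.1 `&` flower p.2 = set0].
have mGA : measurable (G `&` (setT `*` tuple_pow A)).
  by apply: measurableI; [exact: measurable_flower_graph|exact: measurableX].
transitivity (\int[P]_w power_measure lebC k (xsection (G `&` (setT `*` tuple_pow A)) w))%E.
  apply: eq_integral => w _; rewrite -power_measure_tuple_pow.
    congr (power_measure _ _ _); apply/seteqP; split => t /=.
      move=> h; rewrite /xsection/= inE; split; last by split=> // i; exact: (h i).2.
      by apply/voronoi_cell0_tuple => i; exact: (h i).1.
    rewrite /xsection/= inE => -[/voronoi_cell0_tuple h [_ At]] i.
    by split; [exact: h|exact: At].
  apply: measurableI => //.
  have := measurable_xsection w measurable_cell_graph.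
  by congr measurable; apply/seteqP; split => z; rewrite /xsection/= inE.
rewrite (product_measure1_ysection P (power_measure lebC k) mGA) [RHS]integral_mkcond.
apply: eq_integral => t _; rewrite patchE; case: ifPn => [|/negP].
  rewrite inE => At; congr (P _); apply/seteqP; split => w; rewrite /ysection/= inE.
    by case.
  by move=> h; split.
rewrite inE => nAt; rewrite (_ : ysection _ _ = set0) ?measure0//.
by apply/seteqP; split => w //; rewrite /ysection/= inE => -[_ [_ /nAt]].
Qed.

End PointProcess.

Section PoissonVoid.
Context {R : realType} {d : measure_display} {Omega : measurableType d}.
Variable P : probability Omega R.
Variable psi : Omega -> set (plane R).
Hypothesis hpsi : poisson_process P (fun A => (pi^-1)%:E * lebC A)%E psi.

Lemma poisson_void (A : set (plane R)) : measurable A -> (lebC A < +oo)%E ->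
  P [set w | psi w `&` A = set0] = (expR (- (fine (lebC A) / pi)))%:E.
Proof.
move=> mA fA; have [_ h _] := hpsi.
have finA : lebC A \is a fin_num by rewrite ge0_fin_numE.
have nuA : (pi^-1%:E * lebC A)%E = (fine (lebC A) / pi)%:E.
  by rewrite mulrC EFinM fineK.
have := h A mA; rewrite nuA ltry => /(_ isT 0%N); rewrite expr0 fact0 divr1 mul1r => <-.
congr (P _); apply/seteqP; split => w /=; by move=> /num_points_eq0.
Qed.

End PoissonVoid.

Section VoidComparison.
Context {R : realType} {d d' : measure_display} {Omega : measurableType d}
  {Omega' : measurableType d'}.
Variables (P : probability Omega R) (P' : probability Omega' R).
Variables (phi : Omega -> set (plane R)) (Pi : Omega' -> set (plane R)).
Hypothesis hphi : point_process phi.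
Hypothesis hPi : poisson_process P' (fun A => (pi^-1)%:E * lebC A)%E Pi.

Lemma flower_finite k (t : k.-tuple (plane R)) : (lebC (flower t) < +oo)%E.
Proof.
exact: (lebC_bounded (measurable_flower t) (flower_bounded (tuple_cabs_bounded t))).
Qed.

Lemma poisson_void_flower k (t : k.-tuple (plane R)) :
  P' [set w | Pi w `&` flower t = set0] =
  (expR (- (fine (lebC (flower t)) / pi)))%:E.
Proof. by apply: poisson_void => //; [exact: measurable_flower|exact: flower_finite]. Qed.

(** Reduces a comparison of means, possibly infinite, to a pointwise comparison of void
    probabilities of flowers, where every quantity is finite. *)
Lemma mean_area_pow_le k (A : set (plane R)) (C : R) : measurable A -> 0 <= C ->
  (forall t : k.-tuple (plane R), tuple_pow A t ->
    fine (P [set w | phi w `&` flower t = set0]) <=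
    expR (- (fine (lebC (flower t)) / pi)) * C) ->
  (mean_area_pow P k (fun w => voronoi_cell0 (phi w) `&` A) <=
   mean_area_pow P' k (fun w => voronoi_cell0 (Pi w) `&` A) * C%:E)%E.
Proof.
move=> mA C0 h; have [pPi _ _] := hPi.
rewrite !mean_area_powE//; have mtA := @measurable_tuple_pow _ _ k _ mA.
have mv := measurable_void_prob P hphi (k := k).
have mv' := measurable_void_prob P' pPi (k := k).
rewrite muleC -ge0_integralZl//; last exact: measurable_funTS.
apply: ge0_le_integral => //.
- exact: measurable_funTS.
- by apply: measurable_funeM; exact: measurable_funTS.
move=> t At; rewrite poisson_void_flower -EFinM mulrC.
by rewrite -[leLHS]fineK ?fin_num_measure// ?lee_fin ?h//;
  apply: measurable_empty_event => //; exact: measurable_flower.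
Qed.

End VoidComparison.

(** * Quadratic growth of J *)

Section JBound.
Variable R : realType.

Lemma lebC_disc (z : plane R) (r : R) : 0 < r -> lebC (disc z r) = (r ^+ 2 * pi)%:E.
Proof. by move=> r0; rewrite lebC_disc_scale// lebC_unit_disc. Qed.

(** Keep only the pairs with z_1 in B(r/2) and |z_2 - z_1| < 1, which lie in B(r)^2 as soon as r >=
    2. Their measure is pi^2 r^2/4 and the integrand is at least 1/e there; dividing by 2 pi^2 gives
    r^2/(8e). *)
Lemma J_coeff_ge (r : R) : 2 <= r -> (8 * expR 1)^-1 * r ^+ 2 <= J_coeff r.
Proof.
move=> r2; have r0 : 0 < r by lra.
set D := disc (0 : plane R) r; have mD : measurable D by exact: measurable_disc.
have mDD : measurable (D `*` D) by exact: measurableX.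
set nu := (@lebC R \x @lebC R)%E.
set E : set (plane R * plane R) :=
  (disc 0 (r / 2) `*` setT) `&` [set z | cabs (z.2 - z.1) < 1].
have mE : measurable E.
  apply: measurableI; first by apply: measurableX => //; exact: measurable_disc.
  apply: measurable_set_ltr; last exact: measurable_cst.
  by apply: measurable_cabs_sub; [exact: measurable_snd|exact: measurable_fst].
have ED : E `<=` D `*` D.
  move=> [z w] [[/= z2 _] zw]; rewrite /disc/= subr0 in z2; split; rewrite /D/disc/= subr0.
    by rewrite (lt_trans z2)//; lra.
  rewrite -(subrK z w); apply: le_lt_trans (cabs_triangle _ _) _; lra.
have DDfin : (nu (D `*` D) < +oo)%E.
  rewrite /nu product_measure1E//; change (lebC D * lebC D < +oo)%E.
  by rewrite /D !lebC_disc// -EFinM ltry.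
have nuE : nu E = ((r / 2) ^+ 2 * pi * pi)%:E.
  rewrite /nu /product_measure1 (eq_integral (fun z : plane R =>
      pi%:E * (\1_(disc 0 (r / 2)) z)%:E)%E); last first.
    move=> z _ /=; rewrite indicE; have [zr|zr] := pselect (disc 0 (r / 2) z).
      rewrite mem_set// mule1 (_ : xsection E z = disc z 1).
        by rewrite lebC_disc// expr1n mul1r.
      apply/seteqP; split => w; rewrite /xsection/= inE.
        by case.
      by move=> zw; split.
    rewrite memNset// mule0 (_ : xsection E z = set0) ?measure0//.
    by apply/seteqP; split => w //; rewrite /xsection/= inE => -[[]].
  rewrite ge0_integralZl ?lee_fin ?pi_ge0//; last first.
    by apply/measurable_EFinP; exact: measurable_indic (measurable_disc _ _).
  rewrite integral_indic//; last exact: measurable_disc.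
  rewrite setIT; change (pi%:E * lebC (disc (0 : plane R) (r / 2)) = ((r / 2) ^+ 2 * pi * pi)%:E)%E.
  by rewrite lebC_disc ?divr_gt0// -EFinM mulrC.
have indI : nu.-integrable (D `*` D) (EFin \o (\1_E : _ -> R)).
  apply/integrableP; split; first by apply/measurable_EFinP/measurable_indic.
  apply: le_lt_trans DDfin; rewrite -[leRHS]mul1e -integral_cst//.
  apply: ge0_le_integral => //.
    by apply: measurableT_comp => //; apply/measurable_EFinP/measurable_indic.
  by move=> z _; rewrite /= lee_fin indicE; case: (_ \in _); rewrite ?normr1 ?normr0.
have mf : measurable_fun setT (fun z : plane R * plane R =>
    expR (- cabs (z.1 - z.2) ^+ 2)).
  apply: measurableT_comp => //; apply: measurableT_comp => //.
  apply: measurable_funX.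
  by apply: measurable_cabs_sub; [exact: measurable_fst|exact: measurable_snd].
have fI : nu.-integrable (D `*` D) (EFin \o (fun z : plane R * plane R =>
    expR (- cabs (z.1 - z.2) ^+ 2))).
  apply/integrableP; split.
    by apply/measurable_EFinP; exact: measurable_funTS.
  apply: le_lt_trans DDfin; rewrite -[leRHS]mul1e -integral_cst//.
  apply: ge0_le_integral => //.
    by apply: measurableT_comp => //; apply/measurable_EFinP; exact: measurable_funTS.
  move=> z _; rewrite /= lee_fin ger0_norm ?expR_ge0// expR_le1 oppr_le0 sqr_ge0//.
have : expR (- 1) * ((r / 2) ^+ 2 * pi * pi) <=
    \int[nu]_(z in D `*` D) expR (- cabs (z.1 - z.2) ^+ 2).
  have -> : expR (- 1) * ((r / 2) ^+ 2 * pi * pi) =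
      \int[nu]_(z in D `*` D) (expR (- 1) * \1_E z).
    rewrite RintegralZl//; congr (_ * _).
    transitivity (fine (nu E)); first by rewrite nuE.
    rewrite /Rintegral integral_indic; [|exact: mDD|exact: mE].
    congr (fine (_ _)); symmetry; exact: (setIidl ED).
  apply: le_Rintegral => //.
    exact: (@integrableZl _ _ _ nu _ mDD (expR (- 1)) (EFin \o \1_E)).
  move=> z _; rewrite indicE; have [Ez|Ez] := pselect (E z); last first.
    by rewrite memNset// mulr0 expR_ge0.
  rewrite mem_set// mulr1 ler_expR lerN2 cabs_subC expr_le1//.
    by case: Ez => _ /ltW.
  exact: cabs_ge0.
rewrite /J_coeff -/nu -/D.
move=> h; apply: le_trans (ler_wpM2l _ h); last first.
  by rewrite invr_ge0 mulr_ge0// sqr_ge0.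
rewrite le_eqVlt; apply/orP; left; apply/eqP.
rewrite (_ : expR (- 1) = (expR 1)^-1); last exact: expRN.
have p0 : (pi : R) != 0 by rewrite gt_eqF// pi_gt0.
have e0 : expR 1 != 0 :> R by rewrite gt_eqF// expR_gt0.
by move: p0 e0; generalize (pi : R), (expR 1 : R) => p q p0 q0; field; rewrite p0 q0.
Qed.

End JBound.

(** * Small radii *)

Section PowerAffine.
Variable R : realType.

Definition affine_tuple n (r : R) (z : plane R) (t : n.-tuple (plane R)) :
  n.-tuple (plane R) := map_tuple (affine_plane r z) t.

Lemma measurable_affine_tuple n r z : measurable_fun setT (@affine_tuple n r z).
Proof.
apply/measurable_fun_tnthP => i.
rewrite (_ : _ \o _ = affine_plane r z \o (fun t => tnth t i)).
  exact: (measurableT_comp (measurable_affine_plane r z) (measurable_tnth i)).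
by apply/funext => t /=; rewrite tnth_map.
Qed.

Lemma ge0_integral_power_affine n r z (f : n.-tuple (plane R) -> \bar R) :
  0 < r -> measurable_fun setT f -> (forall t, 0 <= f t)%E ->
  (\int[power_measure lebC n]_t f (affine_tuple r z t) =
   ((r ^- 2) ^+ n)%:E * \int[power_measure lebC n]_t f t)%E.
Proof.
move=> r0; elim: n f => [|n ih] f mf f0.
  rewrite !integral_power_measure0//; last first.
    exact: (measurableT_comp mf (measurable_affine_tuple _ _)).
  by rewrite expr0 mul1e; congr f; exact: val_inj.
have r20 : 0 <= (r ^- 2) ^+ n by rewrite exprn_ge0// invr_ge0 sqr_ge0.
have mft := measurableT_comp mf (@measurable_tcons _ (plane R) n).
have mfa := measurableT_comp mf (@measurable_affine_tuple n.+1 r z).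
have mfat := measurableT_comp mfa (@measurable_tcons _ (plane R) n).
rewrite !ge0_integral_power_measureS// [in RHS]fubini_tonelli1//.
rewrite [LHS]fubini_tonelli1//.
have mF := measurable_fun_fubini_tonelli_F (m2 := power_measure lebC n) _ mft
  (fun p => f0 (tcons p)).
have F0 x : (0 <= fubini_F (power_measure lebC n) (f \o @tcons _ (plane R) n) x)%E.
  by apply: integral_ge0 => y _; exact: f0.
rewrite exprS EFinM -muleA (muleC (r ^- 2)%:E) -muleA (muleC _ (r ^- 2)%:E).
rewrite -(ge0_integral_affine z r0 mF)// -ge0_integralZl//; last first.
  exact: (measurableT_comp mF (measurable_affine_plane r z)).
apply: eq_integral => x _; rewrite /fubini_F.
rewrite -(ih (fun t => f (tcons (affine_plane r z x, t)))) //; last first.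
  exact: (measurableT_comp mft (pair1_measurable _)).
apply: eq_integral => t _; congr f; exact: val_inj.
Qed.

End PowerAffine.

Section FlowerArea.
Variable R : realType.
Implicit Types r : R.

Lemma measurable_flower_area k : measurable_fun setT (@flower_area R k).
Proof.
set G := [set p : k.-tuple (plane R) * plane R | flower p.1 p.2].
have mG : measurable G.
  rewrite (_ : G = \bigcup_(i in [set: 'I_k]) [set p : k.-tuple (plane R) * plane R |
      cabs (p.2 - tnth p.1 i) < cabs (tnth p.1 i)]).
    apply: fin_bigcup_measurable; first exact: finite_finset.
    move=> i _.
    have mi := measurableT_comp (measurable_tnth i)
      (@measurable_fst _ _ (k.-tuple (plane R)) (plane R)).
    apply: measurable_set_ltr; last exact: (measurableT_comp (@measurable_cabs R) mi).
    by apply: measurable_cabs_sub => //; exact: measurable_snd.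
  by apply/seteqP; split => p [i _ ?]; exists i.
have := measurable_fun_xsection lebC mG.
apply: eq_measurable_fun => t _; congr (lebC _).
by apply/seteqP; split => z; rewrite /xsection/= inE.
Qed.

Lemma affine_plane0B r (z w : plane R) :
  affine_plane r 0 z - affine_plane r 0 w = affine_plane r 0 (z - w).
Proof. by congr pair => /=; ring. Qed.

Lemma cabs_affine0 r (z : plane R) : 0 <= r -> cabs (affine_plane r 0 z) = r * cabs z.
Proof. by move=> r0; rewrite -[in LHS](subr0 (affine_plane _ _ _)) cabs_affine. Qed.

Lemma flower_area_scale k r (t : k.-tuple (plane R)) : 0 < r ->
  flower_area (affine_tuple r 0 t) = ((r ^+ 2)%:E * flower_area t)%E.
Proof.
move=> r0; have := lebC_affine 0 r0 (measurable_flower (affine_tuple r 0 t)).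
rewrite (_ : _ @^-1` _ = flower t); last first.
  have dE i z : disc (tnth (affine_tuple r 0 t) i) (cabs (tnth (affine_tuple r 0 t) i))
      (affine_plane r 0 z) <-> disc (tnth t i) (cabs (tnth t i)) z.
    rewrite tnth_map /disc/= affine_plane0B !cabs_affine0 ?(ltW r0)//.
    by rewrite ltr_pM2l.
  by apply/seteqP; split => z [i _ /dE ?]; exists i.
move=> E; rewrite [flower_area t]E muleA -EFinM mulfV ?mul1e//.
by rewrite expf_neq0// lt0r_neq0.
Qed.

(** Of the k+1 factors r^2, k come from the change of variables and one from the area itself. *)
Lemma integral_flower_area_scale k r : 0 < r ->
  (\int[power_measure lebC k]_(t in tuple_pow (disc 0 r)) flower_area t =
   ((r ^+ 2) ^+ k.+1)%:E *
   \int[power_measure lebC k]_(t in tuple_pow (disc (0 : plane R) 1)) flower_area t)%E.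
Proof.
move=> r0; rewrite integral_mkcond [in RHS]integral_mkcond.
have mD1 := @measurable_tuple_pow _ _ k _ (measurable_disc (0 : plane R) 1).
set g := (_ \_ _) => /=; set h := (_ \_ _).
have mDr := @measurable_tuple_pow _ _ k _ (measurable_disc (0 : plane R) r).
have mg : measurable_fun setT g.
  apply/(measurable_restrictT _ mDr).
  by apply: measurable_funTS; exact: measurable_flower_area.
have g0 t : (0 <= g t)%E by rewrite /g patchE; case: ifP.
have h0 t : (0 <= h t)%E by rewrite /h patchE; case: ifP.
have mh : measurable_fun setT h.
  apply/(measurable_restrictT _ mD1).
  by apply: measurable_funTS; exact: measurable_flower_area.
have gh t : g (affine_tuple r 0 t) = ((r ^+ 2)%:E * h t)%E.
  have memE : tuple_pow (disc 0 r) (affine_tuple r 0 t) <->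
      tuple_pow (disc 0 1) t.
    by split => ht i; have := ht i; rewrite tnth_map /disc/= !subr0
      cabs_affine0 ?(ltW r0)// gtr_pMr.
  rewrite /g /h !patchE; have [/memE tr|/memE tr] :=
      pselect (tuple_pow (disc 0 r) (affine_tuple r 0 t)).
    by rewrite !mem_set//; [exact: flower_area_scale|exact/memE].
  by rewrite !memNset ?mule0// => /memE.
clearbody g h; have := ge0_integral_power_affine 0 r0 mg g0.
under eq_integral do rewrite gh.
rewrite ge0_integralZl//; last by rewrite lee_fin sqr_ge0.
move=> /(congr1 (fun x => ((r ^+ 2) ^+ k)%:E * x)%E).
rewrite !muleA -!EFinM -exprMn mulfV ?expf_neq0 ?lt0r_neq0// expr1n mul1e => <-.
by rewrite -exprSr.
Qed.

End FlowerArea.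

Section SmallRatio.
Variable R : realFieldType.

(* [x] is [r ^+ 2]; the constants 36 and 81 come from [V / pi <= 9 * r ^+ 2]
   for tuples in [B(r)]. *)
Lemma ratio_expansion (A W a b x : R) : 0 < A -> 0 <= W -> 0 <= x ->
  A * (1 - 36 * x ^+ 2) <= a -> a <= A ->
  A * (1 - x * W) <= b -> b <= A * (1 - x * W + 81 * x ^+ 2) ->
  x * W <= 1 / 2 ->
  `|a / b - 1 - x * W| <= (2 * W ^+ 2 + 316) * x ^+ 2.
Proof.
move=> A0 W0 x0 a1 a2 b1 b2 xW.
have b0 : 0 < b.
  by apply: lt_le_trans b1; rewrite mulr_gt0//; lra.
have bA : A / 2 <= b by apply: le_trans b1; rewrite ler_pM2l//; lra.
have -> : `|a / b - 1 - x * W| = `|a - b - x * W * b| / b.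
  by rewrite -[X in _ = _ / X](gtr0_norm b0) -normf_div; congr `|_|; field; rewrite gt_eqF.
rewrite ler_pdivrMr//.
set s := x * W in a1 b1 b2 xW *; have s0 : 0 <= s by rewrite mulr_ge0.
have sE : W ^+ 2 * x ^+ 2 = s ^+ 2 by rewrite /s exprMn mulrC.
have x2 : 0 <= x ^+ 2 by rewrite sqr_ge0.
have C0 : 0 <= (2 * W ^+ 2 + 316) * x ^+ 2.
  by rewrite mulr_ge0 ?addr_ge0 ?mulr_ge0 ?sqr_ge0 ?ler0n.
apply: le_trans (ler_wpM2l C0 bA).
(* Division by [b] costs a factor 2, as b >= A/2. From above the numerator is at most A s^2; from
   below the loss is at most (36 + 81 + 81/2) A x^2, and 157.5 is rounded up to 158. *)
have -> : (2 * W ^+ 2 + 316) * x ^+ 2 * (A / 2) = A * (s ^+ 2 + 158 * x ^+ 2).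
  by rewrite -sE; field.
have h1 : A * (1 - s) * s <= b * s by rewrite ler_wpM2r.
have h2 : b * s <= A * (1 - s + 81 * x ^+ 2) * s by rewrite ler_wpM2r.
have h3 : A * (81 * x ^+ 2 * s) <= A * (81 * x ^+ 2 * (1 / 2)).
  by rewrite ler_pM2l// ler_wpM2l// mulr_ge0.
have h4 : 0 <= A * x ^+ 2 by rewrite mulr_ge0// ltW.
have h5 : 0 <= A * s ^+ 2 by rewrite mulr_ge0 ?sqr_ge0// ltW.
rewrite ler_norml [s * b]mulrC; apply/andP; split; lra.
Qed.

End SmallRatio.

Section TuplePowIntegral.
Context d (T : measurableType d) (R : realType).
Variable mu : {sigma_finite_measure set T -> \bar R}.
Variables (D : set T) (n : nat).
Hypothesis mD : measurable D.
Hypothesis finD : (mu D < +oo)%E.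
Local Notation pm := (power_measure mu n).

Lemma tuple_pow_integralE (F : n.-tuple T -> R) (M : R) :
  measurable_fun setT F -> (forall t, tuple_pow D t -> `|F t| <= M) ->
  pm.-integrable setT (EFin \o (fun t => \1_(tuple_pow D) t * F t)) /\
  (\int[pm]_(t in tuple_pow D) (F t)%:E =
    (\int[pm]_t (\1_(tuple_pow D) t * F t))%:E)%E.
Proof.
move=> mF FM; have mDn := measurable_tuple_pow (n := n) mD.
have int : pm.-integrable setT (EFin \o (fun t => \1_(tuple_pow D) t * F t)).
  apply: (@integrable_tuple_pow_le _ _ _ _ D mD finD n _ M _ _).1.
    by apply: measurable_funM => //; exact: measurable_indic.
  move=> t; rewrite indicE; have [Dt|Dt] := pselect (tuple_pow D t); last first.
    by rewrite memNset// mul0r mulr0 normr0.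
  by rewrite mem_set// mul1r mulr1 FM.
split => //; rewrite /Rintegral fineK; last exact: integrable_fin_num.
rewrite [LHS]integral_mkcond; apply: eq_integral => t _; rewrite patchE indicE.
by case: ifP => _; rewrite ?mul1r ?mul0r.
Qed.

Lemma tuple_pow_integral_le (F G : n.-tuple T -> R) (M N : R) :
  measurable_fun setT F -> measurable_fun setT G ->
  (forall t, tuple_pow D t -> `|F t| <= M) ->
  (forall t, tuple_pow D t -> `|G t| <= N) ->
  (forall t, tuple_pow D t -> F t <= G t) ->
  \int[pm]_t (\1_(tuple_pow D) t * F t) <= \int[pm]_t (\1_(tuple_pow D) t * G t).
Proof.
move=> mF mG FM GM FG; apply: le_Rintegral => //.
- exact: (tuple_pow_integralE mF FM).1.
- exact: (tuple_pow_integralE mG GM).1.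
move=> t _; rewrite indicE; have [Dt|Dt] := pselect (tuple_pow D t).
  by rewrite mem_set// !mul1r FG.
by rewrite memNset// !mul0r.
Qed.

Lemma tuple_pow_integral_cst (c : R) :
  \int[pm]_t (\1_(tuple_pow D) t * c) = c * fine (mu D) ^+ n.
Proof.
have [indi indE] := indic_tuple_pow_integral mD finD n.
by under eq_Rintegral do rewrite mulrC; rewrite RintegralZl// indE.
Qed.

End TuplePowIntegral.

Section SmallRadius.
Context {R : realType} {d d' : measure_display} {Omega : measurableType d}
  {Omega' : measurableType d'}.
Variables (P : probability Omega R) (P' : probability Omega' R).
Variables (phi : Omega -> set (plane R)) (Pi : Omega' -> set (plane R)).
Hypothesis hphi : determinantal P (@ginibre_palm_kernel R) phi.
Hypothesis hPi : poisson_process P' (fun A => (pi^-1)%:E * lebC A)%E Pi.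
Variable k : nat.

Let V (t : k.-tuple (plane R)) : R := fine (flower_area t) / pi.
Let fg (t : k.-tuple (plane R)) : R := fine (P [set w | phi w `&` flower t = set0]).
Let fp (t : k.-tuple (plane R)) : R := expR (- V t).

Section FixedRadius.
Variable r : R.
Hypothesis r0 : 0 < r.
Local Notation D := (disc (0 : plane R) r).
Local Notation pm := (power_measure (@lebC R) k).
Local Notation Int F := (\int[pm]_t (\1_(tuple_pow D) t * F t)).

Let mD : measurable D := measurable_disc 0 r.

Let lebD : lebC D = (r ^+ 2 * pi)%:E := lebC_disc 0 r0.

Let finD : (lebC D < +oo)%E.
Proof. by rewrite lebD ltry. Qed.

Let mV : measurable_fun setT V.
Proof.
apply: measurable_funM => //.
exact: (measurableT_comp (fine_measurable measurableT) (@measurable_flower_area R k)).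
Qed.

Let mfg : measurable_fun setT fg.
Proof.
exact: (measurableT_comp (fine_measurable measurableT) (measurable_void_prob P hphi.1 (k := k))).
Qed.

Let mfp : measurable_fun setT fp.
Proof. by apply: measurableT_comp => //; exact: measurableT_comp. Qed.

Let flower_le (t : k.-tuple (plane R)) : tuple_pow D t -> forall z, flower t z -> cabs z <= 2 * r.
Proof.
move=> Dt; apply: flower_bounded => i.
by have := Dt i; rewrite /disc/= subr0 => /ltW.
Qed.

Let V_bounds (t : k.-tuple (plane R)) : tuple_pow D t -> 0 <= V t <= 9 * r ^+ 2.
Proof.
move=> Dt; rewrite /V divr_ge0 ?fine_ge0 ?pi_ge0//= ler_pdivrMr ?pi_gt0//.
(* The flower lies in the closed disc of radius 2r; the open disc of radius 3r contains it with room
   to spare, whence the constant 9. *)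
have : (lebC (flower t) <= lebC (disc (0 : plane R) (3 * r)))%E.
  apply: le_measure; rewrite ?inE; [exact: measurable_flower|exact: measurable_disc|].
  move=> z /(flower_le Dt) zr; rewrite /disc/= subr0.
  by apply: le_lt_trans zr _; rewrite ltr_pM2r// ltr_nat.
rewrite (@lebC_disc _ 0 (3 * r)) ?mulr_gt0// => h.
rewrite -lee_fin fineK ?ge0_fin_numE ?flower_finite//.
by apply: le_trans h _; rewrite lee_fin exprMn; lra.
Qed.

Let fg_le1 t : fg t <= 1.
Proof.
have mv := measurable_empty_event hphi.1 (measurable_flower t).
by rewrite -lee_fin fineK ?fin_num_measure// probability_le1.
Qed.

(** The flower has radius 2r and V/pi <= 9 r^2, so the first-moment loss is at most 4 r^2 times 9
    r^2. *)
Let fg_bounds (t : k.-tuple (plane R)) : tuple_pow D t -> 1 - 36 * r ^+ 4 <= fg t.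
Proof.
move=> Dt; have := ginibre_void_ge hphi (measurable_flower t) (flower_le Dt).
apply: le_trans; have /andP[V0 V1] := V_bounds Dt.
have : 4 * r ^+ 2 * V t <= 4 * r ^+ 2 * (9 * r ^+ 2).
  by rewrite ler_wpM2l// mulr_ge0// sqr_ge0.
rewrite /V; have -> : (2 * r) ^+ 2 = 4 * r ^+ 2 by ring.
have -> : 4 * r ^+ 2 * (9 * r ^+ 2) = 36 * r ^+ 4 by ring.
by rewrite /flower_area -/(flower t); lra.
Qed.

Let fp_bounds (t : k.-tuple (plane R)) : tuple_pow D t ->
  1 - V t <= fp t <= 1 - V t + 81 * r ^+ 4.
Proof.
move=> Dt; have /andP[V0 V1] := V_bounds Dt; rewrite expR_ge1Dx/=.
have h : (1 + V t) * fp t <= 1.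
  by rewrite -[leRHS](expRxMexpNx_1 (V t)) ler_wpM2r ?expR_ge0 ?expR_ge1Dx.
have V2 : V t ^+ 2 <= 81 * r ^+ 4.
  have -> : 81 * r ^+ 4 = (9 * r ^+ 2) ^+ 2 by ring.
  by rewrite lerXn2r ?nnegrE// mulr_ge0// sqr_ge0.
apply: (@le_trans _ _ (1 - V t + V t ^+ 2)); last by rewrite lerD2l.
(* The bound e^(-V) <= 1 - V + V^2 follows from (1 + V) e^(-V) <= 1 <= 1 + V^3 after factoring the
   right side. *)
have : (1 + V t) * fp t <= (1 + V t) * (1 - V t + V t ^+ 2).
  apply: le_trans h _.
  have -> : (1 + V t) * (1 - V t + V t ^+ 2) = 1 + V t ^+ 3 by ring.
  by rewrite lerDl exprn_ge0.
by rewrite ler_pM2l//; lra.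
Qed.

Let A : R := (r ^+ 2 * pi) ^+ k.

Let A0 : 0 < A.
Proof. by rewrite exprn_gt0// mulr_gt0 ?exprn_gt0 ?pi_gt0. Qed.

Let Int_cst (c : R) : Int (fun=> c) = c * A.
Proof.
transitivity (c * fine (lebC D) ^+ k); first exact: tuple_pow_integral_cst.
by rewrite lebD.
Qed.

Let V_le (t : k.-tuple (plane R)) : tuple_pow D t -> `|V t| <= 9 * r ^+ 2.
Proof. by move=> /V_bounds/andP[V0 V1]; rewrite ger0_norm. Qed.

Let fg_norm (t : k.-tuple (plane R)) : tuple_pow D t -> `|fg t| <= 1.
Proof. by move=> _; rewrite ger0_norm ?fg_le1// fine_ge0. Qed.

Let fp_norm (t : k.-tuple (plane R)) : tuple_pow D t -> `|fp t| <= 1.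
Proof.
move=> /V_bounds/andP[V0 _].
by rewrite ger0_norm ?expR_ge0// expR_le1 oppr_le0.
Qed.

(** Scaling to the unit disc. Of the k+1 factors pi in [W_coeff], k normalise the volume [A] and one
    is already in [V]. *)
Let Int_V : Int V = A * (r ^+ 2 * @W_coeff R k).
Proof.
have mDk := measurable_tuple_pow (n := k) mD.
have [_ h1] := tuple_pow_integralE mD finD mV V_le.
have fin : (0 < (r ^+ 2) ^+ k.+1 :> R) by rewrite !exprn_gt0.
have := integral_flower_area_scale k r0.
rewrite (eq_integral (fun t => pi%:E * (V t)%:E)%E); last first.
  move=> t _; rewrite -EFinM /V mulrC divfK ?gt_eqF ?pi_gt0// fineK//.
  by rewrite ge0_fin_numE ?flower_finite.
rewrite ge0_integralZl ?lee_fin ?pi_ge0//; [|exact/measurable_EFinP/measurable_funTS|]; last first.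
  by move=> t /V_bounds/andP[V0 _]; rewrite lee_fin.
rewrite h1 => E.
have {}E : (\int[pm]_(t in tuple_pow (disc (0 : plane R) 1)) flower_area t =
    (((r ^+ 2) ^+ k.+1)^-1 * (pi * Int V))%:E)%E.
  by rewrite 2!EFinM E muleA -EFinM mulVf ?gt_eqF// mul1e.
have -> : @W_coeff R k = pi ^- k.+1 * (((r ^+ 2) ^+ k.+1)^-1 * (pi * Int V)).
  by rewrite /W_coeff; congr (_ * _); exact: (congr1 fine E).
rewrite /A; set x := r ^+ 2 in fin *;
rewrite (_ : (x * pi) ^+ k = x ^+ k * pi ^+ k); last exact: exprMn.
set I := Int V; rewrite (exprS x) (exprS pi).
have x0 : x != 0 by rewrite gt_eqF// /x exprn_gt0.
have p0 : (pi : R) != 0 by rewrite gt_eqF// pi_gt0.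
clearbody x I; have xk := expf_neq0 k x0; have pk := expf_neq0 k p0.
move: p0 pk; generalize (pi : R) => p p0 pk.
rewrite (_ : x ^+ k * p ^+ k * _ = x ^+ k * p ^+ k * x / (p * p ^+ k) / (x * x ^+ k) * p * I).
  by field; rewrite xk pk p0 x0.
by rewrite !mulrA.
Qed.

Let mean_g : mean_area_pow P k (fun w => voronoi_cell0 (phi w) `&` D) = (Int fg)%:E.
Proof.
have [_ <-] := tuple_pow_integralE mD finD mfg fg_norm.
rewrite (mean_area_powE P hphi.1 k mD); apply: eq_integral => t _.
have mv := measurable_empty_event hphi.1 (measurable_flower t).
by rewrite /fg fineK// fin_num_measure.
Qed.

Let mean_p : mean_area_pow P' k (fun w => voronoi_cell0 (Pi w) `&` D) = (Int fp)%:E.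
Proof.
have [_ <-] := tuple_pow_integralE mD finD mfp fp_norm.
have [pPi _ _] := hPi.
rewrite (mean_area_powE P' pPi k mD); apply: eq_integral => t _.
exact: poisson_void_flower.
Qed.

Let Int_cstB (c : R) : Int (fun t => c - V t) = c * A - Int V.
Proof.
rewrite -Int_cst -RintegralB//; last 2 first.
- exact: (@tuple_pow_integralE _ _ _ _ _ _ mD finD (fun=> c) `|c| (measurable_cst _) _).1.
- exact: (tuple_pow_integralE mD finD mV V_le).1.
by apply: eq_Rintegral => t _; rewrite mulrBr.
Qed.

Let Int_fp_gt0 : 0 < Int fp.
Proof.
apply: (@lt_le_trans _ _ (Int (fun=> expR (- (9 * r ^+ 2))))).
  by rewrite Int_cst mulr_gt0// expR_gt0.
apply: (tuple_pow_integral_le mD finD (M := 1) (N := 1)) => //.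
- by move=> t _; rewrite ger0_norm ?expR_ge0// expR_le1 oppr_le0 mulr_ge0// sqr_ge0.
- by move=> t /V_bounds/andP[_ V1]; rewrite ler_expR lerN2.
Qed.

(** Records that both means are finite and the Poisson one positive, so that the comparison takes
    place between real numbers. *)
Lemma small_radius_ratio :
  exists a b : R, [/\ 0 < b,
    mean_area_pow P k (fun w => voronoi_cell0 (phi w) `&` D) = a%:E,
    mean_area_pow P' k (fun w => voronoi_cell0 (Pi w) `&` D) = b%:E,
    0 <= @W_coeff R k
  & r ^+ 2 * @W_coeff R k <= 1 / 2 ->
    `|a / b - 1 - r ^+ 2 * @W_coeff R k| <=
    (2 * @W_coeff R k ^+ 2 + 316) * r ^+ 4].
Proof.
have W0 : 0 <= @W_coeff R k.
  rewrite mulr_ge0 ?invr_ge0 ?exprn_ge0 ?pi_ge0// fine_ge0// integral_ge0//.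
exists (Int fg), (Int fp); split => // W1.
have -> : r ^+ 4 = (r ^+ 2) ^+ 2 by rewrite -exprM.
have r4 : (r ^+ 2) ^+ 2 = r ^+ 4 by rewrite -exprM.
apply: (@ratio_expansion _ A) => //; rewrite ?sqr_ge0 ?r4//.
- rewrite mulrC -Int_cst.
  by apply: (tuple_pow_integral_le mD finD (M := `|1 - 36 * r ^+ 4|) (N := 1)).
- rewrite -[leRHS]mul1r -Int_cst.
  apply: (tuple_pow_integral_le mD finD (M := 1) (N := 1)) => //.
  by move=> t _; rewrite normr1.
- rewrite mulrBr mulr1 -Int_V -[X in X - _]mul1r -Int_cstB.
  apply: (tuple_pow_integral_le mD finD (M := 1 + 9 * r ^+ 2) (N := 1)) => //.
  + exact: measurable_funB.
  + by move=> t /V_le Vt; apply: le_trans (ler_normB _ _) _; rewrite normr1 lerD2l.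
  + by move=> t /fp_bounds/andP[].
have -> : A * (1 - r ^+ 2 * @W_coeff R k + 81 * r ^+ 4) =
    (1 + 81 * r ^+ 4) * A - A * (r ^+ 2 * @W_coeff R k) by ring.
rewrite -Int_V -Int_cstB.
apply: (tuple_pow_integral_le mD finD (M := 1) (N := (1 + 81 * r ^+ 4) + 9 * r ^+ 2)) => //.
- exact: measurable_funB.
- move=> t /V_le Vt; apply: le_trans (ler_normB _ _) _; apply: lerD => //.
  by rewrite ger0_norm// addr_ge0// mulr_ge0// exprn_ge0// ltW.
- by move=> t /fp_bounds/andP[_]; rewrite addrAC.
Qed.

End FixedRadius.

Lemma small_radius_expansion : exists e : R -> R,
  (e r / r ^+ 2 @[r --> 0^'+] --> (0 : R)) /\
  forall r : R, 0 < r ->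
    mean_area_pow P k (fun w => voronoi_cell0 (phi w) `&` disc 0 r) =
    (mean_area_pow P' k (fun w => voronoi_cell0 (Pi w) `&` disc 0 r)
     * (1 + r ^+ 2 * @W_coeff R k + e r)%:E)%E.
Proof.
pose W := @W_coeff R k; pose C := 2 * W ^+ 2 + 316.
pose a r := fine (mean_area_pow P k (fun w => voronoi_cell0 (phi w) `&` disc 0 r)).
pose b r := fine (mean_area_pow P' k (fun w => voronoi_cell0 (Pi w) `&` disc 0 r)).
(* The error is defined as whatever makes the identity exact for every r > 0; the content lies in
   its decay. *)
exists (fun r => a r / b r - 1 - r ^+ 2 * W); split; last first.
  move=> r r0; have [x [y [y0 Ea Eb _ _]]] := small_radius_ratio r0.
  rewrite /a /b Ea Eb -EFinM /=; congr EFin.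
  by rewrite -/W; field; rewrite gt_eqF.
have [_ [_ [_ _ _ W0 _]]] := small_radius_ratio (@ltr01 R).
have C0 : 0 < C.
  by rewrite /C ltr_wpDl ?ltr0n//; apply: mulr_ge0; [exact: ler0n|exact: sqr_ge0].
apply/cvgr0Pnorm_le => eps eps0; near=> r.
have r0 : 0 < r by near: r; exact: nbhs_right_gt.
have r1 : r < 1 by near: r; apply: nbhs_right_lt.
(* With r < 1 this yields r^2 W <= r (W + 1) <= 1/2, the smallness required by the ratio estimate;
   [W + 1] is positive even if [W] vanishes. *)
have rW : r < (2 * (W + 1))^-1.
  by near: r; apply: nbhs_right_lt; rewrite invr_gt0 mulr_gt0// ltr_wpDl.
have rC : r < eps / C by near: r; apply: nbhs_right_lt; rewrite divr_gt0.
have [x [y [y0 Ea Eb _ h]]] := small_radius_ratio r0.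
rewrite /a /b Ea Eb /= normrM normfV [X in _ / X]ger0_norm ?sqr_ge0//.
rewrite ler_pdivrMr ?exprn_gt0//.
have rr : r ^+ 2 <= r by rewrite expr2 ler_piMr ?ltW.
apply: le_trans (h _) _.
  apply: (@le_trans _ _ (r * (W + 1))).
    by apply: ler_pM; rewrite ?sqr_ge0// lerDl.
  by move: rW; rewrite -[_^-1]mul1r ltr_pdivlMr ?mulr_gt0 ?ltr_wpDl// => ?; lra.
rewrite -/W -/C (exprD r 2 2) mulrA ler_wpM2r ?sqr_ge0//.
apply: le_trans (ler_wpM2l (ltW C0) rr) _.
by rewrite mulrC -ler_pdivlMr// ltW.
Unshelve. all: by end_near.
Qed.

End SmallRadius.

(** * Large radii *)

Section LargeRadius.
Context {R : realType} {d d' : measure_display} {Omega : measurableType d}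
  {Omega' : measurableType d'}.
Variables (P : probability Omega R) (P' : probability Omega' R).
Variables (phi : Omega -> set (plane R)) (Pi : Omega' -> set (plane R)).
Hypothesis hphi : determinantal P (@ginibre_palm_kernel R) phi.
Hypothesis hPi : poisson_process P' (fun A => (pi^-1)%:E * lebC A)%E Pi.
Variable k : nat.

(** For k > 0 there is a point z_i to choose, and |z_i| >= r, so the flower contains the disc of
    radius r centred at z_i; the void bound accepts any centre. *)
Lemma large_radius_J (r : R) : (0 < k)%N ->
  (mean_area_pow P k (fun w => voronoi_cell0 (phi w) `\` disc 0 r) <=
   mean_area_pow P' k (fun w => voronoi_cell0 (Pi w) `\` disc 0 r)
   * (expR (3 / 2 - J_coeff r))%:E)%E.
Proof.
move=> hk; apply: (@mean_area_pow_le _ _ _ _ _ P P' phi Pi hphi.1 hPi k (~` disc 0 r)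
  (expR (3 / 2 - J_coeff r))); last move=> t Dt.
- exact: measurableC (measurable_disc _ _).
- exact: expR_ge0.
apply: (ginibre_void_le_J hphi (measurable_flower t)
  (flower_bounded (tuple_cabs_bounded t)) (c := tnth t (Ordinal hk))).
move=> z zr; exists (Ordinal hk) => //; apply: lt_le_trans zr _.
by have /negP := Dt (Ordinal hk); rewrite /disc/= subr0 -leNgt.
Qed.

Lemma mean_area_pow_compl_le1 (r : R) :
  (mean_area_pow P k (fun w => voronoi_cell0 (phi w) `\` disc 0 r) <=
   mean_area_pow P' k (fun w => voronoi_cell0 (Pi w) `\` disc 0 r)
   * (expR 1)%:E)%E.
Proof.
apply: (@mean_area_pow_le _ _ _ _ _ P P' phi Pi hphi.1 hPi k (~` disc 0 r) (expR 1));
  last move=> t Dt.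
- exact: measurableC (measurable_disc _ _).
- exact: expR_ge0.
apply: (ginibre_void_le1 hphi (measurable_flower t)).
exact: flower_bounded (tuple_cabs_bounded t).
Qed.

Lemma large_radius_quadratic : (0 < k)%N -> exists c : R, 0 < c /\
  forall r : R, 0 < r ->
  (mean_area_pow P k (fun w => voronoi_cell0 (phi w) `\` disc 0 r) <=
   mean_area_pow P' k (fun w => voronoi_cell0 (Pi w) `\` disc 0 r)
   * (expR (3 / 2 - c * r ^+ 2))%:E)%E.
Proof.
(* The constant of [J_coeff_ge]. For r < 2 it makes c r^2 at most 4/(8e) <= 1/2, so 3/2 - c r^2 is
   still at least 1, the exponent available without J. *)
move=> hk; exists (8 * expR 1)^-1; split=> [|r r0].
  by rewrite invr_gt0 mulr_gt0// expR_gt0.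
have pos : (0 <= mean_area_pow P' k (fun w => voronoi_cell0 (Pi w) `\` disc 0 r))%E.
  by apply: integral_ge0 => w _; apply: expe_ge0.
have [r2|r2] := leP 2 r.
  apply: le_trans (large_radius_J r hk) _; apply: lee_wpmul2l => //.
  by rewrite lee_fin ler_expR lerD2l lerN2 J_coeff_ge.
apply: le_trans (mean_area_pow_compl_le1 r) _; apply: lee_wpmul2l => //.
rewrite lee_fin ler_expR.
have e1 : 1 <= expR 1 :> R by rewrite -[leLHS]expR0 ler_expR.
have : (8 * expR 1)^-1 * r ^+ 2 <= 1 / 2.
  rewrite mulrC ler_pdivrMr ?mulr_gt0 ?expR_gt0//.
  have : r ^+ 2 <= 2 ^+ 2 by rewrite lerXn2r ?nnegrE// ltW.
  by move: e1; lra.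
by lra.
Qed.

End LargeRadius.

Theorem theorem4 (R : realType)
  (d : measure_display) (Omega : measurableType d) (P : probability Omega R)
  (phi0 : Omega -> set (plane R))
  (d' : measure_display) (Omega' : measurableType d') (P' : probability Omega' R)
  (Pi : Omega' -> set (plane R))
  (hphi0 : determinantal P ginibre_palm_kernel phi0)
  (hPi : poisson_process P' (fun A => (pi^-1)%:E * lebC A)%E Pi)
  (k : nat) (hk : (0 < k)%N) :
  (exists e : R -> R,
     (e r / r ^+ 2 @[r --> 0^'+] --> (0 : R)) /\
     forall r : R, 0 < r ->
       mean_area_pow P k (fun w => voronoi_cell0 (phi0 w) `&` disc 0 r) =
       (mean_area_pow P' k (fun w => voronoi_cell0 (Pi w) `&` disc 0 r)
        * (1 + r ^+ 2 * W_coeff k + e r)%:E)%E) /\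
  (forall r : R, 0 < r ->
     (mean_area_pow P k (fun w => voronoi_cell0 (phi0 w) `\` disc 0 r) <=
      mean_area_pow P' k (fun w => voronoi_cell0 (Pi w) `\` disc 0 r)
      * (expR (3 / 2 - J_coeff r))%:E)%E) /\
  (exists c : R, 0 < c /\ forall r : R, 0 < r ->
     (mean_area_pow P k (fun w => voronoi_cell0 (phi0 w) `\` disc 0 r) <=
      mean_area_pow P' k (fun w => voronoi_cell0 (Pi w) `\` disc 0 r)
      * (expR (3 / 2 - c * r ^+ 2))%:E)%E).
Proof.
split; first exact: small_radius_expansion.
split; last exact: large_radius_quadratic.
by move=> r _; exact: large_radius_J.
Qed.
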